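(* Let $(Y_1,Z_1)$ and $(Y_2,Z_2)$ solve the Malliavin weights dynamic programming equations (MWDP, see context) with terminal conditions/drivers $(\xi_1,(f_{1,i})_i)$ and $(\xi_2,(f_{2,i})_i)$ respectively, where $\xi_1,\xi_2\in\mathbf L_2(\mathcal F_T)$. Assume that, for each $i\in\{0,\dots,N-1\}$, $f_{1,i}(Y_{1,i+1},Z_{1,i})\in\mathbf L_2(\mathcal F_T)$, and that there are $\theta_L\in(0,1]$ and $L_{f_2}\in[0,\infty)$ with $$|f_{2,i}(y,z)-f_{2,i}(y',z')|\le\frac{L_{f_2}}{(T-t_i)^{(1-\theta_L)/2}}\big(|y-y'|+|z-z'|\big)\qquad\text{for all }y,y'\in\mathbb R,\ z,z'\in(\mathbb R^q)^\top.$$ Assume that the weights satisfy, for all $0\le i<j\le N$, $\mathbb E_i[H^{(i)}_j]=0$ and $(\mathbb E_i[|H^{(i)}_j|^2])^{1/2}\le C_M(t_j-t_i)^{-1/2}$ for a finite constant $C_M\ge0$. Set $\Delta Y:=Y_1-Y_2$, $\Delta Z:=Z_1-Z_2$, $\Delta\xi:=\xi_1-\xi_2$, $\Delta f_i:=f_{1,i}(Y_{1,i+1},Z_{1,i})-f_{2,i}(Y_{1,i+1},Z_{1,i})$. Then there are finite constants $B_{a,b}$ ($a,b>0$) depending only on $(R_\pi,a,b)$ and $\Gamma_\gamma$ ($\gamma\in\{\tfrac12,1\}$) depending only on $(L_{f_2}(C_M+\sqrt T),T,\theta_L,R_\pi,\gamma)$, having the properties (P1) and (P2) of the context, such that $$|\Delta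 Y_i|_{2,k}\le C^{(1)}_y|\Delta\xi|_{2,k}+C^{(2)}_y\sum_{j=i}^{N-1}|\Delta f_j|_{2,k}\Delta_j,\qquad0\le k\le i\le N,$$ $$|\Delta Z_i|_{2,k}\le C^{(1)}_z\frac{|\Delta\xi-\mathbb E_i\Delta\xi|_{2,k}}{\sqrt{T-t_i}}+C^{(2)}_z\sum_{j=i+1}^{N-1}\frac{|\Delta f_j|_{2,k}}{\sqrt{t_j-t_i}}\Delta_j+C^{(3)}_z|\Delta\xi|_{2,k}(T-t_i)^{\theta_L/2},\qquad0\le k\le i<N,$$ where $$C^{(1)}_y:=1+L_{f_2}\Gamma_1\big(C_MB_{\theta_L/2,1}+B_{1/2+\theta_L/2,1}\sqrt T\big)T^{\theta_L/2},$$ $$C^{(2)}_y:=1+L_{f_2}\Gamma_1(C_M+\sqrt T)B_{\theta_L/2,1}T^{\theta_L/2},$$ $$C^{(1)}_z:=C_M\big(1+L_{f_2}\Gamma_{1/2}C_MB_{\theta_L/2,1/2}T^{\theta_L/2}\big),$$ $$C^{(2)}_z:=C_M\big(1+L_{f_2}\Gamma_{1/2}(C_M+\sqrt T)B_{\theta_L/2,1/2}T^{\theta_L/2}\big),$$ $$C^{(3)}_z:=C_ML_{f_2}\Gamma_{1/2}B_{1/2+\theta_L/2,1/2}.$$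
   Context: **Setting.** $T>0$; $(\Omega,\mathcal F,(\mathcal F_t)_{0\le t\le T},\mathbb P)$ is a filtered probability space (augmented with null sets); $\pi=\{0=t_0<\dots<t_N=T\}$ is a time-grid, $\Delta_i:=t_{i+1}-t_i$, and $\max_{0\le i\le N-2}\Delta_{i+1}/\Delta_i\le R_\pi$ for a fixed $R_\pi>0$. $\mathbb E_i[\cdot]:=\mathbb E[\cdot\mid\mathcal F_{t_i}]$; for a random variable $U$, $|U|_{2,k}:=\sqrt{\mathbb E_k[|U|^2]}$; $|\cdot|$ is the Euclidean norm; $(\mathbb R^q)^\top$ denotes row vectors. The weights $H^{(i)}_j$ ($0\le i<j\le N$) are $(\mathbb R^q)^\top$-valued random variables in $\mathbf L_2(\mathcal F_T,\mathbb P)$. Inequalities between random variables are almost sure. **MWDP.** $(Y,Z)$ solves the MWDP with terminal condition $\xi$ and driver $f_i(\omega,y,z)$ if $$Y_i=\mathbb E_i\Big[\xi+\sum_{j=i}^{N-1}f_j(Y_{j+1},Z_j)\Delta_j\Big]\ (0\le i\le N),\qquad Z_i=\mathbb E_i\Big[\xi H^{(i)}_N+\sum_{j=i+1}^{N-1}f_j(Y_{j+1},Z_j)H^{(i)}_j\Delta_j\Big]\ (0\le i\le N-1),$$ the conditional expectations being well defined. In this statement the drivers $f_{1,i},f_{2,i}:\Omega\times\mathbb R\times(\mathbb R^q)^\top\to\mathbb R$ are jointly measurable but not required to be adapted, and $f_{1,i}$ need not be Lipschitz. **(P1)** For $a,b>0$ and all $0\le i<k\le N$: $\sum_{j=i}^{k-1}\frac{\Delta_j}{(t_k-t_j)^{1-a}}\le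 B_{a,1}(t_k-t_i)^a$ and $\sum_{j=i+1}^{k-1}\frac{\Delta_j}{(t_k-t_j)^{1-a}(t_j-t_i)^{1-b}}\le B_{a,b}(t_k-t_i)^{a+b-1}$. **(P2)** With $c:=L_{f_2}(C_M+\sqrt T)$: whenever $k\in\{0,\dots,N-1\}$ and finite non-negative sequences $(u_l)_{l\ge k},(w_l)_{l\ge k}$ satisfy $u_j\le w_j+c\sum_{l=j+1}^{N-1}\frac{u_l\Delta_l}{(T-t_l)^{(1-\theta_L)/2}(t_l-t_j)^{1/2}}$ for $k\le j\le N$, then $\sum_{l=j+1}^{N-1}\frac{u_l\Delta_l}{(T-t_l)^{(1-\theta_L)/2}(t_l-t_j)^{1-\gamma}}\le\Gamma_\gamma\sum_{l=j+1}^{N-1}\frac{w_l\Delta_l}{(T-t_l)^{(1-\theta_L)/2}(t_l-t_j)^{1-\gamma}}$ for $k\le j\le N$. *)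

(* Defs.v *)
From HB Require Import structures.
From mathcomp Require Import all_boot all_order all_algebra.
From mathcomp Require Import all_classical all_reals all_analysis.
From mathcomp Require Import measurable_realfun.

Set Implicit Arguments.
Unset Strict Implicit.
Unset Printing Implicit Defensive.

Import Order.TTheory GRing.Theory Num.Theory.
Import numFieldNormedType.Exports.

Local Open Scope classical_set_scope.
Local Open Scope ring_scope.

Section time_grid.
Context {R : realType}.
Implicit Types (t : nat -> R) (T Rpi a b c gamma theta : R) (i j k l N : nat).

Definition time_grid T N t : Prop :=
  [/\ t 0%N = 0, t N = T & forall i, (i < N)%N -> t i < t i.+1].

Definition step t i : R := t i.+1 - t i.

Definition step_ratio_le N t Rpi : Prop :=
  forall i, (i.+2 <= N)%N -> step t i.+1 / step t i <= Rpi.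

Definition kernel_sum_bounds N t (B : R -> R -> R) : Prop :=
  forall a b, 0 < a -> 0 < b -> forall i k, (i < k <= N)%N ->
    \sum_(i <= j < k) step t j / (t k - t j) `^ (1 - a)
      <= B a 1 * (t k - t i) `^ a
    /\
    \sum_(i.+1 <= j < k)
        step t j / ((t k - t j) `^ (1 - a) * (t j - t i) `^ (1 - b))
      <= B a b * (t k - t i) `^ (a + b - 1).

Definition weighted_sum T N t theta gamma (u : nat -> R) j : R :=
  \sum_(j.+1 <= l < N)
    u l * step t l / ((T - t l) `^ ((1 - theta) / 2) * (t l - t j) `^ (1 - gamma)).

(* The kernel exponent 1/2 in the hypothesis on u is 1 - gamma for
   gamma = 1/2. *)
Definition gronwall_bound T N t theta c gamma (Gamma : R) : Prop :=
  forall k, (k < N)%N -> forall u w : nat -> R,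
    (forall l, (k <= l)%N -> 0 <= u l) ->
    (forall l, (k <= l)%N -> 0 <= w l) ->
    (forall j, (k <= j <= N)%N ->
       u j <= w j + c * weighted_sum T N t theta 2^-1 u j) ->
    forall j, (k <= j <= N)%N ->
      weighted_sum T N t theta gamma u j
        <= Gamma * weighted_sum T N t theta gamma w j.

End time_grid.

Section conditioning.
Context {R : realType} {d : measure_display} {Omega : measurableType d}.
Context (P : probability Omega R).
Implicit Types (G : set_system Omega) (F : R -> set_system Omega).

Definition measurable_wrt G d' (U : sigmaRingType d') (X : Omega -> U) : Prop :=
  forall B, measurable B -> G (X @^-1` B).

(* Only the measurable P-null sets are required to belong to F s: P need not
   be complete. *)
Definition augmented_filtration (T : R) F : Prop :=
  [/\ forall s, 0 <= s <= T -> sigma_algebra setT (F s) /\ F s `<=` measurable,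
      forall s s', 0 <= s -> s <= s' -> s' <= T -> F s `<=` F s' &
      forall s, 0 <= s <= T ->
        forall A, measurable A -> P A = 0%E -> F s A].

Definition is_condE G (X V : Omega -> \bar R) : Prop :=
  measurable_wrt G V /\
  forall A, G A -> (\int[P]_(w in A) V w = \int[P]_(w in A) X w)%E.

(* A version of E[X | G].  By the Radon-Nikodym theorem one exists, and it is
   P-a.s. unique, as soon as X is integrable, or measurable and nonnegative
   (it is then [0, +oo]-valued); condE is only used in these two cases. *)
Definition condE G (X : Omega -> \bar R) : Omega -> \bar R :=
  xget (cst 0%E) [set V | is_condE G X V].

(* |U|_{2,G} = E[|U|^2 | G]^(1/2), possibly +oo; for a vector-valued U it is
   applied to the Euclidean norm of U. *)
Definition cond_norm2 G (U : Omega -> R) (w : Omega) : \bar R :=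
  sqrte (condE G (fun w' => (U w' ^+ 2)%:E) w).

Definition L2 G (X : Omega -> R) : Prop :=
  measurable_wrt G X /\ X \in Lfun P 2%:E.

Definition real_condE G (X V : Omega -> R) : Prop :=
  P.-integrable setT (EFin \o X) /\ is_condE G (EFin \o X) (EFin \o V).

End conditioning.

Section MWDP.
Context {R : realType} {d : measure_display} {Omega : measurableType d}.
Context (q : nat).

(* The library norm on row vectors is the sup norm. *)
Definition enorm (v : 'rV[R]_q) : R := Num.sqrt (\sum_l v 0 l ^+ 2).

(* 'rV[R]_q carries no measurable structure in the library; it is identified
   with q.-tuple R, whose product sigma-algebra is the Borel one. *)
Definition jointly_measurable (f : Omega -> R -> 'rV[R]_q -> R) : Prop :=
  measurable_fun setT (fun p : Omega * R * q.-tuple R =>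
    f p.1.1 p.1.2 (\row_l tnth p.2 l)).

Definition solves_MWDP (P : probability Omega R) (F : R -> set_system Omega)
    (N : nat) (t : nat -> R) (H : nat -> nat -> Omega -> 'rV[R]_q)
    (xi : Omega -> R) (f : nat -> Omega -> R -> 'rV[R]_q -> R)
    (Y : nat -> Omega -> R) (Z : nat -> Omega -> 'rV[R]_q) : Prop :=
  (forall i, (i <= N)%N ->
     real_condE P (F (t i))
       (fun w => xi w + \sum_(i <= j < N) f j w (Y j.+1 w) (Z j w) * step t j)
       (Y i))
  /\
  (forall i, (i < N)%N -> forall l : 'I_q,
     real_condE P (F (t i))
       (fun w => xi w * H i N w 0 l
          + \sum_(i.+1 <= j < N)
              f j w (Y j.+1 w) (Z j w) * H i j w 0 l * step t j)
       (fun w => Z i w 0 l)).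

End MWDP.

(* Main.v *)
Require Import Defs.
From HB Require Import structures.
From mathcomp Require Import all_boot all_order all_algebra.
From mathcomp Require Import all_classical all_reals all_analysis.
From mathcomp Require Import measurable_realfun.
From mathcomp Require Import ring lra zify.

Set Implicit Arguments.
Unset Strict Implicit.
Unset Printing Implicit Defensive.

Import Order.TTheory GRing.Theory Num.Theory.
Import numFieldNormedType.Exports.

Local Open Scope classical_set_scope.
Local Open Scope ring_scope.

(**
The conditional norms [cond_norm2] obey Minkowski's and Cauchy-Schwarz's
inequalities, so taking them in the equations for [Y1 - Y2] and [Z1 - Z2], where
[E_i H = 0] allows [xi] to be centered in the second one, yields pathwise
recursive inequalities with the kernel [(t l - t j)^(-1/2) (T - t l)^((theta-1)/2)].
Their sum [|dY_(j+1)| + |dZ_j|] satisfies the hypothesis of (P2). The discrete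
Gronwall inequality (P2) itself holds since, after weighting by [exp(lam t)] with
[lam] large, the Volterra operator halves norms. The resulting sums are evaluated
with (P1), obtained by comparing each sum with an integral. Finally,
[|dxi - E_l dxi| <= 2 |dxi - E_i dxi|] for [i <= l]; this factor 2 and the
factor 2 of the Gronwall inequality are why [Gamma] is [4 exp(lam T)].
*)

(** The obstacle is integrability: [f2] along the first solution is not assumed square integrable,
    so the conditional norms of the driver gaps may be [+oo]. Norms therefore live in the extended
    reals, and conditional inequalities are obtained by comparing integrals over the sets of the
    sub-sigma-algebra instead of by subtracting. The finite case is recovered path by path: either
    an infinite driver gap makes the right-hand side infinite, or backward induction makes every
    norm finite and real arithmetic applies.

    Quadratic inequalities are conditioned in linear form, with a rational parameter optimised
    afterwards, so that countably many null sets suffice.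

    In the Gronwall step, exchanging the two sums pairs the nodes [t l < t m]; as
    [T - t l >= t m - t l], the two singular factors merge into the single kernel
    [(t m - t l)^(theta/2 - 1)]. Half of the exponent [theta/2] pays for the smallness gained from
    the exponential weight, and the remaining [theta/4] keeps the kernel summable by (P1). *)

(** * Radon-Nikodym on a sub-sigma-algebra: conditioning bounded variables *)

Section sub_sigma_algebra.
Context {R : realType} {d : measure_display} {Omega : measurableType d}.
Variables (P : probability Omega R) (G : set_system Omega).
Hypotheses (sG : sigma_algebra setT G) (GM : G `<=` measurable).

(** Turning [G] into the sigma-algebra of a measurable type makes the closure properties of
    measurable functions, and the Radon-Nikodym theorem, available for [G]. *)
Local Notation GT := (g_sigma_algebraType G).
Local Open Scope ereal_scope.

Lemma measurable_GT (A : set Omega) : (measurable (A : set GT)) = G A.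
Proof. by rewrite -[in RHS](measurable_g_measurableTypeE sG). Qed.

Lemma measurable_wrtE d' (U : measurableType d') (X : Omega -> U) :
  measurable_wrt G X <-> measurable_fun setT (X : GT -> U).
Proof.
split => [h _ B mB|h B mB]; first by rewrite setTI measurable_GT; exact: h.
by rewrite -measurable_GT -[X in measurable X]setTI; exact: h.
Qed.

Lemma measurable_wrt_fun d' (U : measurableType d') (X : Omega -> U) :
  measurable_wrt G X -> measurable_fun setT X.
Proof. by move=> h _ B mB; rewrite setTI; exact/GM/h. Qed.

(** The proofs [mX] and [X0] are arguments so that the measure structure declared below can be
    inferred from the term itself. *)
Definition density (X : Omega -> \bar R) (mX : measurable_fun setT X)
  (X0 : forall w, 0 <= X w) : set GT -> \bar R := fun A => \int[P]_(w in A) X w.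

Section density.
Variables (X : Omega -> \bar R) (mX : measurable_fun setT X).
Hypothesis X0 : forall w, 0 <= X w.
Local Notation nu := (density mX X0).

Let density0 : nu set0 = 0. Proof. exact: integral_set0. Qed.
Let density_ge0 A : 0 <= nu A. Proof. exact: integral_ge0. Qed.
Let density_sigma_additive : semi_sigma_additive nu.
Proof.
move=> F mF tF mUF; apply: semi_sigma_additive_nng_induced => //.
- by move=> i; apply: GM; rewrite -measurable_GT; exact: mF.
- by apply: GM; rewrite -measurable_GT.
Qed.
HB.instance Definition _ := isMeasure.Build _ _ _ nu
  density0 density_ge0 density_sigma_additive.
End density.

Definition restrG : set GT -> \bar R := fun A => P A.
Let restr0 : restrG set0 = 0. Proof. exact: measure0. Qed.
Let restr_ge0 A : 0 <= restrG A. Proof. exact: measure_ge0. Qed.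
Let restr_sigma_additive : semi_sigma_additive restrG.
Proof.
move=> F mF tF mUF; apply: measure_semi_sigma_additive => //.
- by move=> i; apply: GM; rewrite -measurable_GT; exact: mF.
- by apply: GM; rewrite -measurable_GT.
Qed.
HB.instance Definition _ := isMeasure.Build _ _ _ restrG
  restr0 restr_ge0 restr_sigma_additive.

Let restr_fin : fin_num_fun restrG.
Proof. by move=> A mA; apply: fin_num_measure; apply: GM; rewrite -measurable_GT. Qed.
HB.instance Definition _ := Measure_isFinite.Build _ _ _ restrG restr_fin.

(** [restrG] is the image of [P] under the identity map from [Omega] to [GT], so this is a change of
    variables. *)
Lemma restrG_integral (A : set Omega) (f : Omega -> \bar R) : G A ->
  measurable_wrt G f -> (forall w, 0 <= f w) ->
  \int[restrG]_(w in (A : set GT)) f w = \int[P]_(w in A) f w.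
Proof.
move=> GA Gf f0.
have mid : measurable_fun setT (id : Omega -> GT).
  by move=> _ B mB; rewrite setTI; apply: GM; rewrite -measurable_GT.
transitivity (\int[pushforward P (id : Omega -> GT)]_(w in (A : set GT)) f w).
  by [].
rewrite (ge0_integral_pushforward mid) ?measurable_GT//.
by apply: measurable_funTS; apply/measurable_wrtE.
Qed.

(** The bound by 1 makes the measure with density [X] finite; its restriction to [G] is dominated by
    that of [P], and the Radon-Nikodym derivative is the required version. *)
Lemma ex_condE_bounded (X : Omega -> \bar R) : measurable_fun setT X ->
  (forall w, 0 <= X w <= 1) ->
  exists V, is_condE P G X V /\ forall w, 0 <= V w.
Proof.
move=> mX X01; have X0 w : 0 <= X w by case/andP: (X01 w).
pose nu := density mX X0.
have nufin : fin_num_fun nu.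
  move=> A mA; rewrite ge0_fin_numE ?integral_ge0//.
  have GA : measurable (A : set Omega) by apply: GM; rewrite -measurable_GT.
  apply: (@le_lt_trans _ _ (\int[P]_(w in A) (cst 1) w)).
    apply: ge0_le_integral => //; first exact: measurable_funTS.
    by move=> w _; case/andP: (X01 w).
  by rewrite integral_cst// mul1e; apply: (le_lt_trans (probability_le1 P _)) => //; rewrite ltry.
pose nuM := Measure_isFinite.Build _ _ _ nu nufin.
pose nuF : {finite_measure set GT -> \bar R} := HB.pack nu nuM.
have dom : nuF `<< restrG.
  apply/null_content_dominatesP => A mA A0.
  have GA : measurable (A : set Omega) by apply: GM; rewrite -measurable_GT.
  by apply: null_set_integral => //; exact: measurable_funTS.
have [f [f0 intf fE]] := radon_nikodym_finite dom.
have Gf : measurable_wrt G f by apply/measurable_wrtE; exact: measurable_int intf.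
exists f; split => //; split => // A GA.
rewrite -restrG_integral// -fE ?measurable_GT//.
Qed.

End sub_sigma_algebra.

(** * Existence and comparison of conditional expectations of nonnegative variables *)

Section cond_nonneg.
Context {R : realType} {d : measure_display} {Omega : measurableType d}.
Variables (P : probability Omega R) (G : set_system Omega).
Hypotheses (sG : sigma_algebra setT G) (GM : G `<=` measurable).
Local Open Scope ereal_scope.
Implicit Types X Y U V : Omega -> \bar R.

(** The horizontal slices of [x] between consecutive integers telescope to [min(x, n)]. Each slice
    lies in [[0, 1]], also when [x = +oo], which reduces [ex_condE] to the bounded case. *)
Lemma mine_nat_cvg (x : \bar R) : 0 <= x ->
  limn (fun n => \sum_(0 <= k < n) (mine x k.+1%:R%:E - mine x k%:R%:E)) = x.
Proof.
move=> x0.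
have fin k : mine x k%:R%:E \is a fin_num.
  rewrite ge0_fin_numE ?le_min ?x0 ?lee_fin ?ler0n//.
  by rewrite gt_min ltry orbT.
have -> : (fun n => \sum_(0 <= k < n) (mine x k.+1%:R%:E - mine x k%:R%:E)) =
    (fun n => mine x n%:R%:E).
  apply/funext => n.
  rewrite (@telescope_sume _ 0 n (fun k => mine x k%:R%:E))//.
  by rewrite (_ : mine x 0%:R%:E = 0) ?sube0//; apply/min_idPr.
apply: cvg_lim => //.
case: x x0 {fin} => [r r0|_|//].
- apply: cvg_near_cst.
  near=> n; apply/min_idPl; rewrite lee_fin.
  by near: n; exact: nbhs_infty_ger.
- rewrite (_ : (fun n => _) = fun n => n%:R%:E); last first.
    by apply/funext => n; apply/min_idPr; rewrite leey.
  exact/cvgeryP/cvgr_idn.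
Unshelve. all: by end_near. Qed.

Lemma ex_condE X : measurable_fun setT X -> (forall w, 0 <= X w) ->
  exists V, is_condE P G X V.
Proof.
move=> mX X0.
pose Xn n w := mine (X w) n.+1%:R%:E - mine (X w) n%:R%:E.
have fin n w : mine (X w) n%:R%:E \is a fin_num.
  rewrite ge0_fin_numE ?le_min ?X0 ?lee_fin ?ler0n//.
  by rewrite gt_min ltry orbT.
have mXn n : measurable_fun setT (Xn n).
  by apply: emeasurable_funB; apply: measurable_mine.
have Xn01 n w : 0 <= Xn n w <= 1.
  rewrite /Xn sube_ge0 ?fin//; apply/andP; split.
    by rewrite le_min !ge_min lexx/= lee_fin ler_nat leqnSn orbT.
  rewrite leeBlDr ?fin// ge_min.
  case: (leP (X w) n%:R%:E) => h; first by rewrite leeDr// lee_fin.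
  by rewrite -EFinD lee_fin -natr1 addrC lexx orbT.
have /choice[Vn VnP0] n : exists V, is_condE P G (Xn n) V /\ forall w, 0 <= V w.
  exact: ex_condE_bounded.
have VnP n := (VnP0 n).1; have Vn0 n := (VnP0 n).2.
exists (fun w => \sum_(0 <= n <oo) Vn n w).
have mVn n : measurable_fun setT (Vn n).
  by have := measurable_wrt_fun GM (proj1 (VnP n)).
split.
  apply/(measurable_wrtE sG).
  apply: (@ge0_emeasurable_sum _ _ _ _ _ xpredT) => // n _.
  by apply/(measurable_wrtE sG); case: (VnP n).
move=> A GA; have mA := GM GA.
rewrite integral_nneseries//; last by move=> n; exact: measurable_funTS.
under eq_eseriesr do rewrite (proj2 (VnP _))//.
rewrite -integral_nneseries//.
- by apply: eq_integral => w _; exact: mine_nat_cvg.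
- by move=> n; exact: measurable_funTS.
- by move=> n w _; case/andP: (Xn01 n w).
Qed.

Lemma condE_is_condE X : measurable_fun setT X -> (forall w, 0 <= X w) ->
  is_condE P G X (condE P G X).
Proof. by move=> mX X0; apply: (@xgetPex _ _ [set V | is_condE P G X V]); exact: ex_condE. Qed.

(** The set where [V < 0] belongs to [G], and the integral of [V] over it equals that of [X], which
    is nonnegative. *)
Lemma is_condE_ge0 X V : (forall w, 0 <= X w) -> is_condE P G X V ->
  {ae P, forall w, 0 <= V w}.
Proof.
move=> X0 [GV VX].
have mV := measurable_wrt_fun GM GV.
pose A := [set w | V w < 0].
have GA : G A.
  rewrite -(measurable_GT sG) -[X in measurable X]setTI.
  by apply: emeasurable_fun_infty_o => //; apply/(measurable_wrtE sG).
have mA := GM GA.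
have mNV : measurable_fun A (\- V) by apply: measurable_funTS; apply: measurableT_comp.
have NV0 w : A w -> 0 <= (\- V) w by move=> /= Aw; rewrite oppe_ge0 ltW.
have : \int[P]_(w in A) `|(\- V) w| = 0.
  rewrite (eq_integral (\- V)); last by move=> w /[!inE] Aw; rewrite gee0_abs ?NV0.
  apply/eqP; rewrite eq_le integral_ge0// andbT -oppe_ge0 -integral_ge0N//.
  rewrite (eq_integral V); last by move=> w _ /=; rewrite oppeK.
  by rewrite VX// integral_ge0.
move=> /ae_eq_integral_abs -/(_ mA mNV) h.
apply: filterS h => w /= h; rewrite leNgt; apply/negP => Aw.
by have := h Aw => /eqP; rewrite oppe_eq0 => /eqP V0; rewrite /A V0 ltxx in Aw.
Qed.

(** The integral of [U] over the set where [V > U] may be infinite, so nothing can be cancelled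
    there. That set is exhausted by the [A n], on which [U] is at most [n] and [V] exceeds it by at
    least [1 / (n+1)]. *)
Lemma integral_le_ae U V : measurable_wrt G U -> measurable_wrt G V ->
  (forall A, G A -> (forall w, A w -> 0 <= U w /\ 0 <= V w) ->
    \int[P]_(w in A) V w <= \int[P]_(w in A) U w) ->
  {ae P, forall w, 0 <= U w -> V w <= U w}.
Proof.
move=> GU GV h.
have mU := measurable_wrt_fun GM GU; have mV := measurable_wrt_fun GM GV.
pose A n := [set w | 0 <= U w] `&` [set w | U w <= n%:R%:E] `&`
  [set w | 0 <= V w - (U w + (n.+1%:R^-1)%:E)].
have GA n : G (A n).
  rewrite -(measurable_GT sG).
  have mU' : measurable_fun setT (U : g_sigma_algebraType G -> _) by apply/(measurable_wrtE sG).
  have mV' : measurable_fun setT (V : g_sigma_algebraType G -> _) by apply/(measurable_wrtE sG).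
  apply: measurableI; first apply: measurableI.
  - by rewrite -[X in measurable X]setTI; exact: emeasurable_fun_c_infty.
  - by rewrite -[X in measurable X]setTI; exact: emeasurable_fun_infty_c.
  - rewrite -[X in measurable X]setTI; apply: emeasurable_fun_c_infty => //.
    by apply: emeasurable_funB => //; apply: emeasurable_funD.
have Afin n w : A n w -> U w \is a fin_num.
  move=> -[[/= U0 Un] _]; rewrite ge0_fin_numE//.
  by rewrite (le_lt_trans Un)// ltry.
have AV n w : A n w -> U w + (n.+1%:R^-1)%:E <= V w.
  by move=> Aw; have [_ /=] := Aw; rewrite sube_ge0// fin_numD (Afin _ _ Aw).
have PA n : P (A n) = 0.
  have mA := GM (GA n).
  have U0 w : A n w -> 0 <= U w by case=> -[].
  have Ufin : \int[P]_(w in A n) U w \is a fin_num.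
    rewrite ge0_fin_numE ?integral_ge0//.
    apply: (@le_lt_trans _ _ (\int[P]_(w in A n) (cst n%:R%:E) w)).
      apply: ge0_le_integral => //; first exact: measurable_funTS.
      by move=> w [[]].
    rewrite integral_cst//; apply: (@le_lt_trans _ _ (n%:R%:E * 1)).
      by apply: lee_wpmul2l; rewrite ?lee_fin ?ler0n ?probability_le1.
    by rewrite mule1 ltry.
  have : \int[P]_(w in A n) (U w + (n.+1%:R^-1)%:E) <= \int[P]_(w in A n) U w.
    apply: (@le_trans _ _ (\int[P]_(w in A n) V w)).
      apply: ge0_le_integral => //.
      - by move=> w Aw; rewrite adde_ge0 ?U0// lee_fin.
      - by apply: emeasurable_funD => //; exact: measurable_funTS.
      - exact: measurable_funTS.
      - by move=> w; exact: AV.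
    apply: h => // w Aw; split; first exact: U0.
    by rewrite (le_trans _ (AV _ _ Aw))// adde_ge0 ?U0// lee_fin.
  rewrite ge0_integralD//; last exact: measurable_funTS.
  rewrite integral_cst//.
  (* The finite integral of [U] cancels, leaving [P (A n) / (n+1) <= 0]. *)
  rewrite -[leRHS]adde0 leeD2lE// => le0.
  apply/eqP; rewrite eq_le measure_ge0 andbT.
  by move: le0; rewrite pmule_rle0// lte_fin invr_gt0 ltr0n.
have Aae : {ae P, forall w, forall n, ~ A n w}.
  apply: ae_foralln => n; exists (A n); split; [exact: GM|exact: PA|].
  by move=> w /= /contrapT.
apply: filterS Aae => w nA U0; rewrite leNgt; apply/negP => UV.
have Ufin : U w \is a fin_num by rewrite ge0_fin_numE// (lt_le_trans UV)// leey.
have [u Uu] : exists u, U w = u%:E by exists (fine (U w)); rewrite fineK.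
move: UV U0 nA; rewrite /A /= Uu => UV u0 nA.
have [n [un Vn]] : exists n : nat, (u <= n%:R)%R /\ u%:E + (n.+1%:R^-1)%:E <= V w.
  case: (V w) UV => [v||//]; last first.
    by move=> _; exists (Num.truncn u).+1; split; [exact: ltW (truncnS_gt _)|rewrite leey].
  rewrite lte_fin => uv.
  (* A sum of two truncations, so that one index is at least [u] and at least [1 / (v - u)]. *)
  pose m := (Num.truncn u + Num.truncn (v - u)^-1).+1.
  exists m; split.
    by apply: le_trans (ltW (truncnS_gt _)) _; rewrite ler_nat ltnS leq_addr.
  rewrite -EFinD lee_fin -lerBrDl.
  rewrite -[leRHS]invrK lef_pV2 ?posrE ?invr_gt0 ?subr_gt0//.
  apply: le_trans (ltW (truncnS_gt _)) _; rewrite ler_nat ltnS.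
  by rewrite (leq_trans (leq_addl (Num.truncn u) _))// leqW.
apply: (nA n); split; first by split => //; rewrite lee_fin.
by rewrite sube_ge0.
Qed.

End cond_nonneg.

(** * Calculus of nonnegative conditional expectations *)

Section nonneg_condE.
Context {R : realType} {d : measure_display} {Omega : measurableType d}.
Variable (P : probability Omega R).
Local Open Scope ereal_scope.
Implicit Types (X Y U V : Omega -> \bar R) (G : set_system Omega).

Lemma ae_forall_count (T : countType) (Q : T -> Omega -> Prop) :
  (forall x, {ae P, forall w, Q x w}) -> {ae P, forall w, forall x, Q x w}.
Proof.
move=> h.
have : {ae P, forall w, forall n, if unpickle n is Some x then Q x w else True}.
  apply: ae_foralln => n; case: unpickle => [x|]; first exact: h.
  exact: aeW.
by apply: filterS => w hw x; have := hw (pickle x); rewrite pickleK.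
Qed.

Lemma ae_forall_count_in (T : countType) (C : pred T) (Q : T -> Omega -> Prop) :
  (forall x, C x -> {ae P, forall w, Q x w}) ->
  {ae P, forall w, forall x, C x -> Q x w}.
Proof.
move=> h; apply: ae_forall_count => x.
have [Cx|Cx] := boolP (C x); last exact: aeW.
by apply: filterS (h x Cx) => w Qw _.
Qed.

(* A version of the conditional expectation of a nonnegative [X] is only almost
   surely nonnegative; truncating it at [0] makes [sqrte] well behaved everywhere. *)
Definition nnE G X w := maxe (condE P G X w) 0.

Lemma nnE_ge0 G X w : 0 <= nnE G X w.
Proof. by rewrite le_max lexx orbT. Qed.

Section one_sigma_algebra.
Variable G : set_system Omega.
Hypotheses (sG : sigma_algebra setT G) (GM : G `<=` measurable).
Local Notation E := (nnE G).

Lemma nnE_is_condE X : measurable_fun setT X -> (forall w, 0 <= X w) ->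
  is_condE P G X (E X).
Proof.
move=> mX X0.
have [GV VX] := condE_is_condE P sG GM mX X0.
have V0 := is_condE_ge0 sG GM X0 (condE_is_condE P sG GM mX X0).
have GE : measurable_wrt G (E X).
  apply/(measurable_wrtE sG).
  by apply: measurable_maxe => //; apply/(measurable_wrtE sG).
split=> // A GA; rewrite -VX//; apply: ae_eq_integral.
- exact: GM.
- by apply: measurable_funTS; have := measurable_wrt_fun GM GE.
- by apply: measurable_funTS; have := measurable_wrt_fun GM GV.
- by apply: filterS V0 => w h _; exact/max_idPl.
Qed.

Lemma measurable_nnE X : measurable_fun setT X -> (forall w, 0 <= X w) ->
  measurable_fun setT (E X).
Proof.
move=> mX X0; have := proj1 (nnE_is_condE mX X0).
by move=> /(measurable_wrt_fun GM).
Qed.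

(** Only sets on which [V] is nonnegative have to be tested, since [E X] is nonnegative and the
    inequality is trivial elsewhere. Hence [V] may be signed, as in [real_condE_le]. *)
Lemma le_nnE_integral V X : measurable_fun setT X -> (forall w, 0 <= X w) ->
  measurable_wrt G V ->
  (forall A, G A -> (forall w, A w -> 0 <= V w) ->
    \int[P]_(w in A) V w <= \int[P]_(w in A) X w) ->
  {ae P, forall w, V w <= E X w}.
Proof.
move=> mX X0 GV h; have [GE EX] := nnE_is_condE mX X0.
have : {ae P, forall w, 0 <= E X w -> V w <= E X w}.
  apply: (integral_le_ae sG GM) => // A GA A0.
  by rewrite EX//; apply: h => // w /A0[].
by apply: filterS => w; apply; exact: nnE_ge0.
Qed.

Lemma ge_nnE_integral U X : measurable_fun setT X -> (forall w, 0 <= X w) ->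
  measurable_wrt G U -> (forall w, 0 <= U w) ->
  (forall A, G A -> \int[P]_(w in A) X w <= \int[P]_(w in A) U w) ->
  {ae P, forall w, E X w <= U w}.
Proof.
move=> mX X0 GU U0 h; have [GE EX] := nnE_is_condE mX X0.
have : {ae P, forall w, 0 <= U w -> E X w <= U w}.
  by apply: (integral_le_ae sG GM) => // A GA A0; rewrite EX//; exact: h.
by apply: filterS => w; exact.
Qed.

Lemma nnE_unique U X : measurable_fun setT X -> (forall w, 0 <= X w) ->
  (forall w, 0 <= U w) -> is_condE P G X U -> {ae P, forall w, E X w = U w}.
Proof.
move=> mX X0 U0 [GU UX].
have h1 : {ae P, forall w, U w <= E X w}.
  by apply: le_nnE_integral => // A GA _; rewrite UX.
have h2 : {ae P, forall w, E X w <= U w}.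
  by apply: ge_nnE_integral => // A GA; rewrite UX.
by apply: filterS2 h1 h2 => w le1 le2; apply/eqP; rewrite eq_le le1 le2.
Qed.

Lemma nnE_le X Y : measurable_fun setT X -> (forall w, 0 <= X w) ->
  measurable_fun setT Y -> (forall w, 0 <= Y w) ->
  {ae P, forall w, X w <= Y w} -> {ae P, forall w, E X w <= E Y w}.
Proof.
move=> mX X0 mY Y0 XY; have [GE EX] := nnE_is_condE mX X0.
apply: le_nnE_integral => // A GA _; rewrite EX//.
apply: ae_ge0_le_integral => //; do ?exact: GM; do ?exact: measurable_funTS.
by apply: filterS XY => w.
Qed.

Lemma nnED X Y : measurable_fun setT X -> (forall w, 0 <= X w) ->
  measurable_fun setT Y -> (forall w, 0 <= Y w) ->
  {ae P, forall w, E (fun w => X w + Y w) w = E X w + E Y w}.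
Proof.
move=> mX X0 mY Y0.
have [GX EX] := nnE_is_condE mX X0; have [GY EY] := nnE_is_condE mY Y0.
apply: nnE_unique.
- exact: emeasurable_funD.
- by move=> w; exact: adde_ge0.
- by move=> w; rewrite adde_ge0// nnE_ge0.
split.
  by apply/(measurable_wrtE sG); apply: emeasurable_funD; apply/(measurable_wrtE sG).
move=> A GA; have mA := GM GA.
rewrite !ge0_integralD//; do ?exact: measurable_funTS;
  do ?by move=> w _; exact: nnE_ge0.
- by rewrite EX// EY.
- by apply: measurable_funTS; exact: measurable_nnE.
- by apply: measurable_funTS; exact: measurable_nnE.
Qed.

Lemma nnEZ (k : R) X : (0 <= k)%R -> measurable_fun setT X -> (forall w, 0 <= X w) ->
  {ae P, forall w, E (fun w => k%:E * X w) w = k%:E * E X w}.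
Proof.
move=> k0 mX X0; have [GX EX] := nnE_is_condE mX X0.
apply: nnE_unique.
- exact: measurable_funeM.
- by move=> w; rewrite mule_ge0// lee_fin.
- by move=> w; rewrite mule_ge0// ?lee_fin// nnE_ge0.
split.
  by apply/(measurable_wrtE sG); apply: measurable_funeM; apply/(measurable_wrtE sG).
move=> A GA; have mA := GM GA.
rewrite !ge0_integralZl//; do ?exact: measurable_funTS;
  do ?by move=> w _; exact: nnE_ge0.
- by rewrite EX.
- by apply: measurable_funTS; exact: measurable_nnE.
Qed.

Lemma nnE_id X : measurable_wrt G X -> (forall w, 0 <= X w) ->
  {ae P, forall w, E X w = X w}.
Proof.
move=> GX X0; apply: nnE_unique => //.
by have := measurable_wrt_fun GM GX.
Qed.

Lemma nnE_eq0 X : measurable_fun setT X -> (forall w, 0 <= X w) ->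
  {ae P, forall w, E X w <= 0} -> {ae P, forall w, X w = 0}.
Proof.
move=> mX X0 EX0; have [GX EX] := nnE_is_condE mX X0.
have GT : G setT by rewrite -(measurable_GT sG); exact: measurableT.
have : \int[P]_w `|X w| = 0.
  under eq_integral do rewrite gee0_abs//.
  rewrite -EX//.
  under eq_integral do rewrite -[E X _]gee0_abs ?nnE_ge0//.
  apply/ae_eq_integral_abs => //; first exact: measurable_nnE.
  by apply: filterS EX0 => w le0 _; apply/eqP; rewrite eq_le le0 nnE_ge0.
move=> /ae_eq_integral_abs -/(_ measurableT mX).
by apply: filterS => w; exact.
Qed.

Lemma nnE_fin X : measurable_fun setT X -> (forall w, 0 <= X w) ->
  \int[P]_w X w < +oo -> {ae P, forall w, E X w \is a fin_num}.
Proof.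
move=> mX X0 Xfin; have [GX EX] := nnE_is_condE mX X0.
have GT : G setT by rewrite -(measurable_GT sG); exact: measurableT.
have : P.-integrable setT (E X).
  apply/integrableP; split; first exact: measurable_nnE.
  under eq_integral do rewrite gee0_abs ?nnE_ge0//.
  by rewrite EX.
move=> /(integrable_ae measurableT).
by apply: filterS => w; exact.
Qed.

End one_sigma_algebra.

Lemma nnE_tower G1 G2 X : sigma_algebra setT G1 -> sigma_algebra setT G2 ->
  G1 `<=` G2 -> G2 `<=` measurable ->
  measurable_fun setT X -> (forall w, 0 <= X w) ->
  {ae P, forall w, nnE G1 (nnE G2 X) w = nnE G1 X w}.
Proof.
move=> s1 s2 G12 G2M mX X0.
have G1M : G1 `<=` measurable by move=> A /G12/G2M.
apply: nnE_unique => //.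
- exact: measurable_nnE.
- by move=> w; exact: nnE_ge0.
- by move=> w; exact: nnE_ge0.
have [GX EX] := nnE_is_condE s1 G1M mX X0.
split => // A GA.
have [_ ->//] := nnE_is_condE s2 G2M mX X0; last exact: G12.
exact: EX.
Qed.

End nonneg_condE.

(** * Scalar inequalities of Young type *)

Section scalar.
Context {R : realType}.

(* Minimising over [q] turns Young's inequality into Cauchy-Schwarz. The
   parameter is rational so that, conditionally, all the instances hold outside
   one null set. *)
Lemma le_opt_rat (x a b : R) : 0 <= a -> 0 <= b ->
  (forall q : rat, 0 < q -> x <= ratr q * a + (ratr q)^-1 * b) ->
  x <= 2 * (Num.sqrt a * Num.sqrt b).
Proof.
move=> a0 b0 hq.
have h (s : R) : 0 < s -> x <= s * a + s^-1 * b.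
  move=> s0; apply/ler_addgt0Pr => e e0.
  have /rat_in_itvoo[q] : s < s + e / (a + 1).
    by rewrite ltrDl divr_gt0// ltr_wpDl.
  rewrite in_itv /= => /andP[sq qs].
  have q0 : 0 < q by rewrite -(@ltr0q R) (lt_trans s0).
  apply: (le_trans (hq q q0)).
  have h1 : ratr q * a <= s * a + e.
    apply: (@le_trans _ _ ((s + e / (a + 1)) * a)).
      by rewrite ler_wpM2r// ltW.
    by rewrite mulrDl lerD2l mulrAC ler_pdivrMr ?ltr_wpDl// ler_pM2l// lerDl.
  have h2 : (ratr q)^-1 * b <= s^-1 * b.
    by rewrite ler_wpM2r// lef_pV2 ?posrE ?ltr0q// ltW.
  by lra.
have [x0|x0] := leP x 0.
  by apply: (le_trans x0); rewrite !mulr_ge0// sqrtr_ge0.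
have [az|anz] := eqVneq a 0.
  (* With [a = 0] the bound is [b / s], and [s = (b + 1) / x] makes it smaller than [x], a
     contradiction. *)
  have := h ((b + 1) / x) (divr_gt0 (ltr_wpDl b0 ltr01) x0).
  rewrite az mulr0 add0r invf_div mulrAC ler_pdivlMr ?ltr_wpDl//.
  by rewrite ler_pM2l// gerDl ler10.
have ap : 0 < a by rewrite lt_neqAle eq_sym anz.
(* At [s = x / (2 a)] the first term is [x / 2], which leaves [x^2 <= 4 a b]. *)
have := h (x / (2 * a)) (divr_gt0 x0 (mulr_gt0 (ltr0Sn _ 1) ap)).
have -> : x / (2 * a) * a + (x / (2 * a))^-1 * b = x / 2 + 2 * a * b / x.
  by field; rewrite anz gt_eqF.
rewrite -lerBlDl (_ : x - x / 2 = x / 2); last by field.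
rewrite ler_pdivlMr// => hx.
rewrite -sqrtrM//.
rewrite -(@ler_pXn2r _ 2) ?nnegrE ?mulr_ge0 ?sqrtr_ge0 ?(ltW x0)//.
rewrite exprMn sqr_sqrtr ?mulr_ge0//.
by rewrite !expr2; lra.
Qed.

Local Open Scope ereal_scope.

(** The right-hand side is linear in the two squares, so conditional expectations pass through it;
    minimising over [e] afterwards yields Minkowski's inequality. *)
Lemma sqreD_le (u v : \bar R) (e : R) : (0 < e)%R -> 0 <= u -> 0 <= v ->
  (u + v) ^+ 2 <= (1 + e)%:E * u ^+ 2 + (1 + e^-1)%:E * v ^+ 2.
Proof.
move=> e0; have e1 : (0 < e^-1)%R by rewrite invr_gt0.
have i1 : (1 + e)%:E * +oo = +oo by rewrite gt0_muley// lte_fin addr_gt0.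
have i2 : (1 + e^-1)%:E * +oo = +oo by rewrite gt0_muley// lte_fin addr_gt0.
case: u => [u|_|]//; case: v => [v|_|]//.
- rewrite !lee_fin => u0 v0.
  have : (0 <= e * (u - e^-1 * v) ^+ 2)%R by rewrite mulr_ge0 ?sqr_ge0// ltW.
  have -> : (e * (u - e^-1 * v) ^+ 2 = e * u ^+ 2 - 2 * u * v + e^-1 * v ^+ 2)%R.
    by field; rewrite gt_eqF.
  by rewrite !expr2; lra.
- by move=> _; rewrite [X in _ <= X](_ : _ = +oo) ?leey// !expe2 mulyy i2 -EFinM.
- by move=> _; rewrite [X in _ <= X](_ : _ = +oo) ?leey// !expe2 mulyy i1 -EFinM.
- by rewrite [X in _ <= X](_ : _ = +oo) ?leey// !expe2 mulyy i1 i2.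
Qed.

(** The counterpart of [sqreD_le] from which the conditional Cauchy-Schwarz inequality is
    derived. *)
Lemma mule2_le (u v : \bar R) (e : R) : (0 < e)%R -> 0 <= u -> 0 <= v ->
  2%:E * (u * v) <= e%:E * u ^+ 2 + e^-1%:E * v ^+ 2.
Proof.
move=> e0; have e1 : (0 < e^-1)%R by rewrite invr_gt0.
have i1 : e%:E * +oo = +oo by rewrite gt0_muley.
have i2 : e^-1%:E * +oo = +oo by rewrite gt0_muley.
case: u => [u|_|]//; case: v => [v|_|]//.
- rewrite !lee_fin => u0 v0.
  have : (0 <= e * (u - e^-1 * v) ^+ 2)%R by rewrite mulr_ge0 ?sqr_ge0// ltW.
  have -> : (e * (u - e^-1 * v) ^+ 2 = e * u ^+ 2 - 2 * u * v + e^-1 * v ^+ 2)%R.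
    by field; rewrite gt_eqF.
  by lra.
- by move=> _; rewrite [X in _ <= X](_ : _ = +oo) ?leey// !expe2 mulyy i2 -EFinM.
- by move=> _; rewrite [X in _ <= X](_ : _ = +oo) ?leey// !expe2 mulyy i1 -EFinM.
- by rewrite [X in _ <= X](_ : _ = +oo) ?leey// !expe2 mulyy i1 i2.
Qed.

Lemma sqre_ge0 (x : \bar R) : 0 <= x ^+ 2.
Proof. by case: x => [x||]; rewrite -?EFin_expe ?lee_fin ?sqr_ge0// expe2 ?mulyy ?mulNyNy leey. Qed.

Lemma sqrte_le (x y : \bar R) : x <= y -> sqrte x <= sqrte y.
Proof.
move=> xy; have [y0|y0] := leP 0 y; first by rewrite lee_sqrt.
case: x xy => [x||]; rewrite ?sqrte_ge0// => xy.
  rewrite [sqrte x%:E]/= ler0_sqrtr ?sqrte_ge0// -lee_fin.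
  exact: le_trans xy (ltW y0).
by move: (lt_le_trans y0 (le_trans (leey 0) xy)); rewrite ltxx.
Qed.

End scalar.

(** * Conditional L2 norms with values in the extended reals *)

Section nrm.
Context {R : realType} {d : measure_display} {Omega : measurableType d}.
Variable (P : probability Omega R).
Local Open Scope ereal_scope.
Implicit Types (X Y U V : Omega -> \bar R) (G : set_system Omega).

Definition enrm G U w := sqrte (nnE P G (fun w => U w ^+ 2) w).

Lemma enrm_ge0 G U w : 0 <= enrm G U w. Proof. exact: sqrte_ge0. Qed.

(** [sqrte] sends nonpositive values to 0, so the truncation in [nnE] disappears and the equality
    holds everywhere rather than almost surely. *)
Lemma cond_norm2E G (U : Omega -> R) w :
  cond_norm2 P G U w = enrm G (EFin \o U) w.
Proof.
rewrite /cond_norm2 /enrm /nnE.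
have -> : (fun w' => (U w' ^+ 2)%:E) = (fun w' => (EFin \o U) w' ^+ 2).
  by apply/funext => w' /=; rewrite EFin_expe.
set x := condE _ _ _ _; have [x0|x0] := leP x 0; last by [].
case: x x0 => [x|//|] /=; last by rewrite sqrtr0.
by rewrite lee_fin sqrtr0 => x0; rewrite ler0_sqrtr.
Qed.

Lemma measurable_sqre U : measurable_fun setT U ->
  measurable_fun setT (fun w => U w ^+ 2).
Proof. by move=> mU; under eq_fun do rewrite expe2; exact: emeasurable_funM. Qed.

Lemma measurable_sqrte U : measurable_fun setT U -> (forall w, 0 <= U w) ->
  measurable_fun setT (fun w => sqrte (U w)).
Proof.
move=> mU U0; under eq_fun do rewrite -poweR12_sqrt//.
exact: (measurableT_comp (measurable_poweR _) mU).
Qed.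

Section one_sigma_algebra.
Variable G : set_system Omega.
Hypotheses (sG : sigma_algebra setT G) (GM : G `<=` measurable).
Local Notation E := (nnE P G).
Local Notation N := (enrm G).

Lemma measurable_enrm U : measurable_fun setT U -> measurable_fun setT (N U).
Proof.
move=> mU; apply: measurable_sqrte; last by move=> w; exact: nnE_ge0.
apply: measurable_nnE => //; first exact: measurable_sqre.
by move=> w; exact: sqre_ge0.
Qed.

Lemma enrm_le U V : measurable_fun setT U -> measurable_fun setT V ->
  (forall w, 0 <= U w) ->
  {ae P, forall w, U w <= V w} -> {ae P, forall w, N U w <= N V w}.
Proof.
move=> mU mV U0 UV.
have : {ae P, forall w, E (fun w => U w ^+ 2) w <= E (fun w => V w ^+ 2) w}.
  apply: (nnE_le sG GM); do ?exact: measurable_sqre; do ?by move=> ?; exact: sqre_ge0.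
  apply: filterS UV => w UV; rewrite !expe2.
  by apply: lee_pmul.
by apply: filterS => w; exact: sqrte_le.
Qed.

Lemma enrmD U V : measurable_fun setT U -> measurable_fun setT V ->
  (forall w, 0 <= U w) -> (forall w, 0 <= V w) ->
  {ae P, forall w, N (fun w => U w + V w) w <= N U w + N V w}.
Proof.
move=> mU mV U0 V0.
have mUV : measurable_fun setT (fun w => U w + V w) by exact: emeasurable_funD.
(* One null set serves all rational parameters; what follows it is arithmetic at a fixed [w]. *)
have : {ae P, forall w, forall q : rat, (0 < q)%R ->
    E (fun w => (U w + V w) ^+ 2) w <=
    (1 + ratr q)%:E * E (fun w => U w ^+ 2) w +
    (1 + (ratr q)^-1)%:E * E (fun w => V w ^+ 2) w}.
  apply: ae_forall_count_in => q q0.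
  have q0' : (0 < ratr q :> R)%R by rewrite ltr0q.
  have a0 : (0 <= 1 + ratr q :> R)%R by rewrite addr_ge0// ltW.
  have b0 : (0 <= 1 + (ratr q)^-1 :> R)%R by rewrite addr_ge0// invr_ge0 ltW.
  have p0 (c : R) (W : Omega -> \bar R) w : (0 <= c)%R -> 0 <= c%:E * W w ^+ 2.
    by move=> c0; rewrite mule_ge0 ?lee_fin// sqre_ge0.
  have mW (c : R) (W : Omega -> \bar R) : measurable_fun setT W ->
      measurable_fun setT (fun w => c%:E * W w ^+ 2).
    by move=> mW; apply: measurable_funeM; exact: measurable_sqre.
  have h1 : {ae P, forall w, E (fun w => (U w + V w) ^+ 2) w <=
    E (fun w => (1 + ratr q)%:E * U w ^+ 2 + (1 + (ratr q)^-1)%:E * V w ^+ 2) w}.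
    apply: (nnE_le sG GM).
    - exact: measurable_sqre.
    - by move=> w; exact: sqre_ge0.
    - by apply: emeasurable_funD; exact: mW.
    - by move=> w; rewrite adde_ge0// p0.
    - by apply: aeW => w; exact: sqreD_le.
  have h2 := nnED P sG GM (mW _ _ mU) (fun w => p0 _ U w a0) (mW _ _ mV) (fun w => p0 _ V w b0).
  have h3 := nnEZ P sG GM a0 (measurable_sqre mU) (fun w => sqre_ge0 (U w)).
  have h4 := nnEZ P sG GM b0 (measurable_sqre mV) (fun w => sqre_ge0 (V w)).
  apply: filterS3 h1 (filterI h2 h3) h4 => w le1 [eq2 eq3] eq4.
  by rewrite -eq3 -eq4 -eq2.
apply: filterS => w; rewrite /enrm.
have := nnE_ge0 P G (fun w => U w ^+ 2) w.
have := nnE_ge0 P G (fun w => V w ^+ 2) w.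
have := nnE_ge0 P G (fun w => (U w + V w) ^+ 2) w.
move: (E (fun w => (U w + V w) ^+ 2) w) (E (fun w => U w ^+ 2) w)
  (E (fun w => V w ^+ 2) w) => c a b.
case: a => [a||]; case: b => [b||] => //; last 3 first.
- by move=> _ _ _ _; rewrite [sqrte +oo]/= addey ?leey.
- by move=> _ _ _ _; rewrite [sqrte +oo]/= addye ?leey.
- by move=> _ _ _ _; rewrite [sqrte +oo]/= addye ?leey.
case: c => [c||].
- rewrite !lee_fin => c0 b0 a0 h.
  have : (c - a - b <= 2 * (Num.sqrt a * Num.sqrt b))%R.
    apply: le_opt_rat => // q q0.
    have := h q q0; rewrite -!EFinM -EFinD lee_fin.
    by rewrite !mulrDl !mul1r; lra.
  move=> h2.
  have ab0 : (0 <= Num.sqrt a + Num.sqrt b)%R by rewrite addr_ge0 ?sqrtr_ge0.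
  rewrite -[leRHS]ger0_norm// -sqrtr_sqr ler_wsqrtr// sqrrD !sqr_sqrtr//.
  by rewrite -mulr_natl; lra.
(* When [a] and [b] are finite, the instance [q = 1] rules out [c = +oo]. *)
- by move=> _ _ _ /(_ 1%R ltr01); rewrite -!EFinM -EFinD leye_eq.
- by move=> _ _ _ _; rewrite adde_ge0// lee_fin sqrtr_ge0.
Qed.

Lemma enrmZ (k : R) U : (0 <= k)%R -> measurable_fun setT U ->
  {ae P, forall w, N (fun w => k%:E * U w) w = k%:E * N U w}.
Proof.
move=> k0 mU.
have := nnEZ P sG GM (sqr_ge0 k) (measurable_sqre mU) (fun w => sqre_ge0 (U w)).
apply: filterS => w h; rewrite /enrm.
have -> : (fun w => (k%:E * U w) ^+ 2) = (fun w => (k ^+ 2)%:E * U w ^+ 2).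
  by apply/funext => w'; rewrite !expe2 expr2 EFinM muleACA.
by rewrite h sqrteM ?lee_fin ?sqr_ge0//= sqrtr_sqr ger0_norm.
Qed.

Lemma enrm0 : {ae P, forall w, N (fun=> 0) w = 0}.
Proof.
have m0 : measurable_fun setT (cst 0 : Omega -> \bar R) by [].
have := enrmZ (lexx (0%R : R)) m0.
have -> : (fun w => 0%:E * (cst 0 : Omega -> \bar R) w) = fun=> 0.
  by apply/funext => ?; rewrite mule0.
by apply: filterS => w ->; rewrite mul0e.
Qed.

Lemma enrm_sum (I : Type) (s : seq I) (U : I -> Omega -> \bar R) :
  (forall i, measurable_fun setT (U i)) -> (forall i w, 0 <= U i w) ->
  {ae P, forall w, N (fun w => \sum_(i <- s) U i w) w <= \sum_(i <- s) N (U i) w}.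
Proof.
move=> mU U0; elim: s => [|i s ih].
  have e : (fun w => \sum_(i <- [::]) U i w) = fun=> 0.
    by apply/funext => ?; rewrite big_nil.
  by apply: filterS enrm0 => w; rewrite e big_nil => ->.
have s0 w : 0 <= \sum_(i <- s) U i w by exact: sume_ge0.
have h := enrmD (mU i) (emeasurable_sum s mU) (U0 i) s0.
apply: filterS2 h ih => w h1 h2; rewrite big_cons.
rewrite [X in enrm _ X _](_ : _ = fun w => U i w + \sum_(i <- s) U i w); last first.
  by apply/funext => ?; rewrite big_cons.
by rewrite (le_trans h1)// leeD2l.
Qed.

Lemma enrm_id U : measurable_wrt G U -> (forall w, 0 <= U w) ->
  {ae P, forall w, N U w = U w}.
Proof.
move=> GU U0.
have GU2 : measurable_wrt G (fun w => U w ^+ 2).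
  apply/(measurable_wrtE sG); under eq_fun do rewrite expe2.
  by apply: emeasurable_funM; apply/(measurable_wrtE sG).
have := nnE_id P sG GM GU2 (fun w => sqre_ge0 (U w)).
by apply: filterS => w h; rewrite /enrm h sqrte_sqr gee0_abs.
Qed.

(** Cauchy-Schwarz with a deterministic bound on the second norm, which is the form in which the
    weights are controlled. *)
Lemma nnEM_le (k : R) U V : (0 <= k)%R ->
  measurable_fun setT U -> measurable_fun setT V ->
  (forall w, 0 <= U w) -> (forall w, 0 <= V w) ->
  {ae P, forall w, N V w <= k%:E} ->
  {ae P, forall w, E (fun w => U w * V w) w <= k%:E * N U w}.
Proof.
move=> k0 mU mV U0 V0 Vk.
have mUV : measurable_fun setT (fun w => U w * V w) by exact: emeasurable_funM.
have UV0 w : 0 <= U w * V w by rewrite mule_ge0.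
have Vk2 : {ae P, forall w, E (fun w => V w ^+ 2) w <= (k ^+ 2)%:E}.
  apply: filterS Vk => w h.
  rewrite -(sqr_sqrte (nnE_ge0 P G (fun w => V w ^+ 2) w)) EFin_expe !expe2.
  by apply: lee_pmul => //; exact: sqrte_ge0.
(* For [k = 0] the right-hand side is 0 even where [N U] is [+oo], so [V] itself must be shown to
   vanish almost surely. *)
have [kz|kn0] := eqVneq k 0%R.
  have V2z : {ae P, forall w, V w ^+ 2 = 0}.
    apply: (nnE_eq0 sG GM (measurable_sqre mV) (fun w => sqre_ge0 (V w))).
    by apply: filterS Vk2 => w; rewrite kz expr0n.
  pose z : Omega -> \bar R := cst 0.
  have hz : {ae P, forall w, E (fun w => U w * V w) w <= E z w}.
    apply: (nnE_le sG GM) => //.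
    apply: filterS V2z => w h.
    have -> : V w = 0 by have := sqrte_sqr (V w); rewrite h sqrte0 gee0_abs.
    by rewrite mule0.
  have h0 : {ae P, forall w, E z w = z w}.
    apply: nnE_id => // B mB; rewrite -(measurable_GT sG).
    by rewrite -[X in measurable X]setTI; exact: (@measurable_cst _ _ _ _ setT).
  by apply: filterS2 hz h0 => w le1 eq1; rewrite kz mul0e -[leRHS]/(z w) -eq1.
have kp : (0 < k)%R by rewrite lt_neqAle eq_sym kn0.
have : {ae P, forall w, forall q : rat, (0 < q)%R ->
    2%:E * E (fun w => U w * V w) w <=
    (ratr q)%:E * E (fun w => U w ^+ 2) w + (ratr q)^-1%:E * (k ^+ 2)%:E}.
  apply: ae_forall_count_in => q q0.
  have q0' : (0 < ratr q :> R)%R by rewrite ltr0q.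
  have a0 : (0 <= ratr q :> R)%R by rewrite ltW.
  have b0 : (0 <= (ratr q)^-1 :> R)%R by rewrite invr_ge0 ltW.
  have p0 (c : R) (W : Omega -> \bar R) w : (0 <= c)%R -> 0 <= c%:E * W w ^+ 2.
    by move=> c0; rewrite mule_ge0 ?lee_fin// sqre_ge0.
  have mW (c : R) (W : Omega -> \bar R) : measurable_fun setT W ->
      measurable_fun setT (fun w => c%:E * W w ^+ 2).
    by move=> mW; apply: measurable_funeM; exact: measurable_sqre.
  have h1 : {ae P, forall w, E (fun w => 2%:E * (U w * V w)) w <=
    E (fun w => (ratr q)%:E * U w ^+ 2 + (ratr q)^-1%:E * V w ^+ 2) w}.
    apply: (nnE_le sG GM).
    - exact: measurable_funeM.
    - by move=> w; rewrite mule_ge0.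
    - by apply: emeasurable_funD; exact: mW.
    - by move=> w; rewrite adde_ge0// p0.
    - by apply: aeW => w; exact: mule2_le.
  have h0 := nnEZ P sG GM (ler0n R 2) mUV UV0.
  have h2 := nnED P sG GM (mW _ _ mU) (fun w => p0 _ U w a0) (mW _ _ mV) (fun w => p0 _ V w b0).
  have h3 := nnEZ P sG GM a0 (measurable_sqre mU) (fun w => sqre_ge0 (U w)).
  have h4 := nnEZ P sG GM b0 (measurable_sqre mV) (fun w => sqre_ge0 (V w)).
  apply: filterS3 (filterI h1 h0) (filterI h2 h3) (filterI h4 Vk2).
  move=> w [le1 eq0] [eq2 eq3] [eq4 le5].
  rewrite -eq0; apply: le_trans le1 _; rewrite eq2 eq3 eq4 leeD2l//.
  by rewrite lee_wpmul2l// lee_fin.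
apply: filterS => w; rewrite /enrm.
have := nnE_ge0 P G (fun w => U w ^+ 2) w.
have := nnE_ge0 P G (fun w => (U w * V w)) w.
move: (E (fun w => U w * V w) w) (E (fun w => U w ^+ 2) w) => c a.
case: a => [a||//]; last first.
  by move=> _ _ _; rewrite /= gt0_muley ?leey// lte_fin.
case: c => [c||].
- rewrite !lee_fin => c0 a0 h.
  have : (2 * c <= 2 * (Num.sqrt a * Num.sqrt (k ^+ 2)))%R.
    apply: le_opt_rat => //; first exact: sqr_ge0.
  by rewrite sqrtr_sqr ger0_norm// ler_pM2l// mulrC.
- by move=> _ _ /(_ 1%R ltr01); rewrite gt0_muley ?lte_fin.
- by move=> _ _ _; rewrite leNye.
Qed.

Lemma nnE_le_enrm U : measurable_fun setT U -> (forall w, 0 <= U w) ->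
  {ae P, forall w, E U w <= N U w}.
Proof.
move=> mU U0.
have G1 : measurable_wrt G (cst (1 : \bar R) : Omega -> _).
  move=> B mB; rewrite -(measurable_GT sG) -[X in measurable X]setTI.
  exact: (@measurable_cst _ _ _ _ setT).
have h1 : {ae P, forall w, N (cst 1) w <= 1%:E}.
  by apply: filterS (enrm_id G1 (fun=> lee01)) => w ->.
have m1 : measurable_fun setT (cst 1 : Omega -> \bar R) by [].
have := nnEM_le ler01 mU m1 U0 (fun=> lee01) h1.
apply: filterS => w; rewrite mul1e.
by rewrite (_ : (fun w => U w * 1) = U)//; apply/funext => ?; rewrite mule1.
Qed.

End one_sigma_algebra.

Lemma enrm_tower G1 G2 U : sigma_algebra setT G1 -> sigma_algebra setT G2 ->
  G1 `<=` G2 -> G2 `<=` measurable -> measurable_fun setT U ->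
  {ae P, forall w, enrm G1 (enrm G2 U) w = enrm G1 U w}.
Proof.
move=> s1 s2 G12 G2M mU.
have := nnE_tower P s1 s2 G12 G2M (measurable_sqre mU) (fun w => sqre_ge0 (U w)).
apply: filterS => w; rewrite /enrm => <-; congr (sqrte (nnE P G1 _ w)).
by apply/funext => w'; rewrite sqr_sqrte// nnE_ge0.
Qed.

End nrm.

(** * Conditional expectations of integrable variables *)

Section signed_condE.
Context {R : realType} {d : measure_display} {Omega : measurableType d}.
Variables (P : probability Omega R) (G : set_system Omega).
Hypotheses (sG : sigma_algebra setT G) (GM : G `<=` measurable).
Local Notation E := (nnE P G).
Local Notation N := (enrm P G).
Local Open Scope ereal_scope.

(** [is_condE] does not ask [V] to be integrable. Testing on the sets where [V >= 0] and where
    [V < 0], both in [G], expresses the integral of [|V|] through two finite integrals of [X]. *)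
Lemma is_condE_integrable (X V : Omega -> \bar R) :
  P.-integrable setT X -> is_condE P G X V -> P.-integrable setT V.
Proof.
move=> iX [GV VX].
have mV := measurable_wrt_fun GM GV.
pose A := [set w | 0 <= V w].
have GA : G A.
  rewrite -(measurable_GT sG) -[X in measurable X]setTI.
  by apply: emeasurable_fun_c_infty => //; apply/(measurable_wrtE sG).
have GCA : G (~` A).
  by rewrite -(measurable_GT sG); apply: measurableC; rewrite measurable_GT.
have mA := GM GA; have mCA := GM GCA.
have fin B : G B -> \int[P]_(w in B) X w \is a fin_num.
  by move=> GB; apply: integrable_fin_num => //; [exact: GM|apply: integrableS iX => //; exact: GM].
apply/integrableP; split => //.
have := @ge0_integral_setU _ _ _ P A (~` A) mA mCA (fun w => `|V w|).
rewrite setUv => ->//; last 2 first.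
- exact: measurableT_comp.
- exact/disj_setPCl.
rewrite (eq_integral V) => [|w /[!inE] Aw]; last by rewrite gee0_abs.
rewrite [X in _ + X](eq_integral (\- V)) => [|w /[!inE] Aw]; last first.
  by rewrite lee0_abs// leNgt; apply/negP => /ltW.
have NV0 w : (~` A) w -> 0 <= (\- V) w.
  by move=> Aw; rewrite /= oppe_ge0 leNgt; apply/negP => /ltW.
have -> : \int[P]_(w in ~` A) (\- V) w = - \int[P]_(w in ~` A) V w.
  rewrite -[LHS]oppeK; congr (- _); rewrite -integral_ge0N//.
  by apply: eq_integral => w _; rewrite /= oppeK.
by rewrite !VX// ltey_eq fin_numD fin_numN !fin.
Qed.

Lemma real_condE_lin (a b : R) (X1 X2 V1 V2 : Omega -> R) :
  real_condE P G X1 V1 -> real_condE P G X2 V2 ->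
  real_condE P G (fun w => a * X1 w + b * X2 w)%R (fun w => a * V1 w + b * V2 w)%R.
Proof.
move=> [i1 c1] [i2 c2].
have j1 := is_condE_integrable i1 c1; have j2 := is_condE_integrable i2 c2.
have lin (U1 U2 : Omega -> R) : P.-integrable setT (EFin \o U1) ->
    P.-integrable setT (EFin \o U2) ->
    P.-integrable setT (EFin \o (fun w => a * U1 w + b * U2 w)%R).
  move=> h1 h2; apply: (eq_integrable measurableT _ _ _
    (integrableD measurableT (integrableZl measurableT a h1) (integrableZl measurableT b h2))).
  by move=> w _ /=.
have linI (U1 U2 : Omega -> R) A : measurable A -> P.-integrable setT (EFin \o U1) ->
    P.-integrable setT (EFin \o U2) ->
    \int[P]_(w in A) (a * U1 w + b * U2 w)%:E =
    a%:E * \int[P]_(w in A) (U1 w)%:E + b%:E * \int[P]_(w in A) (U2 w)%:E.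
  move=> mA h1 h2.
  have k1 : P.-integrable A (EFin \o U1) by exact: integrableS h1.
  have k2 : P.-integrable A (EFin \o U2) by exact: integrableS h2.
  rewrite -(integralZl mA k1) -(integralZl mA k2).
  by rewrite -integralD//; apply: integrableZl.
split; first exact: lin.
split.
  apply/(measurable_wrtE sG); apply/measurable_EFinP.
  have [/(measurable_wrtE sG)/measurable_EFinP m1 _] := c1.
  have [/(measurable_wrtE sG)/measurable_EFinP m2 _] := c2.
  by apply: measurable_funD; apply: measurable_funM.
move=> A GA; have mA := GM GA.
rewrite !linI//.
by have [_ ->//] := c1; have [_ ->//] := c2.
Qed.

Lemma real_condE_id (X : Omega -> R) : measurable_wrt G X ->
  P.-integrable setT (EFin \o X) -> real_condE P G X X.
Proof.
move=> GX iX; split=> //; split => //.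
by apply/(measurable_wrtE sG)/measurable_EFinP/(measurable_wrtE sG).
Qed.

Lemma real_condE0 : real_condE P G (fun=> 0%R) (fun=> 0%R).
Proof.
apply: real_condE_id; last exact: (@integrable0 _ _ _ P).
by apply/(measurable_wrtE sG).
Qed.

Lemma real_condE_sum (I : Type) (s : seq I) (a : I -> R) (X V : I -> Omega -> R) :
  (forall l, real_condE P G (X l) (V l)) ->
  real_condE P G (fun w => \sum_(l <- s) a l * X l w)%R
    (fun w => \sum_(l <- s) a l * V l w)%R.
Proof.
move=> h; elim: s => [|l s ih].
  have e (U : I -> Omega -> R) : (fun w => \sum_(l <- [::]) a l * U l w)%R = fun=> 0%R.
    by apply/funext => w; rewrite big_nil.
  by rewrite !e; exact: real_condE0.
have e (U : I -> Omega -> R) : (fun w => \sum_(l <- l :: s) a l * U l w)%R =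
    fun w => (a l * U l w + 1 * \sum_(l <- s) a l * U l w)%R.
  by apply/funext => w; rewrite big_cons mul1r.
by rewrite !e; exact: real_condE_lin.
Qed.

(** As [W] may fail to be integrable, conditioning [W - X] is not an option. Integrals over sets of
    [G] are compared instead, through the positive part of [X]. *)
Lemma real_condE_le (X V : Omega -> R) (W : Omega -> \bar R) :
  real_condE P G X V -> measurable_fun setT W -> (forall w, 0 <= W w) ->
  {ae P, forall w, (X w)%:E <= W w} -> {ae P, forall w, (V w)%:E <= E W w}.
Proof.
move=> [iX [GV VX]] mW W0 XW.
apply: (le_nnE_integral sG GM) => // A GA _; rewrite VX//.
have mA := GM GA.
have mX : measurable_fun setT (EFin \o X) by exact: measurable_int iX.
apply: (@le_trans _ _ (\int[P]_(w in A) (EFin \o X)^\+ w)).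
  apply: le_integral => //.
  - exact: integrableS iX.
  - exact: integrableS (integrable_funepos measurableT iX).
  - by move=> w _; rewrite funeposE le_max lexx.
apply: ae_ge0_le_integral => //.
- by apply: measurable_funTS; exact: measurable_funepos.
- exact: measurable_funTS.
- by apply: filterS XW => w h _; rewrite funeposE ge_max h W0.
Qed.

Lemma real_condE_abs_le (X V : Omega -> R) (W : Omega -> \bar R) :
  real_condE P G X V -> measurable_fun setT W -> (forall w, 0 <= W w) ->
  {ae P, forall w, `|X w|%:E <= W w} -> {ae P, forall w, `|V w|%:E <= E W w}.
Proof.
move=> h mW W0 XW.
have h1 : {ae P, forall w, (V w)%:E <= E W w}.
  apply: (real_condE_le h) => //.
  by apply: filterS XW => w; apply: le_trans; rewrite lee_fin ler_norm.
have h2 : {ae P, forall w, (- V w)%:E <= E W w}.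
  have := real_condE_lin (-1) 0 h h.
  under eq_fun do rewrite mul0r addr0 mulN1r.
  under [X in real_condE _ _ _ X -> _]eq_fun do rewrite mul0r addr0 mulN1r.
  move=> h'; apply: (real_condE_le h') => //.
  by apply: filterS XW => w; apply: le_trans; rewrite lee_fin -normrN ler_norm.
by apply: filterS2 h1 h2 => w; case: (ger0P (V w)).
Qed.

(** [condE] picks some version, so it is enough to exhibit one: the difference of the versions for
    the positive and negative parts, both integrable. *)
Lemma integrable_is_condE (X : Omega -> \bar R) : P.-integrable setT X ->
  is_condE P G X (condE P G X).
Proof.
move=> iX; apply: (@xgetPex _ _ [set V | is_condE P G X V]).
have mX : measurable_fun setT X by exact: measurable_int iX.
have mp : measurable_fun setT (X^\+) by exact: measurable_funepos.
have mn : measurable_fun setT (X^\-) by exact: measurable_funeneg.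
have cp := nnE_is_condE P sG GM mp (funepos_ge0 X).
have cn := nnE_is_condE P sG GM mn (funeneg_ge0 X).
have ip := is_condE_integrable (integrable_funepos measurableT iX) cp.
have in_ := is_condE_integrable (integrable_funeneg measurableT iX) cn.
exists (E X^\+ \- E X^\-); split.
  apply/(measurable_wrtE sG); apply: emeasurable_funB.
    by apply/(measurable_wrtE sG); case: cp.
  by apply/(measurable_wrtE sG); case: cn.
move=> A GA; have mA := GM GA.
rewrite integralB//; [|exact: integrableS ip|exact: integrableS in_].
have [_ ->//] := cp; have [_ ->//] := cn.
by rewrite [RHS]integralE.
Qed.

Lemma measurable_wrt_fine_condE (X : Omega -> \bar R) : P.-integrable setT X ->
  measurable_wrt G (fun w => fine (condE P G X w)).
Proof.
move=> iX; have [GV _] := integrable_is_condE iX.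
apply/(measurable_wrtE sG).
by apply: (measurableT_comp _ (iffLR (measurable_wrtE sG _) GV)); exact: fine_measurable.
Qed.

Lemma real_condE_condE (X : Omega -> R) : P.-integrable setT (EFin \o X) ->
  real_condE P G X (fun w => fine (condE P G (EFin \o X) w)).
Proof.
move=> iX; split => //; have c := integrable_is_condE iX; have [GV VX] := c.
have iV := is_condE_integrable iX c.
have Gf := measurable_wrt_fine_condE iX.
have GEf : measurable_wrt G (EFin \o (fun w => fine (condE P G (EFin \o X) w))).
  by apply/(measurable_wrtE sG)/measurable_EFinP/(measurable_wrtE sG).
split => // A GA; have mA := GM GA; rewrite -VX//.
apply: ae_eq_integral => //.
- by apply: measurable_funTS; have := measurable_wrt_fun GM GEf.
- by apply: measurable_funTS; have := measurable_wrt_fun GM GV.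
- by apply: filterS (integrable_ae measurableT iV) => w h _ /=; rewrite fineK// h.
Qed.

End signed_condE.

(** * The Euclidean norm and its description by rational directions *)

Section enorm.
Context {R : realType} {q : nat}.
Implicit Types u v : 'rV[R]_q.

Lemma enorm_ge0 v : 0 <= enorm v. Proof. exact: sqrtr_ge0. Qed.

Lemma sqr_enorm v : enorm v ^+ 2 = \sum_l v 0 l ^+ 2.
Proof. by rewrite sqr_sqrtr// sumr_ge0// => l _; exact: sqr_ge0. Qed.

Lemma enormZ a v : enorm (a *: v) = `|a| * enorm v.
Proof.
rewrite /enorm (_ : \sum_l _ = a ^+ 2 * \sum_l v 0 l ^+ 2).
  by rewrite sqrtrM ?sqr_ge0// sqrtr_sqr.
by rewrite mulr_sumr; apply: eq_bigr => l _; rewrite mxE exprMn.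
Qed.

Lemma dot_le_enorm u v : \sum_l u 0 l * v 0 l <= enorm u * enorm v.
Proof.
rewrite -(@ler_pM2l _ 2)//; apply: le_opt_rat.
- by apply: sumr_ge0 => l _; exact: sqr_ge0.
- by apply: sumr_ge0 => l _; exact: sqr_ge0.
move=> r r0; rewrite !mulr_sumr -big_split/=; apply: ler_sum => l _.
have s0 : 0 < ratr r :> R by rewrite ltr0q.
set s := ratr r in s0 *.
have : 0 <= s * (u 0 l - s^-1 * v 0 l) ^+ 2 by rewrite mulr_ge0 ?sqr_ge0// ltW.
have -> : s * (u 0 l - s^-1 * v 0 l) ^+ 2 =
    s * u 0 l ^+ 2 - 2 * (u 0 l * v 0 l) + s^-1 * v 0 l ^+ 2.
  by field; rewrite gt_eqF.
by lra.
Qed.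

Lemma enormD u v : enorm (u + v) <= enorm u + enorm v.
Proof.
have h0 : 0 <= enorm u + enorm v by rewrite addr_ge0 ?enorm_ge0.
rewrite -(@ler_pXn2r _ 2) ?nnegrE ?enorm_ge0// sqrrD !sqr_enorm.
have -> : \sum_l (u + v) 0 l ^+ 2 =
    \sum_l u 0 l ^+ 2 + 2 * (\sum_l u 0 l * v 0 l) + \sum_l v 0 l ^+ 2.
  by rewrite mulr_sumr -!big_split/=; apply: eq_bigr => l _; rewrite mxE; ring.
by have := dot_le_enorm u v; rewrite -mulr_natl; lra.
Qed.

Lemma enorm_le_coord v e : 0 <= e -> (forall l, `|v 0 l| <= e) ->
  enorm v <= Num.sqrt q%:R * e.
Proof.
move=> e0 h; rewrite -[e in leRHS]ger0_norm// -sqrtr_sqr -sqrtrM//.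
rewrite ler_wsqrtr//; apply: (@le_trans _ _ (\sum_(l < q) e ^+ 2)).
  apply: ler_sum => l _; rewrite -[v 0 l ^+ 2]real_normK ?num_real//.
  by rewrite ler_pXn2r ?nnegrE.
by rewrite sumr_const card_ord mulr_natl.
Qed.

(** Duality with rational test vectors only: they are countably many, so conditionally all
    directions can be handled outside one null set. *)
Lemma enorm_le_dual v (M : R) : 0 <= M ->
  (forall r : {ffun 'I_q -> rat},
    \sum_l ratr (r l) * v 0 l <= enorm (\row_l (ratr (r l) : R)) * M) ->
  enorm v <= M.
Proof.
move=> M0 h.
(* Replacing [v] by a rational vector within [s] in each coordinate costs at most [s * K]: one part
   from the pairing with [v], the other from the norm of the test vector. *)
pose K := \sum_l `|v 0 l| + Num.sqrt q%:R * M.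
have K0 : 0 <= K.
  by rewrite addr_ge0// ?sumr_ge0// mulr_ge0// sqrtr_ge0.
suff hs : enorm v ^+ 2 <= enorm v * M.
  have [->//|n0] := eqVneq (enorm v) 0.
  have np : 0 < enorm v by rewrite lt_neqAle eq_sym n0 enorm_ge0.
  by move: hs; rewrite expr2 ler_pM2l.
apply/ler_addgt0Pr => e e0.
pose s := e / (K + 1).
have s0 : 0 < s by rewrite divr_gt0// ltr_wpDl.
have sK : s * K <= e.
  by rewrite /s mulrAC ler_pdivrMr ?ltr_wpDl// ler_pM2l// lerDl.
have /choice[r hr] l : exists r : rat, v 0 l < ratr r < v 0 l + s.
  have /rat_in_itvoo[r] : v 0 l < v 0 l + s by rewrite ltrDl.
  by rewrite in_itv /=; exists r.
pose f := [ffun l => r l].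
have hd l : `|ratr (f l) - v 0 l| <= s.
  rewrite ffunE; have /andP[h1 h2] := hr l.
  by rewrite ger0_norm ?subr_ge0 ?(ltW h1)//; lra.
have h1 : enorm (\row_l (ratr (f l) : R)) <= enorm v + Num.sqrt q%:R * s.
  rewrite (_ : \row_l _ = v + (\row_l (ratr (f l) : R) - v)); last by rewrite addrC subrK.
  apply: (le_trans (enormD _ _)); rewrite lerD2l enorm_le_coord ?(ltW s0)// => l.
  by rewrite !mxE.
have h2 : enorm v ^+ 2 - s * \sum_l `|v 0 l| <= \sum_l ratr (f l) * v 0 l.
  rewrite sqr_enorm mulr_sumr -sumrB; apply: ler_sum => l _.
  have : `|(ratr (f l) - v 0 l) * v 0 l| <= s * `|v 0 l| by rewrite normrM ler_wpM2r.
  by rewrite ler_norml => /andP[]; lra.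
have := h f; have := ler_wpM2r M0 h1.
by move: sK; rewrite /K; lra.
Qed.

End enorm.

(** * Jensen's inequality for vectors and contraction of norms *)

Section vector_condE.
Context {R : realType} {d : measure_display} {Omega : measurableType d}.
Variables (P : probability Omega R).
Local Open Scope ereal_scope.

(** Jensen's inequality for the norm: in each fixed direction it is linearity together with
    [real_condE_le], and [enorm_le_dual] reassembles the directions. *)
Lemma vec_condE_le (G : set_system Omega) (q : nat) (X V : Omega -> 'rV[R]_q)
    (W : Omega -> \bar R) :
  sigma_algebra setT G -> G `<=` measurable ->
  (forall l, real_condE P G (fun w => X w 0%R l) (fun w => V w 0%R l)) ->
  measurable_fun setT W -> (forall w, 0 <= W w) ->
  {ae P, forall w, (enorm (X w))%:E <= W w} ->
  {ae P, forall w, (enorm (V w))%:E <= nnE P G W w}.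
Proof.
move=> sG GM h mW W0 XW.
have : {ae P, forall w, forall r : {ffun 'I_q -> rat},
    (\sum_l ratr (r l) * V w 0 l)%R%:E <= (enorm (\row_l (ratr (r l) : R)))%:E * nnE P G W w}.
  apply: ae_forall_count => r.
  set n := enorm _.
  have n0 : (0 <= n)%R by exact: enorm_ge0.
  have := real_condE_sum sG GM (index_enum 'I_q) (fun l => ratr (r l) : R) h.
  move=> /real_condE_le -/(_ sG GM (fun w => n%:E * W w)) h1.
  have {}h1 := h1 (measurable_funeM _ mW) (fun w => mule_ge0 (n0 : 0 <= n%:E) (W0 w)).
  have h2 := nnEZ P sG GM n0 mW W0.
  apply: filterS2 (h1 _) h2 => [w le1 <-//|].
  apply: filterS XW => w hw; apply: (@le_trans _ _ (n%:E * (enorm (X w))%:E)).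
    rewrite -EFinM lee_fin; apply: le_trans (dot_le_enorm _ _).
    by apply: ler_sum => l _; rewrite mxE.
  exact: lee_wpmul2l.
apply: filterS => w; have := nnE_ge0 P G W w; case: (nnE P G W w) => [M|_ _|//].
  by rewrite lee_fin => M0 hr; rewrite lee_fin; exact: enorm_le_dual.
by rewrite leey.
Qed.

Lemma enrm_abs G (U : Omega -> R) : enrm P G (EFin \o U) = enrm P G (fun w => `|U w|%:E).
Proof.
apply/funext => w; congr (sqrte (nnE P G _ w)); apply/funext => w'.
by rewrite -!EFin_expe real_normK// num_real.
Qed.

Section two_sigma_algebras.
Variables G1 G2 : set_system Omega.
Hypotheses (s1 : sigma_algebra setT G1) (s2 : sigma_algebra setT G2).
Hypotheses (G12 : G1 `<=` G2) (G2M : G2 `<=` measurable).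

Let G1M : G1 `<=` measurable. Proof. by move=> A /G12/G2M. Qed.

(** Conditioning on the finer [G2] contracts the norm given [G1]: Jensen's inequality under [G2],
    then the tower property. *)
Lemma enrm_le_nnE (U W : Omega -> \bar R) :
  measurable_fun setT U -> (forall w, 0 <= U w) ->
  measurable_fun setT W -> (forall w, 0 <= W w) ->
  {ae P, forall w, U w <= nnE P G2 W w} ->
  {ae P, forall w, enrm P G1 U w <= enrm P G1 W w}.
Proof.
move=> mU U0 mW W0 UW.
have UW2 : {ae P, forall w, U w <= enrm P G2 W w}.
  by apply: filterS2 UW (nnE_le_enrm P s2 G2M mW W0) => w; exact: le_trans.
have h1 := enrm_le s1 G1M mU (measurable_enrm P s2 G2M mW) U0 UW2.
by apply: filterS2 h1 (enrm_tower P s1 s2 G12 G2M mW) => w + e; rewrite e.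
Qed.

Lemma enrm_condE_le (X V : Omega -> R) (W : Omega -> \bar R) :
  real_condE P G2 X V -> measurable_fun setT W -> (forall w, 0 <= W w) ->
  {ae P, forall w, `|X w|%:E <= W w} ->
  {ae P, forall w, enrm P G1 (EFin \o V) w <= enrm P G1 W w}.
Proof.
move=> h mW W0 XW; have h1 := real_condE_abs_le s2 G2M h mW W0 XW.
rewrite enrm_abs; apply: enrm_le_nnE => //.
case: h => iX c; have iV := is_condE_integrable s2 G2M iX c.
have mV : measurable_fun setT V by apply/measurable_EFinP; exact: measurable_int iV.
by apply/measurable_EFinP; exact: measurableT_comp.
Qed.

End two_sigma_algebras.

End vector_condE.

(** * Norm of a conditional expectation multiplied by centered weights *)

Section weighted_step.
Context {R : realType} {d : measure_display} {Omega : measurableType d}.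
Variables (P : probability Omega R).
Local Open Scope ereal_scope.

Lemma nnE_sum (G : set_system Omega) (I : Type) (s : seq I) (U : I -> Omega -> \bar R) :
  sigma_algebra setT G -> G `<=` measurable ->
  (forall i, measurable_fun setT (U i)) -> (forall i w, 0 <= U i w) ->
  {ae P, forall w, nnE P G (fun w => \sum_(i <- s) U i w) w = \sum_(i <- s) nnE P G (U i) w}.
Proof.
move=> sG GM mU U0; elim: s => [|i s ih].
  have e : (fun w => \sum_(i <- [::]) U i w) = fun=> 0.
    by apply/funext => ?; rewrite big_nil.
  have G0 : measurable_wrt G (cst 0 : Omega -> \bar R).
    by apply/(measurable_wrtE sG).
  by apply: filterS (nnE_id P sG GM G0 (fun=> lexx _)) => w; rewrite e big_nil.
have s0 w : 0 <= \sum_(i <- s) U i w by exact: sume_ge0.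
have h := nnED P sG GM (mU i) (U0 i) (emeasurable_sum s mU) s0.
apply: filterS2 h ih => w h1 h2; rewrite big_cons -h2 -h1.
by congr (nnE P G _ w); apply/funext => ?; rewrite big_cons.
Qed.

Lemma measurable_enorm (q : nat) (V : Omega -> 'rV[R]_q) :
  (forall l, measurable_fun setT (fun w => V w 0%R l)) ->
  measurable_fun setT (fun w => enorm (V w)).
Proof.
move=> mV.
have ms : measurable_fun setT (fun w => \sum_l (V w 0 l) ^+ 2)%R.
  by apply: measurable_sum => l; exact: measurable_funX.
apply: (measurableT_comp _ ms).
by apply: continuous_measurable_fun; exact: sqrt_continuous.
Qed.

(** Density of the rationals around [e]; dividing by [k + 1] covers [k = 0] as well. *)
Lemma le_rat_approx (x : \bar R) (S : \bar R) (k e : R) :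
  (0 <= k)%R -> 0 <= S ->
  (forall r : rat, x <= S + k%:E * `|e - ratr r|%:E) -> x <= S.
Proof.
move=> k0 S0 h; apply/lee_addgt0Pr => s s0.
have s1 : (0 < s / (k + 1))%R by rewrite divr_gt0// ltr_wpDl.
have /rat_in_itvoo[r] : (e < e + s / (k + 1))%R by rewrite ltrDl.
rewrite in_itv /= => /andP[h1 h2].
apply: (le_trans (h r)); rewrite leeD2l// lee_fin.
have le1 : (`|e - ratr r| <= s / (k + 1))%R.
  by rewrite distrC ger0_norm ?subr_ge0 ?(ltW h1)//; lra.
apply: (le_trans (ler_wpM2l k0 le1)).
by rewrite mulrCA ler_piMr ?(ltW s0)// ler_pdivrMr ?ltr_wpDl// mul1r lerDl.
Qed.

Section two_sigma_algebras.
Variables G1 G2 : set_system Omega.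
Hypotheses (s1 : sigma_algebra setT G1) (s2 : sigma_algebra setT G2).
Hypotheses (G12 : G1 `<=` G2) (G2M : G2 `<=` measurable).
Local Notation N1 := (enrm P G1).
Local Notation N2 := (enrm P G2).

Let G1M : G1 `<=` measurable. Proof. by move=> A /G12/G2M. Qed.

(* As [H] is centered given [G2], [U] may be recentered by any rational constant
   [r]; letting [r] approach [e w] pathwise replaces the pull-out property of
   conditional expectations. *)
Lemma enrm_weighted_le (q : nat) (X V H : Omega -> 'rV[R]_q) (U e : Omega -> R)
    (s : seq nat) (g h : nat -> Omega -> R) (kH : R) (k : nat -> R) :
  (forall l, real_condE P G2 (fun w => X w 0%R l) (fun w => V w 0%R l)) ->
  (forall l, real_condE P G2 (fun w => H w 0%R l) (fun=> 0%R)) ->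
  measurable_fun setT U -> measurable_wrt G2 e ->
  (forall m, measurable_fun setT (g m)) -> (forall m w, (0 <= g m w)%R) ->
  (forall m, measurable_fun setT (h m)) -> (forall m w, (0 <= h m w)%R) ->
  (0 <= kH)%R -> (forall m, (0 <= k m)%R) ->
  {ae P, forall w, N2 (fun w => (enorm (H w))%:E) w <= kH%:E} ->
  (forall m, {ae P, forall w, N2 (EFin \o h m) w <= (k m)%:E}) ->
  (forall r w, (enorm (X w - r *: H w) <=
    `|U w - r| * enorm (H w) + \sum_(m <- s) g m w * h m w)%R) ->
  {ae P, forall w, N1 (fun w => (enorm (V w))%:E) w <=
    kH%:E * N1 (fun w => `|U w - e w|%:E) w + \sum_(m <- s) (k m)%:E * N1 (EFin \o g m) w}.
Proof.
move=> cX cH mU Ge mg g0 mh h0 kH0 k0 HkH hk bnd.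
have me := measurable_wrt_fun G2M Ge.
have mcond (W1 W2 : Omega -> R) : real_condE P G2 W1 W2 ->
    measurable_fun setT W1 /\ measurable_fun setT W2.
  move=> [i1 [GV _]]; split; first by apply/measurable_EFinP; exact: measurable_int i1.
  by apply/measurable_EFinP; have := measurable_wrt_fun G2M GV.
have mnH : measurable_fun setT (fun w => enorm (H w)).
  by apply: measurable_enorm => l; have [] := mcond _ _ (cH l).
have mnV : measurable_fun setT (fun w => enorm (V w)).
  by apply: measurable_enorm => l; have [] := mcond _ _ (cX l).
pose A r w : \bar R := `|U w - r|%:E.
have mA r : measurable_fun setT (A r).
  by apply/measurable_EFinP/measurableT_comp => //; exact: measurable_funB.
have A0 r w : 0 <= A r w by rewrite lee_fin.
pose Q m w : \bar R := (g m w)%:E * (h m w)%:E.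
have mQ m : measurable_fun setT (Q m).
  by apply: emeasurable_funM; apply/measurable_EFinP.
have Q0 m w : 0 <= Q m w by rewrite mule_ge0 ?lee_fin.
have nH0 w : 0 <= (enorm (H w))%:E by rewrite lee_fin enorm_ge0.
have mAH r : measurable_fun setT (fun w => A r w * (enorm (H w))%:E).
  by apply: emeasurable_funM => //; exact/measurable_EFinP.
have AH0 r w : 0 <= A r w * (enorm (H w))%:E by rewrite mule_ge0.
have mS : measurable_fun setT (fun w => \sum_(m <- s) Q m w) by exact: emeasurable_sum.
have S0 w : 0 <= \sum_(m <- s) Q m w by exact: sume_ge0.
pose B w : \bar R := `|U w - e w|%:E.
have mB : measurable_fun setT B.
  by apply/measurable_EFinP/measurableT_comp => //; exact: measurable_funB.
have B0 w : 0 <= B w by rewrite lee_fin.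
pose C w := \sum_(m <- s) (k m)%:E * N2 (EFin \o g m) w.
have mg' m : measurable_fun setT (EFin \o g m) by exact/measurable_EFinP.
have mC m : measurable_fun setT (fun w => (k m)%:E * N2 (EFin \o g m) w).
  by apply: measurable_funeM; exact: measurable_enrm.
have C0 m w : 0 <= (k m)%:E * N2 (EFin \o g m) w.
  by rewrite mule_ge0 ?enrm_ge0// lee_fin.
have hr (r : rat) : {ae P, forall w,
    (enorm (V w))%:E <= kH%:E * N2 B w + C w + kH%:E * `|e w - ratr r|%:E}.
  have cXr l : real_condE P G2 (fun w => (X w - ratr r *: H w) 0 l)%R (fun w => V w 0%R l).
    have := real_condE_lin s2 G2M 1 (- ratr r) (cX l) (cH l).
    have -> : (fun w => 1 * X w 0 l + - ratr r * H w 0 l)%R =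
              (fun w => (X w - ratr r *: H w) 0 l)%R.
      by apply/funext => w; rewrite !mxE mul1r mulNr.
    have -> // : (fun w => 1 * V w 0 l + - ratr r * 0)%R = (fun w => V w 0 l)%R.
    by apply/funext => w; rewrite mulr0 addr0 mul1r.
  have a1 : {ae P, forall w, (enorm (V w))%:E <=
      nnE P G2 (fun w => A (ratr r) w * (enorm (H w))%:E + \sum_(m <- s) Q m w) w}.
    apply: (vec_condE_le s2 G2M cXr).
    - exact: emeasurable_funD.
    - by move=> w; rewrite adde_ge0.
    - apply: aeW => w; apply: (@le_trans _ _ (`|U w - ratr r| * enorm (H w) +
        \sum_(m <- s) g m w * h m w)%R%:E); first by rewrite lee_fin bnd.
      by rewrite EFinD EFinM -sumEFin leeD2l.
  have a2 := nnED P s2 G2M (mAH (ratr r)) (AH0 _) mS S0.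
  have a3 := nnE_sum s s2 G2M mQ Q0.
  have a4 := nnEM_le s2 G2M kH0 (mA (ratr r)) (iffRL (measurable_EFinP _ _) mnH) (A0 _) nH0 HkH.
  have a5 : {ae P, forall w, forall m, nnE P G2 (Q m) w <= (k m)%:E * N2 (EFin \o g m) w}.
    apply: ae_forall_count => m; apply: (nnEM_le s2 G2M) => //.
    - exact/measurable_EFinP.
    - exact/measurable_EFinP.
    - by move=> w; exact: g0.
    - by move=> w; exact: h0.
    - exact: hk.
  pose D w : \bar R := `|e w - ratr r|%:E.
  have GD : measurable_wrt G2 D.
    apply/(measurable_wrtE s2)/measurable_EFinP/measurableT_comp => //.
    by apply: measurable_funB => //; exact/(measurable_wrtE s2).
  have mD := measurable_wrt_fun G2M GD.
  have D0 w : 0 <= D w by rewrite lee_fin.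
  (* The triangle inequality moves the center from [ratr r] to [e]. The error [D] is
     [G2]-measurable, so its norm given [G2] is [D] itself. *)
  have a6 : {ae P, forall w, N2 (A (ratr r)) w <= N2 (fun w => B w + D w) w}.
    apply: (enrm_le s2 G2M) => //; first exact: emeasurable_funD.
    apply: aeW => w; rewrite /A /B /D -EFinD lee_fin.
    by rewrite (_ : U w - ratr r = U w - e w + (e w - ratr r))%R ?ler_normD//; ring.
  have a7 := enrmD P s2 G2M mB mD B0 D0.
  have a8 := enrm_id P s2 G2M GD D0.
  apply: filterS3 (filterI (filterI a1 a2) (filterI a3 a4)) (filterI a5 a6) (filterI a7 a8).
  move=> w [[b1 b2] [b3 b4]] [b5 b6] [b7 b8].
  apply: (le_trans b1); rewrite b2 b3.
  have b9 : N2 (A (ratr r)) w <= N2 B w + D w by rewrite -b8; exact: le_trans b7.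
  have b10 : nnE P G2 (fun w => A (ratr r) w * (enorm (H w))%:E) w <= kH%:E * N2 B w + kH%:E * D w.
    apply: (le_trans b4); rewrite -ge0_muleDr ?enrm_ge0//.
    by rewrite lee_wpmul2l// lee_fin.
  rewrite addeAC; apply: leeD => //.
  by rewrite /C; apply: lee_sum => m _; exact: b5.
have hV : {ae P, forall w, (enorm (V w))%:E <= kH%:E * N2 B w + C w}.
  apply: filterS (ae_forall_count hr) => w hw.
  apply: (le_rat_approx kH0) => //.
  rewrite adde_ge0// ?mule_ge0 ?enrm_ge0 ?lee_fin//.
  by apply: sume_ge0 => m _; exact: C0.
have mNB : measurable_fun setT (fun w => kH%:E * N2 B w).
  by apply: measurable_funeM; exact: measurable_enrm.
have NB0 w : 0 <= kH%:E * N2 B w by rewrite mule_ge0 ?enrm_ge0// lee_fin.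
have mCs : measurable_fun setT C by exact: emeasurable_sum.
have Cs0 w : 0 <= C w by apply: sume_ge0 => m _; exact: C0.
have nV0 w : 0 <= (enorm (V w))%:E by rewrite lee_fin enorm_ge0.
(* Norms given [G1] are taken only after [r] has been eliminated; each iterated norm then collapses
   by the tower property. *)
have c1 := enrm_le s1 G1M (iffRL (measurable_EFinP _ _) mnV) (emeasurable_funD mNB mCs) nV0 hV.
have c2 := enrmD P s1 G1M mNB mCs NB0 Cs0.
have c3 := enrm_sum P s1 G1M s mC C0.
have c4 := enrmZ P s1 G1M kH0 (measurable_enrm P s2 G2M mB).
have c5 := enrm_tower P s1 s2 G12 G2M mB.
have c6 : {ae P, forall w, forall m,
    N1 (fun w => (k m)%:E * N2 (EFin \o g m) w) w = (k m)%:E * N1 (EFin \o g m) w}.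
  apply: ae_forall_count => m.
  have c61 := enrmZ P s1 G1M (k0 m) (measurable_enrm P s2 G2M (mg' m)).
  have c62 := enrm_tower P s1 s2 G12 G2M (mg' m).
  by apply: filterS2 c61 c62 => w -> ->.
apply: filterS3 (filterI c1 c2) (filterI c3 c4) (filterI c5 c6).
move=> w [d1 d2] [d3 d4] [d5 d6].
apply: (le_trans d1); apply: (le_trans d2); rewrite d4 d5 leeD2l//.
apply: (le_trans d3); rewrite le_eqVlt; apply/orP; left; apply/eqP.
by apply: eq_bigr => m _; exact: d6.
Qed.

End two_sigma_algebras.
End weighted_step.

(* [lia] also preprocesses the inequalities over [R] in the context, which can
   take minutes; only the hypotheses on indices are kept. *)
Ltac lia_idx :=
  repeat match goal with
  | H : ?P |- _ =>
    lazymatch P with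
    | is_true (leq _ _) => fail
    | is_true (andb (leq _ _) (leq _ _)) => fail
    | is_true (negb (_ == _)) => fail
    | nat => fail
    | _ => clear H
    end
  end; lia.

(** * Inequalities for real powers *)

Section powers.
Context {R : realType}.
Implicit Types (a b x y : R).

Lemma invr_powRB x a : (x `^ (1 - a))^-1 = x `^ (a - 1).
Proof. by rewrite -powRN opprB. Qed.

Lemma divr_powRB x a u : u / x `^ (1 - a) = u * x `^ (a - 1).
Proof. by rewrite invr_powRB. Qed.

Lemma divr_powRB2 x y a b u :
  u / (x `^ (1 - a) * y `^ (1 - b)) = y `^ (b - 1) * (u * x `^ (a - 1)).
Proof. by rewrite invfM !invr_powRB mulrA mulrC. Qed.

(** The tangent line at [x] lies above the concave function [s^a]. The right-hand side is the
    integral of [s^(a-1)] from [y] to [x], so for [y <= x] this compares one rectangle of a Riemann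
    sum with its integral. *)
Lemma powR_tangent a x y : 0 < a -> a <= 1 -> 0 < x -> 0 <= y ->
  (x - y) * x `^ (a - 1) <= (x `^ a - y `^ a) / a.
Proof.
move=> a0 a1 x0 y0.
have xa : x `^ a = x * x `^ (a - 1) by rewrite mulr_powRB1// ltW.
have p0 : 0 < x `^ (a - 1) by rewrite powR_gt0.
rewrite ler_pdivlMr// xa.
have [->|yn0] := eqVneq y 0.
  by rewrite powR0 ?gt_eqF// !subr0 ler_piMr// mulr_ge0// ltW.
have yp : 0 < y by rewrite lt_neqAle eq_sym yn0.
pose r := y / x; have r0 : 0 < r by rewrite divr_gt0.
have m0 : 0 < 1 + a * (r - 1).
  have -> : 1 + a * (r - 1) = a * r + (1 - a) by ring.
  by rewrite ltr_wpDr ?subr_ge0// mulr_gt0.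
have lnle z : 0 < z -> ln z <= z - 1.
  by move=> z0; rewrite -{1}(subrK 1 z) addrC le_ln1Dx// ltrBrDl subrr.
(* Bernoulli's inequality. With [m] its right-hand side, the bounds [ln z <= z - 1] at [z = r / m]
   and [z = 1 / m], weighted by [a] and [1 - a], sum to [a * ln r - ln m <= 0]. *)
have ra : r `^ a <= 1 + a * (r - 1).
  rewrite -(lnK (_ : r `^ a \is Num.pos)) ?posrE ?powR_gt0// -[leRHS]lnK ?posrE//.
  rewrite ler_expR ln_powR.
  set m := 1 + a * (r - 1) in m0 *.
  have h1 : ln r - ln m <= r / m - 1 by rewrite -ln_div ?posrE// lnle// divr_gt0.
  have h2 : - ln m <= m^-1 - 1 by rewrite -lnV ?posrE// lnle// invr_gt0.
  have h3 : a * (ln r - ln m) <= a * (r / m - 1) by rewrite ler_pM2l.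
  have h4 : (1 - a) * - ln m <= (1 - a) * (m^-1 - 1) by rewrite ler_wpM2l// subr_ge0.
  have e : a * (r / m - 1) + (1 - a) * (m^-1 - 1) = 0.
    rewrite (_ : a * (r / m - 1) + (1 - a) * (m^-1 - 1) = (1 + a * (r - 1)) / m - 1); last by ring.
    by rewrite divff ?subrr// gt_eqF.
  by lra.
have ya : y `^ a <= x * x `^ (a - 1) * (1 + a * (r - 1)).
  have -> : y `^ a = x `^ a * r `^ a.
    by rewrite -powRM ?(ltW x0) ?(ltW r0)// mulrC divfK// gt_eqF.
  by rewrite -xa ler_wpM2l// powR_ge0.
have e : x * x `^ (a - 1) * (1 + a * (r - 1)) =
    x * x `^ (a - 1) - (x - y) * x `^ (a - 1) * a.
  by rewrite /r; field; rewrite gt_eqF.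
by lra.
Qed.

Lemma le_powR_neg a x y : a <= 0 -> 0 < x -> x <= y -> y `^ a <= x `^ a.
Proof.
move=> a0 x0 xy; have y0 := lt_le_trans x0 xy.
have e z : z `^ a = (z `^ (- a))^-1 by rewrite -powRN opprK.
rewrite !e lef_pV2 ?posrE ?powR_gt0//.
by rewrite ge0_ler_powR ?nnegrE ?oppr_ge0 ?(ltW x0) ?(ltW y0).
Qed.

(** At a distance of at least half the interval from its singularity, a power kernel is comparable
    to its value at full length. For [a < 1] the loss is [2^(1-a)], at most 2. *)
Lemma powR_half a x y : 0 < a -> 0 < y -> y / 2 <= x -> x <= y ->
  x `^ (a - 1) <= 2 * y `^ (a - 1).
Proof.
move=> a0 y0 yx xy; have y20 : 0 < y / 2 by rewrite divr_gt0.
have x0 := lt_le_trans y20 yx.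
have [a1|a1] := leP 1 a.
  apply: (@le_trans _ _ (y `^ (a - 1))).
    by rewrite ge0_ler_powR ?nnegrE ?subr_ge0// ltW.
  by rewrite ler_peMl ?powR_ge0// ler1n.
apply: (@le_trans _ _ ((y / 2) `^ (a - 1))).
  by apply: le_powR_neg => //; rewrite subr_le0 ltW.
rewrite powRM ?(ltW y0) ?invr_ge0// mulrC ler_wpM2r ?powR_ge0//.
rewrite -powR_inv1// -powRrM mulN1r opprB.
by rewrite ler1_powR ?ler1n// gerBl ltW.
Qed.

Lemma expRN_le_powR a x : 0 < a -> a <= 1 -> 0 < x -> expR (- x) <= x `^ (- a).
Proof.
move=> a0 a1 x0; rewrite expRN powRN lef_pV2 ?posrE ?powR_gt0 ?expR_gt0//.
apply: le_trans (expR_ge1Dx x).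
have [x1|x1] := leP 1 x.
  by apply: (@le_trans _ _ x); rewrite ?ler1_powR// lerDr.
apply: (@le_trans _ _ (1 `^ a)); last by rewrite powR1 lerDl ltW.
by rewrite ge0_ler_powR ?nnegrE// ltW.
Qed.

End powers.

Section sums.
Context {R : realType}.

Lemma sum_triangle (a N : nat) (F : nat -> nat -> R) :
  \sum_(a <= l < N) \sum_(l.+1 <= m < N) F l m =
  \sum_(a <= m < N) \sum_(a <= l < m) F l m.
Proof.
transitivity (\sum_(a <= l < N) \sum_(a <= m < N | (l < m)%N) F l m).
  rewrite !big_nat; apply: eq_bigr => l /andP[al lN].
  rewrite [RHS](big_cat_nat _ (n := l.+1))//=; last exact: leqW.
  rewrite [X in _ = X + _]big_nat_cond [X in _ = X + _]big_pred0 ?add0r; last first.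
    by move=> m; lia.
  rewrite [RHS]big_nat_cond [LHS]big_nat_cond; apply: eq_bigl => m.
  by lia.
rewrite (exchange_big_dep_nat xpredT)//=; apply: eq_big_nat => m /andP[am mN].
rewrite [LHS](big_cat_nat _ (n := m))//=; last exact: ltnW.
rewrite [X in _ + X = _]big_nat_cond [X in _ + X = _]big_pred0 ?addr0; last first.
  by move=> l; lia.
rewrite [RHS]big_nat_cond [LHS]big_nat_cond; apply: eq_bigl => l.
by lia.
Qed.

End sums.

(** * Time grids and the kernel sums of (P1) *)

Section grid.
Context {R : realType}.
Variables (T : R) (N : nat) (t : nat -> R).
Hypothesis tg : time_grid T N t.
Local Notation D := (step t).

Lemma grid_lt i j : (i < j <= N)%N -> t i < t j.
Proof.
case: tg => _ _ tlt; elim: j => [|j ih] /andP[ij jN]; first by [].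
have [->|ij'] := eqVneq i j; first exact: tlt.
by apply: lt_trans (tlt _ jN); apply: ih; lia_idx.
Qed.

Lemma grid_le i j : (i <= j <= N)%N -> t i <= t j.
Proof.
move=> /andP[ij jN]; have [->//|ij'] := eqVneq i j.
by rewrite ltW// grid_lt//; lia_idx.
Qed.

Lemma step_gt0 i : (i < N)%N -> 0 < D i.
Proof. by move=> iN; rewrite subr_gt0 grid_lt// ltnSn. Qed.

Lemma grid_le_T i : (i <= N)%N -> t i <= T.
Proof. by move=> iN; case: tg => _ <- _; rewrite grid_le// iN leqnn. Qed.

Lemma grid_lt_T i : (i < N)%N -> t i < T.
Proof. by move=> iN; case: tg => _ <- _; rewrite grid_lt// iN leqnn. Qed.

Lemma grid_ge0 i : (i <= N)%N -> 0 <= t i.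
Proof. by move=> iN; case: tg => <- _ _; rewrite grid_le. Qed.

Lemma grid_subT i j : (i <= j <= N)%N -> t j - t i <= T.
Proof.
move=> /andP[ij jN]; rewrite lerBlDr (le_trans (grid_le_T jN))// lerDl grid_ge0//.
exact: leq_trans jN.
Qed.

Lemma sum_step i k : (i <= k)%N -> \sum_(i <= j < k) D j = t k - t i.
Proof. by move=> ik; rewrite telescope_sumr. Qed.

(** For [a <= 1] the kernel increases towards its singularity at [t k], so sampling it at left
    endpoints stays below the integral. For [a > 1] it is at most its value at [t i]. The constant
    covers both cases. *)
Lemma right_kernel_sum a i k : 0 < a -> (i < k <= N)%N ->
  \sum_(i <= j < k) D j * (t k - t j) `^ (a - 1) <= (1 + a^-1) * (t k - t i) `^ a.
Proof.
move=> a0 /andP[ik kN].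
have L0 : 0 < t k - t i by rewrite subr_gt0 grid_lt// ik.
have [a1|a1] := leP a 1.
  apply: (@le_trans _ _ (a^-1 * (t k - t i) `^ a)); last first.
    by rewrite ler_wpM2r ?powR_ge0// lerDr.
  pose f j := - (a^-1 * (t k - t j) `^ a).
  apply: (@le_trans _ _ (\sum_(i <= j < k) (f j.+1 - f j))); last first.
    rewrite telescope_sumr ?(ltnW ik)// /f subrr powR0 ?gt_eqF// mulr0 oppr0.
    by rewrite sub0r opprK.
  rewrite big_nat [leRHS]big_nat; apply: ler_sum => j /andP[ij jk].
  have x0 : 0 < t k - t j by rewrite subr_gt0 grid_lt// jk.
  have y0 : 0 <= t k - t j.+1 by rewrite subr_ge0 grid_le// jk.
  have := powR_tangent a0 a1 x0 y0.
  rewrite (_ : t k - t j - (t k - t j.+1) = D j); last by rewrite /step; ring.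
  by move=> /le_trans; apply; rewrite /f; lra.
apply: (@le_trans _ _ ((t k - t i) `^ a)); last first.
  by rewrite ler_peMl ?powR_ge0// lerDl invr_ge0 ltW.
rewrite -(mulr_powRB1 (ltW L0) a0) -sum_step ?(ltnW ik)// mulr_suml.
rewrite sum_step ?(ltnW ik)//.
rewrite big_nat [leRHS]big_nat; apply: ler_sum => j /andP[ij jk].
have jN : (j < N)%N by lia_idx.
rewrite ler_wpM2l ?(ltW (step_gt0 _))//.
rewrite ge0_ler_powR ?nnegrE ?subr_ge0 ?(ltW a1)//.
- by rewrite grid_le// (ltnW jk).
- by rewrite grid_le// (ltnW ik).
- by rewrite lerB// grid_le// ij ltnW.
Qed.

End grid.

Section kernel_sums.
Context {R : realType}.
Variables (T Rpi : R) (N : nat) (t : nat -> R).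
Hypotheses (tg : time_grid T N t) (Rpi0 : 0 < Rpi) (tr : step_ratio_le N t Rpi).
Local Notation D := (step t).

(** Here the singularity is on the left, and for [b <= 1] the node [t j] overestimates the kernel on
    its step. The ratio bound gives [t j.+1 - t i <= (1 + Rpi) * (t j - t i)], so moving the node to
    the right end costs at most a factor [1 + Rpi], after which the sum is below the integral. *)
Lemma left_kernel_sum b i k : 0 < b -> (i < k <= N)%N ->
  \sum_(i.+1 <= j < k) D j * (t j - t i) `^ (b - 1)
    <= (1 + (1 + Rpi) / b) * (t k - t i) `^ b.
Proof.
move=> b0 /andP[ik kN].
have L0 : 0 < t k - t i by rewrite subr_gt0 (grid_lt tg)// ik.
have r1 : 1 <= 1 + Rpi by rewrite lerDl ltW.
have r0 : 0 < 1 + Rpi by rewrite (lt_le_trans ltr01).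
have [b1|b1] := leP b 1.
  apply: (@le_trans _ _ ((1 + Rpi) / b * (t k - t i) `^ b)); last first.
    by rewrite ler_wpM2r ?powR_ge0// lerDr.
  pose f j := (1 + Rpi) / b * (t j - t i) `^ b.
  apply: (@le_trans _ _ (\sum_(i.+1 <= j < k) (f j.+1 - f j))); last first.
    rewrite telescope_sumr// /f gerBl mulr_ge0 ?powR_ge0// divr_ge0// ltW//.
  rewrite big_nat [leRHS]big_nat; apply: ler_sum => j /andP[ij jk].
  have jN : (j < N)%N by lia_idx.
  have x0 : 0 < t j.+1 - t i by rewrite subr_gt0 (grid_lt tg)//; lia_idx.
  have z0 : 0 < t j - t i by rewrite subr_gt0 (grid_lt tg)//; lia_idx.
  have xz : t j.+1 - t i <= (1 + Rpi) * (t j - t i).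
    have h : D j <= Rpi * (t j - t i).
      case: j ij jk jN {x0} z0 => [//|j] ij jk jN z0.
      have Dj : 0 < D j by apply: (step_gt0 tg); exact: ltnW.
      have := tr jN; rewrite ler_pdivrMr// => /le_trans; apply.
      rewrite ler_wpM2l ?(ltW Rpi0)// /step lerB// (grid_le tg)//; lia_idx.
    by move: h; rewrite /step; lra.
  have := powR_tangent b0 b1 x0 (ltW z0).
  rewrite (_ : t j.+1 - t i - (t j - t i) = D j); last by rewrite /step; ring.
  move=> h.
  have h2 : (t j - t i) `^ (b - 1) <= (1 + Rpi) * (t j.+1 - t i) `^ (b - 1).
    rewrite -!invr_powRB ler_pdivlMr ?powR_gt0// mulrC ler_pdivrMr ?powR_gt0//.
    apply: (@le_trans _ _ (((1 + Rpi) * (t j - t i)) `^ (1 - b))).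
      by rewrite ge0_ler_powR ?nnegrE ?subr_ge0// ?(le_trans (ltW x0) xz)// -subr_ge0 ltW.
    rewrite powRM ?(ltW r0) ?(ltW z0)// ler_wpM2r ?powR_ge0//.
    by rewrite ler1_powR// gerBl ltW.
  apply: (@le_trans _ _ (D j * ((1 + Rpi) * (t j.+1 - t i) `^ (b - 1)))).
    by rewrite ler_wpM2l// ltW// (step_gt0 tg).
  rewrite mulrCA /f -mulrBr -mulrA ler_wpM2l ?(ltW r0)//.
  by apply: (le_trans h); rewrite mulrC.
apply: (@le_trans _ _ ((t k - t i) `^ b)); last first.
  by rewrite ler_peMl ?powR_ge0// lerDl divr_ge0// ltW.
rewrite -(mulr_powRB1 (ltW L0) b0).
apply: (@le_trans _ _ ((t k - t i.+1) * (t k - t i) `^ (b - 1))); last first.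
  by rewrite ler_wpM2r ?powR_ge0// lerB// (grid_le tg)//; lia_idx.
rewrite -sum_step// mulr_suml.
rewrite big_nat [leRHS]big_nat; apply: ler_sum => j /andP[ij jk].
have jN : (j < N)%N by lia_idx.
rewrite ler_wpM2l ?(ltW (step_gt0 tg _))//.
rewrite ge0_ler_powR ?nnegrE ?subr_ge0 ?(ltW b1)//.
- by rewrite (grid_le tg)//; lia_idx.
- by rewrite (grid_le tg)//; lia_idx.
- by rewrite lerB// (grid_le tg)//; lia_idx.
Qed.

(** The sum of the constants for the two ends of the interval; the factor 2 is that of
    [powR_half]. *)
Definition kernel_cst (a b : R) : R := 2 * ((1 + (1 + Rpi) / b) + (1 + a^-1)).

Lemma kernel_cst_ge0 a b : 0 < a -> 0 < b -> 0 <= kernel_cst a b.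
Proof.
by move=> a0 b0; rewrite /kernel_cst mulr_ge0// !addr_ge0// ?divr_ge0 ?addr_ge0 ?invr_ge0// ltW.
Qed.

Lemma kernel_sum1 a i k : 0 < a -> (i < k <= N)%N ->
  \sum_(i <= j < k) D j * (t k - t j) `^ (a - 1) <= kernel_cst a 1 * (t k - t i) `^ a.
Proof.
move=> a0 ikN; apply: (le_trans (right_kernel_sum tg a0 ikN)).
rewrite ler_wpM2r ?powR_ge0// /kernel_cst divr1.
have : 0 <= a^-1 by rewrite invr_ge0 ltW.
by move: Rpi0; lra.
Qed.

Lemma kernel_sum2 a b i k : 0 < a -> 0 < b -> (i < k <= N)%N ->
  \sum_(i.+1 <= j < k) (t j - t i) `^ (b - 1) * (D j * (t k - t j) `^ (a - 1))
    <= kernel_cst a b * (t k - t i) `^ (a + b - 1).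
Proof.
move=> a0 b0 ikN; have /andP[ik kN] := ikN.
have L0 : 0 < t k - t i by rewrite subr_gt0 (grid_lt tg)// ik.
have S1 := right_kernel_sum tg a0 ikN; have S2 := left_kernel_sum b0 ikN.
have Ln0 : t k - t i != 0 by rewrite gt_eqF.
set La := (t k - t i) `^ (a - 1); set Lb := (t k - t i) `^ (b - 1).
apply: (@le_trans _ _ (\sum_(i.+1 <= j < k)
    (2 * La * (D j * (t j - t i) `^ (b - 1)) +
     2 * Lb * (D j * (t k - t j) `^ (a - 1))))).
  rewrite big_nat [leRHS]big_nat; apply: ler_sum => j /andP[ij jk].
  have jN : (j < N)%N by lia_idx.
  have x0 : 0 < t k - t j by rewrite subr_gt0 (grid_lt tg)//; lia_idx.
  have z0 : 0 < t j - t i by rewrite subr_gt0 (grid_lt tg)//; lia_idx.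
  have xL : t k - t j <= t k - t i by rewrite lerB// (grid_le tg)//; lia_idx.
  have zL : t j - t i <= t k - t i by rewrite lerB// (grid_le tg)//; lia_idx.
  set X := (t k - t j) `^ (a - 1); set Z := (t j - t i) `^ (b - 1).
  have X0 : 0 <= X by exact: powR_ge0.
  have Z0 : 0 <= Z by exact: powR_ge0.
  have La0 : 0 <= La by exact: powR_ge0.
  have Lb0 : 0 <= Lb by exact: powR_ge0.
  have D0 := ltW (step_gt0 tg jN).
  (* Every node is at least half the length away from one of the ends; the factor singular at that
     end is replaced by a constant, leaving a one-sided sum. *)
  have [h|h] := leP ((t k - t i) / 2) (t k - t j).
    have h1 : X <= 2 * La by apply: powR_half.
    have h2 := ler_wpM2l (mulr_ge0 D0 Z0) h1.
    have : 0 <= 2 * Lb * (D j * X) by rewrite !mulr_ge0.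
    by lra.
  have h1 : Z <= 2 * Lb.
    by apply: powR_half => //; lra.
  have h2 := ler_wpM2l (mulr_ge0 D0 X0) h1.
  have : 0 <= 2 * La * (D j * Z) by rewrite !mulr_ge0.
  by lra.
have S1' : \sum_(i.+1 <= j < k) D j * (t k - t j) `^ (a - 1) <=
    (1 + a^-1) * (t k - t i) `^ a.
  apply: le_trans S1; rewrite [leRHS]big_ltn// lerDr mulr_ge0 ?powR_ge0//.
  by rewrite ltW// (step_gt0 tg)//; lia_idx.
rewrite big_split/= -!mulr_sumr.
have e : (t k - t i) `^ (a + b - 1) = La * (t k - t i) `^ b.
  by rewrite /La /Lb -powRD ?Ln0 ?implybT//; congr (_ `^ _); ring.
have e' : (t k - t i) `^ (a + b - 1) = Lb * (t k - t i) `^ a.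
  by rewrite /La /Lb -powRD ?Ln0 ?implybT//; congr (_ `^ _); ring.
rewrite /kernel_cst mulrDr mulrDl {1}e e'.
have -> : forall x y z : R, 2 * x * (y * z) = 2 * y * (x * z) by move=> *; ring.
have -> : 2 * (1 + a^-1) * (Lb * (t k - t i) `^ a) =
  2 * Lb * ((1 + a^-1) * (t k - t i) `^ a) by ring.
by rewrite lerD// ler_wpM2l// mulr_ge0// powR_ge0.
Qed.

Lemma kernel_sum_boundsP : kernel_sum_bounds N t kernel_cst.
Proof.
move=> a b a0 b0 i k ikN; split.
  apply: le_trans (kernel_sum1 a0 ikN); rewrite le_eqVlt; apply/orP; left; apply/eqP.
  by apply: eq_bigr => j _; exact: divr_powRB.
apply: le_trans (kernel_sum2 a0 b0 ikN); rewrite le_eqVlt; apply/orP; left; apply/eqP.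
by apply: eq_bigr => j _; exact: divr_powRB2.
Qed.

End kernel_sums.

(** * The discrete Gronwall inequality (P2) *)

Section gronwall.
Context {R : realType}.
Variables (T Rpi : R) (N : nat) (t : nat -> R).
Hypotheses (T0 : 0 < T) (tg : time_grid T N t).
Hypotheses (Rpi0 : 0 < Rpi) (tr : step_ratio_le N t Rpi).
Variables (theta c : R).
Hypotheses (theta01 : 0 < theta <= 1) (c0 : 0 <= c).
Local Notation D := (step t).
Local Notation B := (kernel_cst Rpi).

(** The time step with the blow-up of the Lipschitz constant near [T] absorbed into it. *)
Definition wstep l : R := D l / (T - t l) `^ ((1 - theta) / 2).

Lemma wstep_ge0 l : (l < N)%N -> 0 <= wstep l.
Proof.
by move=> lN; rewrite /wstep divr_ge0 ?powR_ge0// ltW// (step_gt0 tg).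
Qed.

(** Since [t m <= T], the distance [T - t l] is at least [t m - t l]; the two singular factors then
    combine into one convolution kernel. *)
Lemma wstep_le l m : (l < m < N)%N ->
  wstep l / (t m - t l) `^ 2^-1 <= D l * (t m - t l) `^ (theta / 2 - 1).
Proof.
move=> /andP[lm mN]; have lN := ltn_trans lm mN.
have x0 : 0 < t m - t l by rewrite subr_gt0 (grid_lt tg)// lm ltnW.
have -> : theta / 2 - 1 = - ((1 - theta) / 2 + 2^-1) by field.
rewrite powRN powRD; last by rewrite (gt_eqF x0) implybT.
rewrite invfM /wstep -mulrA; rewrite ler_wpM2l ?(ltW (step_gt0 tg lN))//.
rewrite ler_wpM2r ?invr_ge0 ?powR_ge0// lef_pV2 ?posrE ?powR_gt0//; last first.
  by rewrite subr_gt0 (grid_lt_T tg).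
rewrite ge0_ler_powR ?nnegrE ?(ltW x0)//.
- by case/andP: theta01 => _ h; rewrite divr_ge0// subr_ge0.
- by rewrite subr_ge0 ltW// (grid_lt_T tg).
- by rewrite lerB// (grid_le_T tg)// ltnW.
Qed.

Lemma weighted_sumE gamma (u : nat -> R) j :
  weighted_sum T N t theta gamma u j =
  \sum_(j.+1 <= l < N) (t l - t j) `^ (gamma - 1) * (wstep l * u l).
Proof.
apply: eq_bigr => l _; rewrite -invr_powRB /wstep.
move: (_ `^ (1 - gamma)) (_ `^ ((1 - theta) / 2)) => x y.
by rewrite invfM; ring.
Qed.

(* As [exp(- lam s) <= (lam s)^(- theta/4)], damping trades the power [s^(theta/4)]
   for the factor [lam^(- theta/4)]; this [lam] makes the latter small enough. *)
Definition damping g : R :=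
  (2 * c * B (theta / 4) g * T `^ (theta / 4) + 1) `^ (4 / theta).

Lemma damping_base_ge0 g : 0 < g ->
  0 <= 2 * c * B (theta / 4) g * T `^ (theta / 4).
Proof.
move=> g0; case/andP: theta01 => th0 _.
have B0 := kernel_cst_ge0 Rpi0 (divr_gt0 th0 (ltr0Sn R 3)) g0.
exact: (mulr_ge0 (mulr_ge0 (mulr_ge0 (ler0n R 2) c0) B0) (powR_ge0 _ _)).
Qed.

Lemma damping_gt0 g : 0 < g -> 0 < damping g.
Proof.
by move=> g0; rewrite powR_gt0// ltr_wpDl// damping_base_ge0.
Qed.

Lemma damping_powR g : 0 < g ->
  damping g `^ (theta / 4) = 2 * c * B (theta / 4) g * T `^ (theta / 4) + 1.
Proof.
move=> g0; case/andP: theta01 => th0 _.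
rewrite /damping -powRrM (_ : 4 / theta * (theta / 4) = 1); last by field; rewrite gt_eqF.
by rewrite powRr1// addr_ge0// damping_base_ge0.
Qed.

Lemma damped_kernel g s : 0 < g -> 0 < s ->
  s `^ (theta / 2 - 1) * expR (- (damping g * s)) <=
  (damping g `^ (theta / 4))^-1 * s `^ (theta / 4 - 1).
Proof.
move=> g0 s0; case/andP: theta01 => th0 th1.
have l0 := damping_gt0 g0.
have d0 : 0 < theta / 4 by rewrite divr_gt0.
have d1 : theta / 4 <= 1 by rewrite ler_pdivrMr// mul1r (le_trans th1)// ler1n.
have := expRN_le_powR d0 d1 (mulr_gt0 l0 s0).
rewrite powRM ?(ltW l0) ?(ltW s0)// => h.
apply: (le_trans (ler_wpM2l (powR_ge0 _ _) h)).
rewrite mulrCA -powRN ler_wpM2l ?powR_ge0//.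
rewrite -powRD; last by rewrite (gt_eqF s0) implybT.
by rewrite (_ : theta / 2 - 1 + - (theta / 4) = theta / 4 - 1)//; field.
Qed.

(* The weight [expR (lam * t l)] turns the Volterra kernel into a contraction
   of ratio 1/2 once [lam] is large. *)
Lemma gronwall_kernel a lam (kap u w : nat -> R) : 0 <= lam ->
  (forall l, (a <= l < N)%N -> 0 <= kap l) ->
  (forall l, (a <= l < N)%N -> 0 <= u l) ->
  (forall l, (a <= l < N)%N -> 0 <= w l) ->
  (forall m, (a <= m < N)%N ->
    c * \sum_(a <= l < m) kap l *
      (D l * ((t m - t l) `^ (theta / 2 - 1) * expR (- (lam * (t m - t l)))))
      <= kap m / 2) ->
  (forall j, (a <= j < N)%N ->
     u j <= w j + c * weighted_sum T N t theta 2^-1 u j) ->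
  \sum_(a <= l < N) kap l * (wstep l * u l) <=
  2 * expR (lam * T) * \sum_(a <= l < N) kap l * (wstep l * w l).
Proof.
move=> lam0 kap0 u0 w0 hk hu.
pose E (v : nat -> R) := \sum_(a <= l < N) kap l * wstep l * expR (lam * t l) * v l.
have W0 l : (a <= l < N)%N -> 0 <= kap l * wstep l * expR (lam * t l).
  move=> h; have lN : (l < N)%N by case/andP: h.
  exact: mulr_ge0 (mulr_ge0 (kap0 l h) (wstep_ge0 lN)) (expR_ge0 _).
have lowerE : \sum_(a <= l < N) kap l * (wstep l * u l) <= E u.
  rewrite big_nat [leRHS]big_nat; apply: ler_sum => l h.
  have lN : (l < N)%N by case/andP: h.
  have e1 : 1 <= expR (lam * t l).
    by rewrite -expR0 ler_expR mulr_ge0// (grid_ge0 tg)// ltnW.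
  have h0 := mulr_ge0 (mulr_ge0 (kap0 l h) (wstep_ge0 lN)) (u0 l h).
  by have := ler_wpM2l h0 e1; lra.
have upperE : E w <= expR (lam * T) * \sum_(a <= l < N) kap l * (wstep l * w l).
  rewrite /E mulr_sumr big_nat [leRHS]big_nat; apply: ler_sum => l h.
  have lN : (l < N)%N by case/andP: h.
  have e1 : expR (lam * t l) <= expR (lam * T).
    by rewrite ler_expR ler_wpM2l// (grid_le_T tg)// ltnW.
  have h0 := mulr_ge0 (mulr_ge0 (kap0 l h) (wstep_ge0 lN)) (w0 l h).
  by have := ler_wpM2l h0 e1; lra.
(* Summing the Volterra inequality against the exponential weight and exchanging the sums leaves,
   for each [m], exactly the inner sum bounded by [hk]. *)
have stepE : E u <= E w + 2^-1 * E u.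
  apply: (@le_trans _ _ (\sum_(a <= l < N) (kap l * wstep l * expR (lam * t l) * w l +
      \sum_(l.+1 <= m < N) c * (kap l * wstep l * expR (lam * t l) *
        ((t m - t l) `^ (2^-1 - 1) * (wstep m * u m)))))).
    rewrite /E big_nat [leRHS]big_nat; apply: ler_sum => l h.
    rewrite -mulr_sumr -mulr_sumr -weighted_sumE [X in _ + X]mulrCA -mulrDr.
    by rewrite ler_wpM2l ?W0// hu.
  rewrite big_split/= lerD2l sum_triangle /E mulr_sumr.
  rewrite big_nat [leRHS]big_nat; apply: ler_sum => m h.
  have mN : (m < N)%N by case/andP: h.
  have k1 := hk m h.
  have h0 : 0 <= wstep m * expR (lam * t m) * u m.
    exact: mulr_ge0 (mulr_ge0 (wstep_ge0 mN) (expR_ge0 _)) (u0 m h).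
  rewrite (_ : 2^-1 * _ = kap m / 2 * (wstep m * expR (lam * t m) * u m)); last by ring.
  apply: le_trans (ler_wpM2r h0 k1).
  rewrite mulr_sumr mulr_suml big_nat [leRHS]big_nat; apply: ler_sum => l /andP[al lm].
  have lmN : (l < m < N)%N by rewrite lm.
  have hl : (a <= l < N)%N by rewrite al (ltn_trans lm).
  have q := wstep_le lmN.
  have -> : (t m - t l) `^ (2^-1 - 1) = ((t m - t l) `^ 2^-1)^-1.
    by rewrite -powRN; congr (_ `^ _); field.
  (* The weight is moved from [t l] to the later [t m], leaving the damping factor
     [exp(- lam (t m - t l))]. *)
  rewrite (_ : expR (lam * t l) = expR (- (lam * (t m - t l))) * expR (lam * t m)); last first.
    by rewrite -expRD; congr expR; ring.
  have g0 : 0 <= c * kap l * expR (- (lam * (t m - t l))) * (wstep m * expR (lam * t m) * u m).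
    exact: mulr_ge0 (mulr_ge0 (mulr_ge0 c0 (kap0 l hl)) (expR_ge0 _)) h0.
  by have := ler_wpM2l g0 q; lra.
(* All terms are real, so half of [E u] moves to the left and [E u <= 2 * E w]. *)
apply: (le_trans lowerE).
by rewrite -mulrA; lra.
Qed.

(** The kernel [(t l - t i)^(g-1)] reproduces itself: by the two-sided sum of (P1), convolving it
    with the damped kernel returns a multiple of it, made at most 1/2 by [damping]. *)
Lemma gronwall_left g i (u w : nat -> R) : 0 < g -> (i <= N)%N ->
  (forall l, (i < l < N)%N -> 0 <= u l) ->
  (forall l, (i < l < N)%N -> 0 <= w l) ->
  (forall j, (i < j < N)%N ->
     u j <= w j + c * weighted_sum T N t theta 2^-1 u j) ->
  weighted_sum T N t theta g u i <=
  2 * expR (damping g * T) * weighted_sum T N t theta g w i.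
Proof.
move=> g0 iN u0 w0 hu; rewrite !weighted_sumE.
have l0 := damping_gt0 g0.
apply: gronwall_kernel => //; first exact: ltW.
  by move=> l _; exact: powR_ge0.
move=> m /andP[im mN].
case/andP: theta01 => th0 th1.
have d0 : 0 < theta / 4 by rewrite divr_gt0.
have imN : (i < m <= N)%N by rewrite im ltnW.
have hB := kernel_sum2 tg Rpi0 tr d0 g0 imN.
have B0 := kernel_cst_ge0 Rpi0 d0 g0.
have z0 : 0 < t m - t i by rewrite subr_gt0 (grid_lt tg).
set Lam := damping g `^ (theta / 4).
have L0 : 0 < Lam by rewrite powR_gt0.
apply: (@le_trans _ _ (c * (Lam^-1 * (B (theta / 4) g * (t m - t i) `^ (theta / 4 + g - 1))))).
  rewrite ler_wpM2l//; apply: le_trans (ler_wpM2l _ hB); last by rewrite invr_ge0 ltW.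
  rewrite mulr_sumr big_nat [leRHS]big_nat; apply: ler_sum => l /andP[il lm].
  have lN := ltn_trans lm mN.
  have s0 : 0 < t m - t l by rewrite subr_gt0 (grid_lt tg)// lm ltnW.
  have q := damped_kernel g0 s0.
  have D0 : 0 <= D l * (t l - t i) `^ (g - 1).
    by rewrite mulr_ge0 ?powR_ge0// ltW// (step_gt0 tg).
  have := ler_wpM2l D0 q.
  by rewrite -/Lam; lra.
have -> : (t m - t i) `^ (theta / 4 + g - 1) =
    (t m - t i) `^ (theta / 4) * (t m - t i) `^ (g - 1).
  by rewrite -powRD ?addrA// (gt_eqF z0) implybT.
have zT : (t m - t i) `^ (theta / 4) <= T `^ (theta / 4).
  rewrite ge0_ler_powR ?nnegrE ?(ltW d0) ?(ltW z0) ?(ltW T0)//.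
  by rewrite (grid_subT tg)// (ltnW im) ltnW.
have LE : Lam = 2 * c * B (theta / 4) g * T `^ (theta / 4) + 1 by exact: damping_powR.
have cB0 : 0 <= c * B (theta / 4) g by rewrite mulr_ge0.
(* The base of [damping] was chosen for this bound; the [+ 1] in it keeps [Lam] positive when
   [c = 0]. *)
have key : c * B (theta / 4) g * (t m - t i) `^ (theta / 4) <= Lam / 2.
  apply: (le_trans (ler_wpM2l cB0 zT)); rewrite LE; lra.
have p0 : 0 <= (t m - t i) `^ (g - 1) by exact: powR_ge0.
have kk : Lam^-1 * (c * B (theta / 4) g * (t m - t i) `^ (theta / 4)) <= 2^-1.
  by rewrite ler_pdivrMl.
by have := ler_wpM2r p0 kk; lra.
Qed.

(** The case of the constant kernel with the term [l = i] included. [weighted_sum] starts at [i.+1],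
    whereas the bound on [y i] involves [z i]. *)
Lemma gronwall_flat i (u w : nat -> R) : (i <= N)%N ->
  (forall l, (i <= l < N)%N -> 0 <= u l) ->
  (forall l, (i <= l < N)%N -> 0 <= w l) ->
  (forall j, (i <= j < N)%N ->
     u j <= w j + c * weighted_sum T N t theta 2^-1 u j) ->
  \sum_(i <= l < N) wstep l * u l <=
  2 * expR (damping 1 * T) * \sum_(i <= l < N) wstep l * w l.
Proof.
move=> iN u0 w0 hu.
have l0 := damping_gt0 ltr01.
have := @gronwall_kernel i (damping 1) (fun=> 1) u w (ltW l0) (fun _ _ => ler01) u0 w0 _ hu.
have e (v : nat -> R) : \sum_(i <= l < N) 1 * (wstep l * v l) =
    \sum_(i <= l < N) wstep l * v l by apply: eq_bigr => l _; rewrite mul1r.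
rewrite !e; apply => m /andP[im mN].
have [->|im'] := eqVneq i m; first by rewrite big_geq// mulr0 divr_ge0.
case/andP: theta01 => th0 th1.
have d0 : 0 < theta / 4 by rewrite divr_gt0.
have imN : (i < m <= N)%N by lia_idx.
have hB := kernel_sum1 tg Rpi0 d0 imN.
have B0 := kernel_cst_ge0 Rpi0 d0 ltr01.
have z0 : 0 < t m - t i by rewrite subr_gt0 (grid_lt tg).
set Lam := damping 1 `^ (theta / 4).
have L0 : 0 < Lam by rewrite powR_gt0.
apply: (@le_trans _ _ (c * (Lam^-1 * (B (theta / 4) 1 * (t m - t i) `^ (theta / 4))))).
  rewrite ler_wpM2l//; apply: le_trans (ler_wpM2l _ hB); last by rewrite invr_ge0 ltW.
  rewrite mulr_sumr big_nat [leRHS]big_nat; apply: ler_sum => l /andP[il lm].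
  have lN := ltn_trans lm mN.
  have s0 : 0 < t m - t l by rewrite subr_gt0 (grid_lt tg)// lm ltnW.
  have q := damped_kernel ltr01 s0.
  have D0 : 0 <= D l by rewrite ltW// (step_gt0 tg).
  have := ler_wpM2l D0 q.
  by rewrite -/Lam; lra.
have zT : (t m - t i) `^ (theta / 4) <= T `^ (theta / 4).
  rewrite ge0_ler_powR ?nnegrE ?(ltW d0) ?(ltW z0) ?(ltW T0)//.
  by rewrite (grid_subT tg)// im ltnW.
have LE : Lam = 2 * c * B (theta / 4) 1 * T `^ (theta / 4) + 1 by exact: damping_powR.
have cB0 : 0 <= c * B (theta / 4) 1 by rewrite mulr_ge0.
have key : c * B (theta / 4) 1 * (t m - t i) `^ (theta / 4) <= Lam / 2.
  apply: (le_trans (ler_wpM2l cB0 zT)); rewrite LE; lra.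
have kk : Lam^-1 * (c * B (theta / 4) 1 * (t m - t i) `^ (theta / 4)) <= 2^-1.
  by rewrite ler_pdivrMl.
by move: kk; lra.
Qed.

Lemma weighted_sum_ge0 g (w : nat -> R) j :
  (forall l, (j < l < N)%N -> 0 <= w l) -> 0 <= weighted_sum T N t theta g w j.
Proof.
move=> w0; rewrite weighted_sumE big_nat; apply: sumr_ge0 => l /andP[jl lN].
apply: mulr_ge0 (powR_ge0 _ _) (mulr_ge0 (wstep_ge0 lN) _).
by rewrite w0// jl.
Qed.

Lemma gronwall_boundP g : 0 < g ->
  gronwall_bound T N t theta c g (4 * expR (damping g * T)).
Proof.
move=> g0 k kN u w u0 w0 hu j /andP[kj jN].
apply: (@le_trans _ _ (2 * expR (damping g * T) * weighted_sum T N t theta g w j)).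
  apply: gronwall_left => // l /andP[jl lN].
  - by apply: u0; lia_idx.
  - by apply: w0; lia_idx.
  - by apply: hu; lia_idx.
rewrite ler_wpM2r ?weighted_sum_ge0//.
  by move=> l /andP[jl lN]; apply: w0; lia_idx.
by rewrite ler_wpM2r ?expR_ge0// ler_nat.
Qed.

End gronwall.

(** * Stability of the deterministic recursion for real sequences *)

Section stability.
Context {R : realType}.
Variables (T Rpi : R) (N : nat) (t : nat -> R).
Hypotheses (T0 : 0 < T) (tg : time_grid T N t).
Hypotheses (Rpi0 : 0 < Rpi) (tr : step_ratio_le N t Rpi).
Variables (theta Lf CM : R).
Hypotheses (theta01 : 0 < theta <= 1) (Lf0 : 0 <= Lf) (CM0 : 0 <= CM).
Local Notation D := (step t).
Local Notation B := (kernel_cst Rpi).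
Local Notation wst := (wstep T t theta).
Local Notation c := (Lf * (CM + Num.sqrt T)).
Local Notation rs l j := ((t l - t j) `^ (- 2^-1)).

Let th0 : 0 < theta. Proof. by case/andP: theta01. Qed.
Let th20 : 0 < theta / 2. Proof. by rewrite divr_gt0. Qed.
Let tN : t N = T. Proof. by case: tg. Qed.
Let half0 : 0 < 2^-1 :> R. Proof. by rewrite invr_gt0. Qed.
Let th30 : 0 < 2^-1 + theta / 2. Proof. by rewrite addr_gt0. Qed.
Let c0 : 0 <= c. Proof. by rewrite mulr_ge0// addr_ge0// sqrtr_ge0. Qed.
Let hB1 := @kernel_sum1 R T Rpi N t tg Rpi0.
Let hB2 := @kernel_sum2 R T Rpi N t tg Rpi0 tr.

Let B0 a b : 0 < a -> 0 < b -> 0 <= B a b. Proof. exact: kernel_cst_ge0. Qed.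

Lemma powR_le_T (b x : R) : 0 <= b -> 0 <= x -> x <= T -> x `^ b <= T `^ b.
Proof. by move=> b0 x0 xT; rewrite ge0_ler_powR ?nnegrE// ltW. Qed.

(** The origin of [CM + sqrt T]: the kernel 1 of the [y] recursion is dominated by [sqrt T] times
    the singular kernel of the [z] recursion, so the two add up to a single Volterra inequality. *)
Lemma one_le_sqrtT_rs l j : (j < l <= N)%N -> 1 <= Num.sqrt T * rs l j.
Proof.
move=> /andP[jl lN]; have x0 : 0 < t l - t j by rewrite subr_gt0 (grid_lt tg)// jl.
rewrite powRN ler_pdivlMr ?powR_gt0// mul1r -powR12_sqrt ?(ltW T0)//.
by rewrite powR_le_T ?(ltW half0) ?(ltW x0)// (grid_subT tg)// (ltnW jl).
Qed.

Lemma sum_wstep i : (i <= N)%N ->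
  \sum_(i <= l < N) wst l <= B (2^-1 + theta / 2) 1 * Num.sqrt T * T `^ (theta / 2).
Proof.
move=> iN; have [->|iN'] := eqVneq i N.
  rewrite big_geq//.
  exact: mulr_ge0 (mulr_ge0 (B0 th30 ltr01) (sqrtr_ge0 _)) (powR_ge0 _ _).
have iNN : (i < N <= N)%N by rewrite ltn_neqAle iN' iN leqnn.
have h := hB1 th30 iNN; move: h; rewrite tN => h.
rewrite (eq_big_nat _ _ (F2 := fun l => D l * (T - t l) `^ (2^-1 + theta / 2 - 1))); last first.
  by move=> l _; rewrite -divr_powRB /wstep; congr (_ / _ `^ _); field.
apply: (le_trans h).
rewrite -mulrA ler_wpM2l ?B0// -powR12_sqrt ?(ltW T0)// -powRD; last first.
  by rewrite (gt_eqF T0) implybT.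
rewrite powR_le_T ?(ltW th30)// ?subr_ge0 ?(grid_le_T tg)//.
by rewrite gerBl (grid_ge0 tg).
Qed.

Lemma wstep_rsT l : (l < N)%N ->
  wst l * (T - t l) `^ (- 2^-1) = D l * (T - t l) `^ (theta / 2 - 1).
Proof.
move=> lN; have x0 : 0 < T - t l by rewrite subr_gt0 (grid_lt_T tg).
rewrite (_ : theta / 2 - 1 = - ((1 - theta) / 2) + - 2^-1); last by field.
rewrite powRD; last by rewrite (gt_eqF x0) implybT.
by rewrite /wstep mulrA; congr (_ * _); rewrite powRN.
Qed.

Lemma sum_wstep_rsT i : (i <= N)%N ->
  \sum_(i <= l < N) wst l * (T - t l) `^ (- 2^-1) <= B (theta / 2) 1 * T `^ (theta / 2).
Proof.
move=> iN; have [->|iN'] := eqVneq i N.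
  by rewrite big_geq// mulr_ge0 ?powR_ge0 ?B0.
have iNN : (i < N <= N)%N by rewrite ltn_neqAle iN' iN leqnn.
have h := hB1 th20 iNN; move: h; rewrite tN => h.
rewrite (eq_big_nat _ _ (F2 := fun l => D l * (T - t l) `^ (theta / 2 - 1))); last first.
  by move=> l /andP[_ lN]; exact: wstep_rsT.
apply: (le_trans h); rewrite ler_wpM2l ?B0//.
rewrite powR_le_T ?(ltW th20)// ?subr_ge0 ?(grid_le_T tg)//.
by rewrite gerBl (grid_ge0 tg).
Qed.

(** Exchanging the sums and applying [wstep_le] reduces the double sum to a convolution of [kap],
    which [hK] bounds by [kap] again. It is used with [kap] constant for [y] and with [kap] the
    singular kernel based at [t i] for [z]. *)
Lemma sum_wstep_sum a (kap phi : nat -> R) K :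
  (forall l, (a <= l < N)%N -> 0 <= kap l) ->
  (forall l, (a <= l < N)%N -> 0 <= phi l) ->
  (forall m, (a <= m < N)%N ->
    \sum_(a <= l < m) kap l * (D l * (t m - t l) `^ (theta / 2 - 1)) <= K * kap m) ->
  \sum_(a <= l < N) kap l * (wst l * \sum_(l.+1 <= m < N) rs m l * phi m)
    <= K * \sum_(a <= m < N) kap m * phi m.
Proof.
move=> kap0 phi0 hK.
under eq_bigr do rewrite mulrA mulr_sumr.
rewrite sum_triangle mulr_sumr big_nat [leRHS]big_nat; apply: ler_sum => m h.
rewrite mulrA; apply: le_trans (ler_wpM2r (phi0 m h) (hK m h)).
rewrite mulr_suml big_nat [leRHS]big_nat; apply: ler_sum => l /andP[al lm].
have lmN : (l < m < N)%N by rewrite lm; case/andP: h.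
have hl : (a <= l < N)%N by rewrite al; case/andP: lmN => _; exact: ltn_trans.
have := wstep_le tg theta01 lmN; rewrite -powRN => q.
by have := ler_wpM2l (mulr_ge0 (kap0 l hl) (phi0 m h)) q; lra.
Qed.

Variables (x : R) (delta phi y z : nat -> R) (i : nat).
Hypotheses (iN : (i <= N)%N) (x0 : 0 <= x).
Hypotheses (delta0 : forall j, (i <= j < N)%N -> 0 <= delta j).
Hypotheses (phi0 : forall j, (i <= j < N)%N -> 0 <= phi j).
Hypotheses (y0 : forall j, (i <= j <= N)%N -> 0 <= y j).
Hypotheses (z0 : forall j, (i <= j < N)%N -> 0 <= z j).
Hypothesis yb : forall j, (i <= j <= N)%N ->
  y j <= x + \sum_(j <= l < N) (phi l * D l + Lf * (wst l * (y l.+1 + z l))).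
Hypothesis zb : forall j, (i <= j < N)%N ->
  z j <= CM * (T - t j) `^ (- 2^-1) * delta j + \sum_(j.+1 <= l < N)
    CM * rs l j * (phi l * D l + Lf * (wst l * (y l.+1 + z l))).

Let u l := y l.+1 + z l.
Let w j := x + CM * ((T - t j) `^ (- 2^-1) * delta j) +
  (CM + Num.sqrt T) * \sum_(j.+1 <= l < N) rs l j * (phi l * D l).

Let CT0 : 0 <= CM + Num.sqrt T. Proof. by rewrite addr_ge0// sqrtr_ge0. Qed.

Let phiD0 l : (i <= l < N)%N -> 0 <= phi l * D l.
Proof.
move=> h; rewrite mulr_ge0 ?phi0// ltW// (step_gt0 tg)//.
by case/andP: h.
Qed.

Let u0 l : (i <= l < N)%N -> 0 <= u l.
Proof. by move=> h; rewrite addr_ge0 ?z0// y0//; lia_idx. Qed.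

Let w0 l : (i <= l < N)%N -> 0 <= w l.
Proof.
move=> h; apply: addr_ge0; first apply: addr_ge0 => //.
  exact: mulr_ge0 CM0 (mulr_ge0 (powR_ge0 _ _) (delta0 h)).
apply: mulr_ge0 => //; rewrite big_nat; apply: sumr_ge0 => m hm.
by apply: mulr_ge0 (powR_ge0 _ _) (phiD0 _); lia_idx.
Qed.

Let uw j : (i <= j < N)%N -> u j <= w j + c * weighted_sum T N t theta 2^-1 u j.
Proof.
move=> h.
have hj : (i <= j.+1 <= N)%N by lia_idx.
have hz := zb h; have hy := yb hj.
rewrite weighted_sumE.
have h12 : 2^-1 - 1 = - 2^-1 :> R by field.
rewrite h12 /w mulr_sumr mulr_sumr -addrA -big_split/=.
rewrite /u; apply: (le_trans (lerD hy hz)).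
rewrite addrACA -big_split/= -mulrA lerD2l big_nat [leRHS]big_nat.
apply: ler_sum => l hl.
have lN : (l < N)%N by case/andP: hl.
have p : 0 <= phi l * D l + Lf * (wst l * (y l.+1 + z l)).
  apply: addr_ge0 (phiD0 _) (mulr_ge0 Lf0 (mulr_ge0 (wstep_ge0 tg theta lN) (u0 _))); lia_idx.
have q : 1 <= Num.sqrt T * rs l j by apply: one_le_sqrtT_rs; lia_idx.
by have := ler_wpM2r p q; lra.
Qed.

Local Notation G g := (4 * expR (damping T Rpi theta c g * T)).

Lemma y_stability : (forall j, (i <= j < N)%N -> delta j <= 2 * x) ->
  y i <= (1 + Lf * G 1 * (CM * B (theta / 2) 1 + B (2^-1 + theta / 2) 1 * Num.sqrt T)
            * T `^ (theta / 2)) * x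
       + (1 + Lf * G 1 * (CM + Num.sqrt T) * B (theta / 2) 1 * T `^ (theta / 2))
         * \sum_(i <= j < N) phi j * D j.
Proof.
move=> dx.
have gr := gronwall_flat T0 tg Rpi0 theta01 c0 iN u0 w0 uw.
set E := expR _ in gr *.
have hy : y i <= x + \sum_(i <= j < N) phi j * D j + Lf * \sum_(i <= l < N) wst l * u l.
  have := yb (_ : (i <= i <= N)%N); rewrite leqnn iN => /(_ isT) /le_trans; apply.
  by rewrite big_split/= -mulr_sumr addrA.
set S := \sum_(i <= j < N) phi j * D j in hy *.
have S1 := sum_wstep iN; have S2 := sum_wstep_rsT iN.
have S3 : \sum_(i <= l < N) 1 * (wst l * \sum_(l.+1 <= m < N) rs m l * (phi m * D m))
    <= B (theta / 2) 1 * T `^ (theta / 2) * \sum_(i <= m < N) 1 * (phi m * D m).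
  apply: sum_wstep_sum => // m h; rewrite mulr1.
  have [->|im'] := eqVneq i m; first by rewrite big_geq// mulr_ge0 ?powR_ge0 ?B0.
  have imN : (i < m <= N)%N by lia_idx.
  have hb := hB1 th20 imN.
  under eq_bigr do rewrite mul1r.
  apply: (le_trans hb); rewrite ler_wpM2l ?B0//.
  rewrite powR_le_T ?(ltW th20)// ?subr_ge0 ?(grid_le tg) ?(grid_subT tg)//; lia_idx.
have {S3} S3 : \sum_(i <= l < N) wst l * \sum_(l.+1 <= m < N) rs m l * (phi m * D m)
    <= B (theta / 2) 1 * T `^ (theta / 2) * S.
  have e (v : nat -> R) : \sum_(i <= l < N) 1 * v l = \sum_(i <= l < N) v l.
    by apply: eq_bigr => l _; rewrite mul1r.
  by move: S3; rewrite !e.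
(* The three parts of [w] are summed separately by [S1], [S2] and [S3], after [delta] has been
   replaced by its bound [2 * x]. *)
have W : \sum_(i <= l < N) wst l * w l <=
    (B (2^-1 + theta / 2) 1 * Num.sqrt T * T `^ (theta / 2)) * x +
    2 * CM * x * (B (theta / 2) 1 * T `^ (theta / 2)) +
    (CM + Num.sqrt T) * (B (theta / 2) 1 * T `^ (theta / 2) * S).
  have cx0 : 0 <= 2 * CM * x := mulr_ge0 (mulr_ge0 (ler0n R 2) CM0) x0.
  apply: le_trans (lerD (lerD (ler_wpM2r x0 S1) (ler_wpM2l cx0 S2)) (ler_wpM2l CT0 S3)).
  rewrite mulr_suml !mulr_sumr -!big_split/= big_nat [leRHS]big_nat.
  apply: ler_sum => l h.
  have lN : (l < N)%N by case/andP: h.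
  have p : 0 <= wst l * CM * (T - t l) `^ (- 2^-1).
    exact: mulr_ge0 (mulr_ge0 (wstep_ge0 tg theta lN) CM0) (powR_ge0 _ _).
  by have := ler_wpM2l p (dx l h); rewrite /w; lra.
have S0 : 0 <= S by rewrite /S big_nat; apply: sumr_ge0 => j; exact: phiD0.
have b1 : 0 <= B (2^-1 + theta / 2) 1 * Num.sqrt T * T `^ (theta / 2) * x.
  exact: mulr_ge0 (mulr_ge0 (mulr_ge0 (B0 th30 ltr01) (sqrtr_ge0 _)) (powR_ge0 _ _)) x0.
have b3 : 0 <= (CM + Num.sqrt T) * (B (theta / 2) 1 * T `^ (theta / 2) * S).
  exact: mulr_ge0 CT0 (mulr_ge0 (mulr_ge0 (B0 th20 ltr01) (powR_ge0 _ _)) S0).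
(* Only the term coming from [delta] carries a factor 2. Doubling the others too puts a common
   factor in front, and [2 * 2 * E] is [G 1]. *)
have W2 : \sum_(i <= l < N) wst l * w l <= 2 * (
    (CM * B (theta / 2) 1 + B (2^-1 + theta / 2) 1 * Num.sqrt T) * T `^ (theta / 2) * x +
    (CM + Num.sqrt T) * B (theta / 2) 1 * T `^ (theta / 2) * S) by lra.
have E2 : 0 <= 2 * E by rewrite mulr_ge0// expR_ge0.
have := ler_wpM2l Lf0 (le_trans gr (ler_wpM2l E2 W2)).
by lra.
Qed.

(** In contrast to [y_stability], the centered error [delta i] is kept, with its weight
    [(T - t i)^(-1/2)]. The uncentered [x] enters only through the [y] part of the driver arguments,
    hence with the milder weight [(T - t i)^(theta/2)]. *)
Lemma z_stability : (i < N)%N -> (forall j, (i <= j < N)%N -> delta j <= 2 * delta i) ->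
  z i <= CM * (1 + Lf * G 2^-1 * CM * B (theta / 2) 2^-1 * T `^ (theta / 2))
           * ((T - t i) `^ (- 2^-1) * delta i)
       + CM * (1 + Lf * G 2^-1 * (CM + Num.sqrt T) * B (theta / 2) 2^-1 * T `^ (theta / 2))
         * \sum_(i.+1 <= j < N) rs j i * (phi j * D j)
       + CM * Lf * G 2^-1 * B (2^-1 + theta / 2) 2^-1 * x * (T - t i) `^ (theta / 2).
Proof.
move=> iN' dx.
have gr : weighted_sum T N t theta 2^-1 u i <=
    2 * expR (damping T Rpi theta c 2^-1 * T) * weighted_sum T N t theta 2^-1 w i.
  apply: (gronwall_left T0 tg Rpi0 tr theta01 c0) => // l h.
  - by apply: u0; lia_idx.
  - by apply: w0; lia_idx.
  - by apply: uw; lia_idx.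
set E := expR _ in gr *.
have h12 : 2^-1 - 1 = - 2^-1 :> R by field.
have hz : z i <= CM * ((T - t i) `^ (- 2^-1) * delta i) +
    CM * (\sum_(i.+1 <= j < N) rs j i * (phi j * D j)) +
    CM * Lf * weighted_sum T N t theta 2^-1 u i.
  have := zb (_ : (i <= i < N)%N); rewrite leqnn iN' => /(_ isT) /le_trans; apply.
  rewrite weighted_sumE h12 !mulr_sumr -addrA -big_split/= mulrA lerD2l.
  by rewrite le_eqVlt; apply/orP; left; apply/eqP; apply: eq_bigr => l _; rewrite /u; ring.
set S := \sum_(i.+1 <= j < N) rs j i * (phi j * D j) in hz *.
have iNN : (i < N <= N)%N by rewrite iN' leqnn.
have X0 : 0 < T - t i by rewrite subr_gt0 (grid_lt_T tg).
(* Exponents [1/2 + theta/2] at [T] and [1/2] at [t i] add up, minus 1, to [theta/2]: the power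
   multiplying [x] in the conclusion. *)
have S1 : \sum_(i.+1 <= l < N) rs l i * wst l <=
    B (2^-1 + theta / 2) 2^-1 * (T - t i) `^ (theta / 2).
  have h := hB2 th30 half0 iNN; move: h; rewrite tN.
  rewrite (_ : 2^-1 + theta / 2 + 2^-1 - 1 = theta / 2); last by field.
  move=> h; apply: le_trans h.
  rewrite le_eqVlt; apply/orP; left; apply/eqP; apply: eq_bigr => l _.
  by rewrite h12 -divr_powRB /wstep; congr (_ * (_ / _ `^ _)); field.
(* Now the exponent is [theta/2 - 1/2]. Bounding [(T - t i)^(theta/2)] by its value at [T] keeps
   exactly the singular weight of [delta i]. *)
have S2 : \sum_(i.+1 <= l < N) rs l i * (wst l * (T - t l) `^ (- 2^-1)) <=
    B (theta / 2) 2^-1 * T `^ (theta / 2) * (T - t i) `^ (- 2^-1).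
  have h := hB2 th20 half0 iNN; move: h; rewrite tN.
  rewrite (_ : theta / 2 + 2^-1 - 1 = theta / 2 - 2^-1); last by field.
  have -> : (T - t i) `^ (theta / 2 - 2^-1) =
      (T - t i) `^ (theta / 2) * (T - t i) `^ (- 2^-1).
    by rewrite -powRD// (gt_eqF X0) implybT.
  move=> h.
  apply: (@le_trans _ _ (B (theta / 2) 2^-1 * ((T - t i) `^ (theta / 2) * (T - t i) `^ (- 2^-1)))).
    apply: le_trans h.
    rewrite le_eqVlt; apply/orP; left; apply/eqP; apply: eq_big_nat => l /andP[_ lN].
    by rewrite wstep_rsT// h12.
  rewrite -mulrA ler_wpM2l ?B0// ler_wpM2r ?powR_ge0//.
  rewrite powR_le_T ?(ltW th20) ?(ltW X0)//.
  by rewrite gerBl (grid_ge0 tg).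
have S3 : \sum_(i.+1 <= l < N) rs l i * (wst l * \sum_(l.+1 <= m < N) rs m l * (phi m * D m))
    <= B (theta / 2) 2^-1 * T `^ (theta / 2) * S.
  apply: sum_wstep_sum => [l _|l h|m h].
  - exact: powR_ge0.
  - by apply: phiD0; lia_idx.
  have imN : (i < m <= N)%N by lia_idx.
  have hb := hB2 th20 half0 imN.
  have Z0 : 0 < t m - t i by rewrite subr_gt0 (grid_lt tg)//.
  move: hb; rewrite (_ : theta / 2 + 2^-1 - 1 = theta / 2 - 2^-1); last by field.
  have -> : (t m - t i) `^ (theta / 2 - 2^-1) = (t m - t i) `^ (theta / 2) * rs m i.
    by rewrite -powRD// (gt_eqF Z0) implybT.
  move=> h'.
  apply: (@le_trans _ _ (B (theta / 2) 2^-1 * ((t m - t i) `^ (theta / 2) * rs m i))).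
    apply: le_trans h'.
    rewrite le_eqVlt; apply/orP; left; apply/eqP; apply: eq_bigr => l _.
    by rewrite h12.
  rewrite -mulrA ler_wpM2l ?B0// ler_wpM2r ?powR_ge0//.
  by rewrite powR_le_T ?(ltW th20) ?(ltW Z0)// (grid_subT tg)//; lia_idx.
have di0 : 0 <= delta i by apply: delta0; rewrite leqnn.
have W : weighted_sum T N t theta 2^-1 w i <=
    (B (2^-1 + theta / 2) 2^-1 * (T - t i) `^ (theta / 2)) * x +
    2 * CM * delta i * (B (theta / 2) 2^-1 * T `^ (theta / 2) * (T - t i) `^ (- 2^-1)) +
    (CM + Num.sqrt T) * (B (theta / 2) 2^-1 * T `^ (theta / 2) * S).
  have cx0 : 0 <= 2 * CM * delta i := mulr_ge0 (mulr_ge0 (ler0n R 2) CM0) di0.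
  apply: le_trans (lerD (lerD (ler_wpM2r x0 S1) (ler_wpM2l cx0 S2)) (ler_wpM2l CT0 S3)).
  rewrite weighted_sumE h12 mulr_suml !mulr_sumr -!big_split/= big_nat [leRHS]big_nat.
  apply: ler_sum => l h.
  have lN : (l < N)%N by case/andP: h.
  have p : 0 <= rs l i * (wst l * CM * (T - t l) `^ (- 2^-1)).
    exact: mulr_ge0 (powR_ge0 _ _)
      (mulr_ge0 (mulr_ge0 (wstep_ge0 tg theta lN) CM0) (powR_ge0 _ _)).
  have hl : (i <= l < N)%N by lia_idx.
  by have := ler_wpM2l p (dx l hl); rewrite /w; lra.
have S0 : 0 <= S.
  rewrite /S big_nat; apply: sumr_ge0 => j h; apply: mulr_ge0 (powR_ge0 _ _) (phiD0 _); lia_idx.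
have b1 : 0 <= B (2^-1 + theta / 2) 2^-1 * (T - t i) `^ (theta / 2) * x.
  exact: mulr_ge0 (mulr_ge0 (B0 th30 half0) (powR_ge0 _ _)) x0.
have b3 : 0 <= (CM + Num.sqrt T) * (B (theta / 2) 2^-1 * T `^ (theta / 2) * S).
  exact: mulr_ge0 CT0 (mulr_ge0 (mulr_ge0 (B0 th20 half0) (powR_ge0 _ _)) S0).
have W2 : weighted_sum T N t theta 2^-1 w i <= 2 * (
    B (2^-1 + theta / 2) 2^-1 * (T - t i) `^ (theta / 2) * x +
    CM * delta i * (B (theta / 2) 2^-1 * T `^ (theta / 2) * (T - t i) `^ (- 2^-1)) +
    (CM + Num.sqrt T) * (B (theta / 2) 2^-1 * T `^ (theta / 2) * S)) by lra.
have E2 : 0 <= 2 * E by rewrite mulr_ge0// expR_ge0.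
have CL0 : 0 <= CM * Lf by rewrite mulr_ge0.
have := ler_wpM2l CL0 (le_trans gr (ler_wpM2l E2 W2)).
by lra.
Qed.

End stability.

(** * Passage from extended-real norms to the real recursion *)

Section pathwise.
Context {R : realType}.
Variables (T Rpi : R) (N : nat) (t : nat -> R).
Hypotheses (T0 : 0 < T) (tg : time_grid T N t).
Hypotheses (Rpi0 : 0 < Rpi) (tr : step_ratio_le N t Rpi).
Variables (theta Lf CM : R).
Hypotheses (theta01 : 0 < theta <= 1) (Lf0 : 0 <= Lf) (CM0 : 0 <= CM).
Local Notation D := (step t).
Local Notation B := (kernel_cst Rpi).
Local Notation c := (Lf * (CM + Num.sqrt T)).
Local Notation L l := (Lf / (T - t l) `^ ((1 - theta) / 2)).
Local Notation rs l j := ((t l - t j) `^ (- 2^-1)).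
Local Notation G g := (4 * expR (damping T Rpi theta c g * T)).

Variables (x : \bar R) (phi Y Z : nat -> \bar R) (delta : nat -> \bar R) (i : nat).
Hypotheses (x0 : (0 <= x)%E) (xfin : x \is a fin_num).
Hypotheses (phi0 : forall l, (0 <= phi l)%E) (delta0 : forall l, (0 <= delta l)%E).
Hypotheses (Y0 : forall l, (0 <= Y l)%E) (Z0 : forall l, (0 <= Z l)%E).
Hypothesis dx : forall l, (i <= l < N)%N -> (delta l <= 2%:E * x)%E.
Hypothesis Yb : forall j, (i <= j <= N)%N ->
  (Y j <= x + \sum_(j <= l < N) (phi l + (L l)%:E * (Y l.+1 + Z l)) * (D l)%:E)%E.
Hypothesis Zb : forall j, (i <= j < N)%N ->
  (Z j <= (CM * (T - t j) `^ (- 2^-1))%:E * delta j + \sum_(j.+1 <= l < N)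
    (CM * rs l j)%:E * ((phi l + (L l)%:E * (Y l.+1 + Z l)) * (D l)%:E))%E.

Let D0 l : (l < N)%N -> 0 < D l. Proof. exact: (step_gt0 tg). Qed.

Let delta_fin l : (i <= l < N)%N -> delta l \is a fin_num.
Proof.
move=> h; rewrite ge0_fin_numE//; apply: le_lt_trans (dx h) _.
by rewrite ltey_eq fin_numM.
Qed.

Let term_fin l : phi l \is a fin_num -> Y l.+1 \is a fin_num -> Z l \is a fin_num ->
  ((phi l + (L l)%:E * (Y l.+1 + Z l)) * (D l)%:E)%E \is a fin_num.
Proof. by move=> h1 h2 h3; rewrite fin_numM// fin_numD h1/= fin_numM// fin_numD h2. Qed.

Let sum_fin (s : nat -> \bar R) a : (forall l, (a <= l < N)%N -> s l \is a fin_num) ->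
  (\sum_(a <= l < N) s l)%E \is a fin_num.
Proof.
move=> h; apply/sum_fin_numP => l; rewrite mem_index_iota => hl _; exact: h.
Qed.

Let finite_Z j : (i <= j < N)%N ->
  (forall l, (j < l < N)%N -> phi l \is a fin_num) ->
  (forall l, (j < l < N)%N -> Y l.+1 \is a fin_num /\ Z l \is a fin_num) ->
  Z j \is a fin_num.
Proof.
move=> h hphi hYZ; rewrite ge0_fin_numE//; apply: le_lt_trans (Zb h) _.
rewrite ltey_eq fin_numD fin_numM ?delta_fin//= sum_fin// => l hl.
by have [h1 h2] := hYZ l hl; rewrite fin_numM// term_fin// hphi.
Qed.

(** Backward induction in time. The sum bounding [Y j] contains [Z j] through its first term, so
    [Z j] is shown finite first. A starting index [a] above [i] leaves [phi i] free to be
    infinite. *)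
Let finite_YZ a : (i <= a)%N -> (forall l, (a <= l < N)%N -> phi l \is a fin_num) ->
  forall n j, (N - j <= n)%N -> (a <= j <= N)%N ->
    Y j \is a fin_num /\ ((j < N)%N -> Z j \is a fin_num).
Proof.
move=> ia hphi; elim => [|n ih] j jn /andP[aj jN].
  have jE : j = N by lia_idx.
  split; last by move=> jN'; exfalso; move: jN'; rewrite jE ltnn.
  have ij : (i <= j <= N)%N by lia_idx.
  rewrite ge0_fin_numE//; apply: le_lt_trans (Yb ij) _.
  by rewrite jE big_geq// adde0 ltey_eq xfin.
have hYZ l : (j < l < N)%N -> Y l.+1 \is a fin_num /\ Z l \is a fin_num.
  move=> hl.
  have h1 : (N - l <= n)%N by lia_idx.
  have h2 : (a <= l <= N)%N by lia_idx.
  have h3 : (N - l.+1 <= n)%N by lia_idx.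
  have h4 : (a <= l.+1 <= N)%N by lia_idx.
  split; first by case: (ih l.+1 h3 h4).
  by case: (ih l h1 h2) => _; apply; case/andP: hl.
have hZ : (j < N)%N -> Z j \is a fin_num.
  move=> jN'; apply: finite_Z => //; first by lia_idx.
  by move=> l hl; apply: hphi; lia_idx.
split => //.
have ij : (i <= j <= N)%N by lia_idx.
rewrite ge0_fin_numE//; apply: le_lt_trans (Yb ij) _.
rewrite ltey_eq fin_numD xfin sum_fin// => l hl.
have hl2 : (a <= l < N)%N by lia_idx.
apply: term_fin; first exact: hphi.
- have h3 : (N - l.+1 <= n)%N by lia_idx.
  have h4 : (a <= l.+1 <= N)%N by lia_idx.
  by case: (ih l.+1 h3 h4).
- have [jl|jl] := eqVneq j l; first by rewrite -jl; apply: hZ; lia_idx.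
  by apply: (hYZ l _).2; lia_idx.
Qed.

Let term_real l : phi l \is a fin_num -> Y l.+1 \is a fin_num -> Z l \is a fin_num ->
  ((phi l + (L l)%:E * (Y l.+1 + Z l)) * (D l)%:E)%E =
  (fine (phi l) * D l + Lf * (wstep T t theta l * (fine (Y l.+1) + fine (Z l))))%:E.
Proof.
move=> h1 h2 h3; rewrite -{1}(fineK h1) -{1}(fineK h2) -{1}(fineK h3).
rewrite -[LHS]/(((fine (phi l) + L l * (fine (Y l.+1) + fine (Z l))) * D l)%:E).
by rewrite /wstep; congr EFin; ring.
Qed.

Lemma Y_path : (i <= N)%N ->
  (Y i <= (1 + Lf * G 1 * (CM * B (theta / 2) 1 + B (2^-1 + theta / 2) 1 * Num.sqrt T)
            * T `^ (theta / 2))%:E * x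
       + (1 + Lf * G 1 * (CM + Num.sqrt T) * B (theta / 2) 1 * T `^ (theta / 2))%:E
         * \sum_(i <= j < N) phi j * (D j)%:E)%E.
Proof.
move=> iN; case/andP: (theta01) => th0 th1.
have th20 : 0 < theta / 2 by rewrite divr_gt0.
have th30 : 0 < 2^-1 + theta / 2 by rewrite addr_gt0// invr_gt0.
have B1 := kernel_cst_ge0 Rpi0 th20 ltr01.
have B2 := kernel_cst_ge0 Rpi0 th30 ltr01.
set C1 := 1 + _; set C2 := 1 + _.
have G0 : 0 <= Lf * G 1 by rewrite !mulr_ge0// expR_ge0.
have C10 : 0 <= C1.
  apply: addr_ge0 => //; apply: mulr_ge0 (powR_ge0 _ _); apply: mulr_ge0 => //.
  exact: addr_ge0 (mulr_ge0 CM0 B1) (mulr_ge0 B2 (sqrtr_ge0 _)).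
have C20 : 0 < C2.
  apply: ltr_pwDl => //; apply: mulr_ge0 (powR_ge0 _ _).
  exact: mulr_ge0 (mulr_ge0 G0 (addr_ge0 CM0 (sqrtr_ge0 _))) B1.
(* If some [phi l] in the sum is [+oo], the right-hand side is [+oo] because [C2] is positive and
   steps are positive. *)
have [/forallP hfin|] := boolP [forall l : 'I_N, (i <= l)%N ==> (phi l \is a fin_num)]; last first.
  rewrite negb_forall => /existsP[l]; rewrite negb_imply => /andP[il].
  rewrite ge0_fin_numE// -leNgt leye_eq => /eqP pl.
  have -> : (\sum_(i <= j < N) phi j * (D j)%:E = +oo)%E.
    rewrite (bigD1_seq (l : nat)) ?mem_index_iota ?iota_uniq ?il ?ltn_ord//=.
    rewrite pl gt0_mulye ?lte_fin ?D0// addye//.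
    rewrite -ltNye; apply: (@lt_le_trans _ _ 0%E); first exact: ltNy0.
    rewrite big_nat_cond; apply: sume_ge0 => j /andP[/andP[_ jN] _].
    by rewrite mule_ge0// lee_fin ltW// D0.
  rewrite gt0_muley ?lte_fin// addey ?leey//.
  by rewrite -ltNye (@lt_le_trans _ _ 0%E) ?ltNy0// mule_ge0.
have {}hfin l : (i <= l < N)%N -> phi l \is a fin_num.
  by move=> /andP[il lN]; have := hfin (Ordinal lN); rewrite /= il.
have hY j : (i <= j <= N)%N -> Y j \is a fin_num.
  by move=> h; case: (finite_YZ (leqnn i) hfin (leqnn _) h).
have hZ j : (i <= j < N)%N -> Z j \is a fin_num.
  move=> h; have h' : (i <= j <= N)%N by lia_idx.
  by case: (finite_YZ (leqnn i) hfin (leqnn _) h') => _; apply; case/andP: h.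
have hiN : (i <= i <= N)%N by rewrite leqnn.
have hterm l : (i <= l < N)%N -> ((phi l + (L l)%:E * (Y l.+1 + Z l)) * (D l)%:E)%E =
  (fine (phi l) * D l + Lf * (wstep T t theta l * (fine (Y l.+1) + fine (Z l))))%:E.
  move=> h; apply: term_real; [exact: hfin| |exact: hZ].
  by apply: hY; lia_idx.
have := @y_stability R T Rpi N t T0 tg Rpi0 theta Lf CM theta01 Lf0 CM0
  (fine x) (fun l => fine (delta l)) (fun l => fine (phi l)) (fun l => fine (Y l))
  (fun l => fine (Z l)) i iN (fine_ge0 x0) (fun l _ => fine_ge0 (delta0 l))
  (fun l _ => fine_ge0 (phi0 l)) (fun l _ => fine_ge0 (Y0 l)) (fun l _ => fine_ge0 (Z0 l)).
rewrite -/C1 -/C2 => hs.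
rewrite -(fineK (hY i hiN)) -(fineK xfin).
rewrite (eq_big_nat _ _ (F2 := fun j => (fine (phi j) * D j)%:E)); last first.
  by move=> l h; rewrite -{1}(fineK (hfin l h)) EFinM.
rewrite sumEFin -!EFinM -EFinD lee_fin; apply: hs.
- move=> j h; rewrite -lee_fin fineK ?hY//; apply: (le_trans (Yb h)).
  rewrite -{1}(fineK xfin) (eq_big_nat _ _ (F2 := fun l => (fine (phi l) * D l +
    Lf * (wstep T t theta l * (fine (Y l.+1) + fine (Z l))))%:E)); last first.
    by move=> l hl; apply: hterm; lia_idx.
  by rewrite sumEFin.
- move=> j h; rewrite -lee_fin fineK ?hZ//; apply: (le_trans (Zb h)).
  rewrite -{1}(fineK (delta_fin h)) (eq_big_nat _ _ (F2 := fun l => (CM * rs l j *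
    (fine (phi l) * D l + Lf * (wstep T t theta l * (fine (Y l.+1) + fine (Z l)))))%:E)); last first.
    by move=> l hl; rewrite hterm ?EFinM//; lia_idx.
  by rewrite sumEFin -EFinM -EFinD.
- move=> j h; rewrite -lee_fin EFinM !fineK ?delta_fin//.
  exact: dx.
Qed.

Lemma Z_path : (i < N)%N ->
  (forall l, (i <= l < N)%N -> (delta l <= 2%:E * delta i)%E) ->
  (Z i <= (CM * (1 + Lf * G 2^-1 * CM * B (theta / 2) 2^-1 * T `^ (theta / 2)))%:E
           * (delta i * ((Num.sqrt (T - t i))^-1)%:E)
       + (CM * (1 + Lf * G 2^-1 * (CM + Num.sqrt T) * B (theta / 2) 2^-1 * T `^ (theta / 2)))%:E
         * \sum_(i.+1 <= j < N) phi j * ((Num.sqrt (t j - t i))^-1)%:E * (D j)%:E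
       + (CM * Lf * G 2^-1 * B (2^-1 + theta / 2) 2^-1)%:E * x * ((T - t i) `^ (theta / 2))%:E)%E.
Proof.
move=> iN dd; case/andP: (theta01) => th0 th1.
have half0 : 0 < 2^-1 :> R by rewrite invr_gt0.
have th20 : 0 < theta / 2 by rewrite divr_gt0.
have th30 : 0 < 2^-1 + theta / 2 by rewrite addr_gt0.
have B1 := kernel_cst_ge0 Rpi0 th20 half0.
have B2 := kernel_cst_ge0 Rpi0 th30 half0.
have iNN : (i <= i < N)%N by rewrite leqnn.
have rsE (u : R) : 0 <= u -> (Num.sqrt u)^-1 = u `^ (- 2^-1).
  by move=> u0; rewrite -powR12_sqrt// powRN.
have X0 : 0 <= T - t i by rewrite subr_ge0 (grid_le_T tg)// ltnW.
rewrite (rsE _ X0).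
rewrite (eq_big_nat _ _ (F2 := fun j => (phi j * (rs j i)%:E * (D j)%:E)%E)); last first.
  move=> j /andP[ij jN]; rewrite rsE// subr_ge0 (grid_le tg)//.
  by rewrite (ltnW ij) (ltnW jN).
set C1 := CM * (1 + _); set C2 := CM * (1 + _); set C3 := CM * Lf * _ * _.
have G0 : 0 <= Lf * G 2^-1 by rewrite !mulr_ge0// expR_ge0.
have C10 : 0 <= C1.
  apply: mulr_ge0 => //; apply: addr_ge0 => //; apply: mulr_ge0 (powR_ge0 _ _).
  exact: mulr_ge0 (mulr_ge0 G0 CM0) B1.
have q0 : 0 < 1 + Lf * G 2^-1 * (CM + Num.sqrt T) * B (theta / 2) 2^-1 * T `^ (theta / 2).
  apply: ltr_pwDl => //; apply: mulr_ge0 (powR_ge0 _ _).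
  exact: mulr_ge0 (mulr_ge0 G0 (addr_ge0 CM0 (sqrtr_ge0 _))) B1.
have C20 : 0 <= C2 by rewrite mulr_ge0// ltW.
have C30 : 0 <= C3 by rewrite mulr_ge0// mulr_ge0 ?mulr_ge0// expR_ge0.
have t10 : (0 <= C1%:E * (delta i * ((T - t i) `^ (- 2^-1))%:E))%E.
  by rewrite !mule_ge0// ?lee_fin// powR_ge0.
have t30 : (0 <= C3%:E * x * ((T - t i) `^ (theta / 2))%:E)%E.
  by rewrite !mule_ge0// ?lee_fin// powR_ge0.
have s0 : (0 <= \sum_(i.+1 <= j < N) phi j * (rs j i)%:E * (D j)%:E)%E.
  rewrite big_nat_cond; apply: sume_ge0 => j /andP[/andP[_ jN] _].
  by rewrite !mule_ge0// lee_fin ?powR_ge0// ltW// D0.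
(* When [CM = 0] the constant [C2] vanishes and an infinite [phi] no longer makes the right-hand
   side infinite; but then [Zb] gives [Z i <= 0]. *)
have [CMz|CMn0] := eqVneq CM 0.
  apply: (@le_trans _ _ 0%E); last by rewrite !adde_ge0// mule_ge0.
  apply: (le_trans (Zb iNN)); rewrite CMz mul0r mul0e add0e big1// => l _.
  by rewrite mul0r mul0e.
have CMp : 0 < CM by rewrite lt_neqAle eq_sym CMn0.
have [/forallP hfin|] := boolP [forall l : 'I_N, (i < l)%N ==> (phi l \is a fin_num)]; last first.
  rewrite negb_forall => /existsP[l]; rewrite negb_imply => /andP[il].
  rewrite ge0_fin_numE// -leNgt leye_eq => /eqP pl.
  have -> : (\sum_(i.+1 <= j < N) phi j * (rs j i)%:E * (D j)%:E = +oo)%E.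
    rewrite (bigD1_seq (l : nat)) ?mem_index_iota ?iota_uniq ?il ?ltn_ord//=.
    rewrite pl gt0_mulye ?lte_fin; last first.
      by rewrite powR_gt0// subr_gt0 (grid_lt tg)// il ltnW.
    rewrite gt0_mulye ?lte_fin ?D0// addye//.
    rewrite -ltNye; apply: (@lt_le_trans _ _ 0%E); first exact: ltNy0.
    rewrite big_nat_cond; apply: sume_ge0 => j /andP[/andP[_ jN] _].
    by rewrite !mule_ge0// lee_fin ?powR_ge0// ltW// D0.
  rewrite gt0_muley; last by rewrite lte_fin mulr_gt0.
  have ny (z : \bar R) : (0 <= z)%E -> z != -oo%E by case: z.
  by rewrite addey ?ny// addye ?ny// leey.
have {}hfin l : (i.+1 <= l < N)%N -> phi l \is a fin_num.
  by move=> /andP[il lN]; have := hfin (Ordinal lN); rewrite /= il.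
have hY j : (i.+1 <= j <= N)%N -> Y j \is a fin_num.
  by move=> h; case: (finite_YZ (leqnSn i) hfin (leqnn _) h).
have hZ' j : (i.+1 <= j < N)%N -> Z j \is a fin_num.
  move=> h; have h' : (i.+1 <= j <= N)%N by lia_idx.
  by case: (finite_YZ (leqnSn i) hfin (leqnn _) h') => _; apply; case/andP: h.
have hZi : Z i \is a fin_num.
  apply: finite_Z => // l h; split; last exact: hZ'.
  by apply: hY; lia_idx.
have hZ j : (i <= j < N)%N -> Z j \is a fin_num.
  by move=> h; have [<-//|ij] := eqVneq i j; apply: hZ'; lia_idx.
have hterm l : (i.+1 <= l < N)%N -> ((phi l + (L l)%:E * (Y l.+1 + Z l)) * (D l)%:E)%E =
  (fine (phi l) * D l + Lf * (wstep T t theta l * (fine (Y l.+1) + fine (Z l))))%:E.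
  move=> h; apply: term_real; [exact: hfin| |exact: hZ'].
  by apply: hY; lia_idx.
(* [phi i] and [Y i], possibly infinite, do not enter the bound on [Z i]. *)
pose y l := if l == i then 0 else fine (Y l).
have y0 l : 0 <= y l by rewrite /y; case: ifPn => // _; exact: fine_ge0.
have yE l : (i < l)%N -> y l = fine (Y l).
  by move=> h; rewrite /y; have [e|//] := eqVneq l i; move: h; rewrite e ltnn.
have := @z_stability R T Rpi N t T0 tg Rpi0 tr theta Lf CM theta01 Lf0 CM0
  (fine x) (fun l => fine (delta l)) (fun l => fine (phi l)) y
  (fun l => fine (Z l)) i (ltnW iN) (fine_ge0 x0) (fun l _ => fine_ge0 (delta0 l))
  (fun l _ => fine_ge0 (phi0 l)) (fun l _ => y0 l) (fun l _ => fine_ge0 (Z0 l)).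
rewrite -/C1 -/C2 -/C3 => hs.
rewrite -(fineK hZi) -(fineK xfin) -(fineK (delta_fin iNN)).
rewrite (eq_big_nat _ _ (F2 := fun j => (rs j i * (fine (phi j) * D j))%:E)); last first.
  move=> l h; rewrite -{1}(fineK (hfin l h)) -!EFinM; congr EFin; ring.
rewrite sumEFin -!EFinM -!EFinD lee_fin.
rewrite [fine (delta i) * _]mulrC; apply: hs => //.
- move=> j h; have [ji|ji] := eqVneq j i.
    rewrite ji {1}/y eqxx addr_ge0 ?fine_ge0// big_nat; apply: sumr_ge0 => l /andP[_ lN].
    apply: addr_ge0; first by rewrite mulr_ge0 ?fine_ge0// ltW// D0.
    exact: mulr_ge0 Lf0 (mulr_ge0 (wstep_ge0 tg theta lN) (addr_ge0 (y0 _) (fine_ge0 (Z0 l)))).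
  have h1 : (i.+1 <= j <= N)%N by lia_idx.
  rewrite yE ?(andP h1).1// -lee_fin fineK ?hY//; apply: (le_trans (Yb h)).
  rewrite -{1}(fineK xfin) (eq_big_nat _ _ (F2 := fun l => (fine (phi l) * D l +
    Lf * (wstep T t theta l * (y l.+1 + fine (Z l))))%:E)); last first.
    move=> l hl; rewrite hterm ?yE//; lia_idx.
  by rewrite sumEFin.
- move=> j h; rewrite -lee_fin fineK ?hZ//; apply: (le_trans (Zb h)).
  rewrite -{1}(fineK (delta_fin h)) (eq_big_nat _ _ (F2 := fun l => (CM * rs l j *
    (fine (phi l) * D l + Lf * (wstep T t theta l * (y l.+1 + fine (Z l)))))%:E)); last first.
    move=> l hl; rewrite hterm ?yE ?EFinM//; lia_idx.
  by rewrite sumEFin -EFinM -EFinD.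
- by move=> j h; rewrite -lee_fin EFinM !fineK ?delta_fin// dd.
Qed.

End pathwise.

(** * Recursive inequalities for the norms of the solution differences *)

Section recursion.
Context {R : realType} {d : measure_display} {Omega : measurableType d}.
Variables (P : probability Omega R) (F : R -> set_system Omega) (q : nat).
Variables (T theta Lf CM : R) (N : nat) (t : nat -> R).
Variable H : nat -> nat -> Omega -> 'rV[R]_q.
Variables (xi1 xi2 : Omega -> R) (f1 f2 : nat -> Omega -> R -> 'rV[R]_q -> R).
Variables (Y1 Y2 : nat -> Omega -> R) (Z1 Z2 : nat -> Omega -> 'rV[R]_q).
Hypotheses (Lf0 : 0 <= Lf) (CM0 : 0 <= CM) (tg : time_grid T N t).
Hypothesis fF : augmented_filtration P T F.
Hypothesis HL2 : forall i j, (i < j <= N)%N -> forall l : 'I_q,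
  L2 P (F T) (fun w => H i j w 0 l).
Hypothesis Hc : forall i j, (i < j <= N)%N -> forall l : 'I_q,
  {ae P, forall w, condE P (F (t i)) (fun w' => (H i j w' 0 l)%:E) w = 0%E}.
Hypothesis HM : forall i j, (i < j <= N)%N ->
  {ae P, forall w, (cond_norm2 P (F (t i)) (fun w' => enorm (H i j w')) w
    <= (CM * (t j - t i) `^ (- 2^-1))%:E)%E}.
Hypotheses (xi1L : L2 P (F T) xi1) (xi2L : L2 P (F T) xi2).
Hypothesis jm1 : forall i, (i < N)%N -> jointly_measurable (f1 i).
Hypothesis jm2 : forall i, (i < N)%N -> jointly_measurable (f2 i).
Hypothesis S1 : solves_MWDP P F N t H xi1 f1 Y1 Z1.
Hypothesis S2 : solves_MWDP P F N t H xi2 f2 Y2 Z2.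
Hypothesis f2Lip : forall i, (i < N)%N ->
  {ae P, forall w, forall (y y' : R) (z z' : 'rV[R]_q),
    `|f2 i w y z - f2 i w y' z'|
      <= Lf / (T - t i) `^ ((1 - theta) / 2) * (`|y - y'| + enorm (z - z'))}.

Local Notation D := (step t).
Local Notation L l := (Lf / (T - t l) `^ ((1 - theta) / 2)).
Local Notation dY := (fun i w => Y1 i w - Y2 i w).
Local Notation dZ := (fun i w => Z1 i w - Z2 i w).
Local Notation dxi := (fun w => xi1 w - xi2 w).
Local Notation df := (fun i w => f1 i w (Y1 i.+1 w) (Z1 i w) - f2 i w (Y1 i.+1 w) (Z1 i w)).
Local Notation Edxi := (fun i w => fine (condE P (F (t i)) (fun w' => (dxi w')%:E) w)).
Local Notation nrm k U := (cond_norm2 P (F (t k)) U).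

Let sF i : (i <= N)%N -> sigma_algebra setT (F (t i)).
Proof.
move=> iN; case: fF => h _ _; apply: (h (t i) _).1.
by rewrite (grid_ge0 tg)// (grid_le_T tg).
Qed.

Let FM i : (i <= N)%N -> F (t i) `<=` measurable.
Proof.
move=> iN; case: fF => h _ _; apply: (h (t i) _).2.
by rewrite (grid_ge0 tg)// (grid_le_T tg).
Qed.

Let Fmono i j : (i <= j <= N)%N -> F (t i) `<=` F (t j).
Proof.
move=> /andP[ij jN]; case: fF => _ h _; apply: h.
- by rewrite (grid_ge0 tg)// (leq_trans ij).
- by rewrite (grid_le tg)// ij.
- exact: (grid_le_T tg).
Qed.

Let dxiL : dxi \in Lfun P 2%:E.
Proof.
case: xi1L => _ h1; case: xi2L => _ h2.
have le12 : (1 <= 2%:E :> \bar R)%E by rewrite lee_fin ler1n.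
exact: (rpredB h1 h2).
Qed.

Let PT : P setT \is a fin_num. Proof. exact: fin_num_measure. Qed.

Let dxiI : P.-integrable setT (EFin \o dxi).
Proof. by apply/Lfun1_integrable; exact: Lfun_subset12 dxiL. Qed.

Let mdxi : measurable_fun setT dxi.
Proof. by apply/measurable_EFinP; exact: measurable_int dxiI. Qed.

Let mcond i (X V : Omega -> R) : (i <= N)%N -> real_condE P (F (t i)) X V ->
  measurable_fun setT V.
Proof.
by move=> iN [_ [GV _]]; apply/measurable_EFinP; have := measurable_wrt_fun (FM iN) GV.
Qed.

Let mY1 i : (i <= N)%N -> measurable_fun setT (Y1 i).
Proof. by move=> iN; exact: mcond (S1.1 i iN). Qed.

Let mY2 i : (i <= N)%N -> measurable_fun setT (Y2 i).
Proof. by move=> iN; exact: mcond (S2.1 i iN). Qed.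

Let mZ1 i l : (i < N)%N -> measurable_fun setT (fun w => Z1 i w 0 l).
Proof. by move=> iN; exact: mcond (ltnW iN) (S1.2 i iN l). Qed.

Let mZ2 i l : (i < N)%N -> measurable_fun setT (fun w => Z2 i w 0 l).
Proof. by move=> iN; exact: mcond (ltnW iN) (S2.2 i iN l). Qed.

Lemma measurable_driver (f : Omega -> R -> 'rV[R]_q -> R) (Y : Omega -> R)
    (Z : Omega -> 'rV[R]_q) : jointly_measurable f -> measurable_fun setT Y ->
  (forall l, measurable_fun setT (fun w => Z w 0 l)) ->
  measurable_fun setT (fun w => f w (Y w) (Z w)).
Proof.
move=> mf mY mZ.
pose h w : Omega * R * q.-tuple R := (w, Y w, [tuple Z w 0 l | l < q]).
have mh : measurable_fun setT h.
  apply: measurable_fun_pair; first exact: measurable_fun_pair.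
  apply/measurable_fun_tnthP => l; apply: eq_measurable_fun (mZ l) => w _ /=.
  by rewrite tnth_mktuple.
have := measurableT_comp mf mh; apply: eq_measurable_fun => w _ /=.
by congr (f _ _ _); apply/rowP => l; rewrite mxE tnth_mktuple.
Qed.

(** Set to 0 from index [N] on, so that measurability holds at every index, as [enrm_sum] and
    [enrm_weighted_le] ask. *)
Let g l w : R := if (l < N)%N then
  f1 l w (Y1 l.+1 w) (Z1 l w) - f2 l w (Y2 l.+1 w) (Z2 l w) else 0.

Let mdf l : (l < N)%N -> measurable_fun setT (df l).
Proof.
move=> lN; apply: measurable_funB; apply: measurable_driver;
  do ?[exact: jm1|exact: jm2|exact: mY1|by move=> ?; exact: mZ1].
Qed.

Let mg l : measurable_fun setT (g l).
Proof.
rewrite /g; have [lN|lN] := boolP (l < N)%N; last exact: measurable_cst.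
apply: measurable_funB; apply: measurable_driver;
  do ?[exact: jm1|exact: jm2|exact: mY1|exact: mY2|by move=> ?; exact: mZ1|by move=> ?; exact: mZ2].
Qed.

Let mdZ l : (l < N)%N -> measurable_fun setT (fun w => enorm (dZ l w)).
Proof.
move=> lN; apply: measurable_enorm => m.
have -> : (fun w => (dZ l w) 0 m) = (fun w => Z1 l w 0 m - Z2 l w 0 m).
  by apply/funext => w; rewrite !mxE.
by apply: measurable_funB; [exact: mZ1|exact: mZ2].
Qed.

Let nabs k (U : Omega -> R) w : nrm k U w = enrm P (F (t k)) (fun w => `|U w|%:E) w.
Proof. by rewrite cond_norm2E enrm_abs. Qed.

Let mabs (U : Omega -> R) : measurable_fun setT U ->
  measurable_fun setT (fun w => `|U w|%:E).
Proof. by move=> mU; apply/measurable_EFinP; exact: measurableT_comp. Qed.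

Let L0 l : (l < N)%N -> 0 <= L l.
Proof. by move=> lN; rewrite divr_ge0// powR_ge0. Qed.

(** The value of [f2] along the first solution is inserted: the Lipschitz condition bears on [f2],
    and the remaining difference is the driver gap at the first solution. *)
Lemma driver_gap k l : (k <= N)%N -> (l < N)%N ->
  {ae P, forall w, (enrm P (F (t k)) (fun w => `|g l w|%:E) w <=
    nrm k (df l) w + (L l)%:E * (nrm k (dY l.+1) w + nrm k (fun w => enorm (dZ l w)) w))%E}.
Proof.
move=> kN lN.
have m1 := mabs (mdf lN).
have m2 : measurable_fun setT (fun w => `|dY l.+1 w|%:E).
  by apply: mabs; apply: measurable_funB; [exact: mY1|exact: mY2].
have m3 : measurable_fun setT (fun w => (enorm (dZ l w))%:E) by apply/measurable_EFinP; exact: mdZ.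
have p1 w : (0 <= `|df l w|%:E)%E by rewrite lee_fin.
have p2 w : (0 <= `|dY l.+1 w|%:E)%E by rewrite lee_fin.
have p3 w : (0 <= (enorm (dZ l w))%:E)%E by rewrite lee_fin enorm_ge0.
have m23 := emeasurable_funD m2 m3.
have p23 w : (0 <= `|dY l.+1 w|%:E + (enorm (dZ l w))%:E)%E by rewrite adde_ge0.
have mL : measurable_fun setT (fun w => (L l)%:E * (`|dY l.+1 w|%:E + (enorm (dZ l w))%:E))%E.
  exact: measurable_funeM.
have pL w : (0 <= (L l)%:E * (`|dY l.+1 w|%:E + (enorm (dZ l w))%:E))%E.
  by apply: mule_ge0 => //; rewrite lee_fin L0.
have a1 : {ae P, forall w, (`|g l w|%:E <= `|df l w|%:E +
    (L l)%:E * (`|dY l.+1 w|%:E + (enorm (dZ l w))%:E))%E}.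
  apply: filterS (f2Lip lN) => w h; rewrite /g lN.
  rewrite -[X in (_ <= X)%E]/((`|df l w| + L l * (`|dY l.+1 w| + enorm (dZ l w)))%:E).
  rewrite lee_fin.
  have := h (Y1 l.+1 w) (Y2 l.+1 w) (Z1 l w) (Z2 l w).
  set a := f1 _ _ _ _; set b := f2 _ _ _ _; set c := f2 _ _ _ _.
  move=> hl; rewrite (_ : a - c = (a - b) + (b - c)); last by ring.
  by rewrite (le_trans (ler_normD _ _))// lerD2l.
have a2 := enrm_le (sF kN) (FM kN) (mabs (mg l)) (emeasurable_funD m1 mL)
  (fun w => normr_ge0 _ : (0 <= `|g l w|%:E)%E) a1.
have a3 := enrmD P (sF kN) (FM kN) m1 mL p1 pL.
have a4 := enrmZ P (sF kN) (FM kN) (L0 lN) m23.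
have a5 := enrmD P (sF kN) (FM kN) m2 m3 p2 p3.
apply: filterS2 (filterI a2 a3) (filterI a4 a5) => w [b2 b3] [b4 b5].
apply: (le_trans b2); apply: (le_trans b3); rewrite b4 !nabs leeD2l//.
apply: lee_wpmul2l; first by rewrite lee_fin L0.
rewrite (_ : (fun w => `|enorm (dZ l w)|%:E) = (fun w => (enorm (dZ l w))%:E))//.
by apply/funext => w'; rewrite ger0_norm// enorm_ge0.
Qed.

(** Conditioning on [F (t j)] contracts the norm given the coarser [F (t k)]; Minkowski's inequality
    and [driver_gap] do the rest. *)
Lemma recursion_Y k j : (k <= j <= N)%N -> {ae P, forall w,
  (nrm k (dY j) w <= nrm k dxi w + \sum_(j <= l < N)
    (nrm k (df l) w + (L l)%:E * (nrm k (dY l.+1) w + nrm k (fun w => enorm (dZ l w)) w))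
      * (D l)%:E)%E}.
Proof.
move=> /andP[kj jN]; have kN := leq_trans kj jN.
have kjN : (k <= j <= N)%N by rewrite kj.
pose D' l : R := if (l < N)%N then D l else 0.
have D'0 l : 0 <= D' l.
  by rewrite /D'; case: ifPn => // lN; rewrite ltW// (step_gt0 tg).
pose Q l w : \bar R := ((D' l)%:E * `|g l w|%:E)%E.
have mQ l : measurable_fun setT (Q l) by apply: measurable_funeM; exact: mabs.
have Q0 l w : (0 <= Q l w)%E by rewrite mule_ge0 ?lee_fin.
pose W w : \bar R := (`|dxi w|%:E + \sum_(j <= l < N) Q l w)%E.
have mS : measurable_fun setT (fun w => \sum_(j <= l < N) Q l w)%E by exact: emeasurable_sum.
have S0 w : (0 <= \sum_(j <= l < N) Q l w)%E by exact: sume_ge0.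
have mW : measurable_fun setT W by apply: emeasurable_funD => //; exact: mabs.
have x0 w : (0 <= `|dxi w|%:E)%E by rewrite lee_fin.
have W0 w : (0 <= W w)%E by rewrite adde_ge0.
have cj := real_condE_lin (sF jN) (FM jN) 1 (-1) (S1.1 j jN) (S2.1 j jN).
have XW : {ae P, forall w, (`|1 * (xi1 w + \sum_(j <= l < N) f1 l w (Y1 l.+1 w) (Z1 l w) * D l) +
    -1 * (xi2 w + \sum_(j <= l < N) f2 l w (Y2 l.+1 w) (Z2 l w) * D l)|%:E <= W w)%E}.
  apply: aeW => w; rewrite /W.
  rewrite (_ : 1 * _ + _ = dxi w + \sum_(j <= l < N) D' l * g l w).
    rewrite (_ : (\sum_(j <= l < N) Q l w)%E = (\sum_(j <= l < N) D' l * `|g l w|)%:E); last first.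
      by rewrite -sumEFin.
    rewrite -EFinD lee_fin (le_trans (ler_normD _ _))// lerD2l.
    apply: (le_trans (ler_norm_sum _ _ _)); apply: ler_sum => l _.
    by rewrite normrM (ger0_norm (D'0 l)).
  rewrite mul1r mulN1r opprD addrACA; congr (_ + _).
  rewrite -sumrB; apply: eq_big_nat => l /andP[_ lN].
  by rewrite /D' /g lN; ring.
have a1 := enrm_condE_le (sF kN) (sF jN) (Fmono kjN) (FM jN) cj mW W0 XW.
have a2 := enrmD P (sF kN) (FM kN) (mabs mdxi) mS x0 S0.
have a3 := enrm_sum P (sF kN) (FM kN) (index_iota j N) mQ Q0.
have a4 : {ae P, forall w, forall l, (l < N)%N -> (enrm P (F (t k)) (Q l) w <=
    (nrm k (df l) w + (L l)%:E * (nrm k (dY l.+1) w + nrm k (fun w => enorm (dZ l w)) w))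
      * (D l)%:E)%E}.
  apply: ae_forall_count_in => l lN.
  have b1 := enrmZ P (sF kN) (FM kN) (D'0 l) (mabs (mg l)).
  apply: filterS2 b1 (driver_gap kN lN) => w -> h.
  rewrite muleC /D' lN; apply: lee_wpmul2r => //.
  by rewrite lee_fin ltW// (step_gt0 tg).
apply: filterS2 (filterI a1 a2) (filterI a3 a4) => w [b1 b2] [b3 b4].
rewrite cond_norm2E nabs.
rewrite (_ : EFin \o dY j = EFin \o (fun w => 1 * Y1 j w + -1 * Y2 j w)); last first.
  by apply/funext => w' /=; rewrite mul1r mulN1r.
apply: (le_trans b1); apply: (le_trans b2); rewrite leeD2l//.
apply: (le_trans b3); rewrite !big_nat; apply: lee_sum => l /andP[_ lN].
exact: b4.
Qed.

Let HI i j l : (i < j <= N)%N -> P.-integrable setT (EFin \o (fun w => H i j w 0 l)).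
Proof.
by move=> ij; apply/Lfun1_integrable; apply: Lfun_subset12 => //; case: (HL2 ij l).
Qed.

Let mH i j l : (i < j <= N)%N -> measurable_fun setT (fun w => H i j w 0 l).
Proof. by move=> ij; apply/measurable_EFinP; exact: measurable_int (HI l ij). Qed.

Let Hcond i j l : (i < j <= N)%N -> real_condE P (F (t i)) (fun w => H i j w 0 l) (fun=> 0).
Proof.
move=> ij; have iN : (i <= N)%N by case/andP: ij => /ltnW; exact: leq_trans.
have [iX [GX XE]] := real_condE_condE (sF iN) (FM iN) (HI l ij).
have [_ [G0 _]] := real_condE0 P (sF iN).
split=> //; split=> // A GA; have mA := FM iN GA; rewrite -XE//.
apply: ae_eq_integral => //.
- exact: measurable_cst.
- by apply: measurable_funTS; have := measurable_wrt_fun (FM iN) GX.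
- by apply: filterS (Hc ij l) => w h _ /=; rewrite h.
Qed.

Let CM_ge0 i j : 0 <= CM * (t j - t i) `^ (- 2^-1).
Proof. by rewrite mulr_ge0// powR_ge0. Qed.

Let enorm_sum (I : Type) (s : seq I) (v : I -> 'rV[R]_q) :
  enorm (\sum_(m <- s) v m) <= \sum_(m <- s) enorm (v m).
Proof.
elim: s => [|m s ih].
  by rewrite !big_nil; have := enormZ 0 (0 : 'rV[R]_q); rewrite scale0r normr0 mul0r => ->.
by rewrite !big_cons (le_trans (enormD _ _))// lerD2l.
Qed.

(** An instance of [enrm_weighted_le] with the terminal weight as the centered [H] and [E_j dxi] as
    the center. The later weights multiply driver differences and enter only through the bounds on
    their norms. *)
Lemma recursion_Z k j : (k <= j < N)%N -> {ae P, forall w,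
  (nrm k (fun w => enorm (dZ j w)) w <=
    (CM * (T - t j) `^ (- 2^-1))%:E * nrm k (fun w => dxi w - Edxi j w)%R w +
    \sum_(j.+1 <= l < N) (CM * (t l - t j) `^ (- 2^-1))%:E *
     ((nrm k (df l) w + (L l)%:E * (nrm k (dY l.+1) w + nrm k (fun w => enorm (dZ l w)) w))
      * (D l)%:E))%E}.
Proof.
move=> /andP[kj jN]; have kN : (k <= N)%N := leq_trans kj (ltnW jN).
have kjN : (k <= j <= N)%N by rewrite kj ltnW.
have jNN : (j < N <= N)%N by rewrite jN leqnn.
pose D' l : R := if (l < N)%N then D l else 0.
have D'0 l : 0 <= D' l.
  by rewrite /D'; case: ifPn => // lN; rewrite ltW// (step_gt0 tg).
pose G l w : R := D' l * `|g l w|.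
have mG l : measurable_fun setT (G l).
  by apply: measurable_funM => //; exact: measurableT_comp.
have G0 l w : 0 <= G l w by rewrite mulr_ge0.
(* The value 0 outside [j < m <= N] makes measurability and the norm bound hold for every [m]. *)
pose h m w : R := if (j < m <= N)%N then enorm (H j m w) else 0.
have mh m : measurable_fun setT (h m).
  rewrite /h; have [jm|jm] := boolP (j < m <= N)%N; last exact: measurable_cst.
  by apply: measurable_enorm => l; exact: mH.
have h0 m w : 0 <= h m w by rewrite /h; case: ifPn => // _; exact: enorm_ge0.
pose X1 (l : 'I_q) w := xi1 w * H j N w 0 l
  + \sum_(j.+1 <= m < N) f1 m w (Y1 m.+1 w) (Z1 m w) * H j m w 0 l * D m.
pose X2 (l : 'I_q) w := xi2 w * H j N w 0 l
  + \sum_(j.+1 <= m < N) f2 m w (Y2 m.+1 w) (Z2 m w) * H j m w 0 l * D m.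
pose X w : 'rV[R]_q := \row_l (X1 l w - X2 l w).
have cX l : real_condE P (F (t j)) (fun w => X w 0 l) (fun w => (dZ j w) 0 l).
  have := real_condE_lin (sF (ltnW jN)) (FM (ltnW jN)) 1 (-1) (S1.2 j jN l) (S2.2 j jN l).
  have -> : (fun w => 1 * Z1 j w 0 l + -1 * Z2 j w 0 l) = (fun w => (dZ j w) 0 l).
    by apply/funext => w; rewrite !mxE mul1r mulN1r.
  rewrite -/(X1 l) -/(X2 l) => c.
  have -> // : (fun w => X w 0 l) = (fun w => 1 * X1 l w + -1 * X2 l w).
  by apply/funext => w; rewrite !mxE mul1r mulN1r.
have Xdef w : X w = dxi w *: H j N w + \sum_(j.+1 <= m < N) (D' m * g m w) *: H j m w.
  apply/rowP => l; rewrite !mxE summxE /X1 /X2 opprD addrACA -mulrBl; congr (_ + _).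
  rewrite -sumrB; apply: eq_big_nat => m /andP[_ mN].
  by rewrite mxE /D' /g mN; ring.
have bnd r w : enorm (X w - r *: H j N w) <=
    `|dxi w - r| * enorm (H j N w) + \sum_(m <- index_iota j.+1 N) G m w * h m w.
  rewrite Xdef addrAC -scalerBl; apply: (le_trans (enormD _ _)).
  rewrite enormZ lerD2l; apply: (le_trans (enorm_sum _ _)).
  rewrite big_nat [leRHS]big_nat; apply: ler_sum => m /andP[jm mN].
  by rewrite enormZ /h jm (ltnW mN) normrM (ger0_norm (D'0 m)).
have HkH : {ae P, forall w, (enrm P (F (t j)) (fun w => (enorm (H j N w))%:E) w <=
    (CM * (t N - t j) `^ (- 2^-1))%:E)%E}.
  by apply: filterS (HM jNN) => w; rewrite cond_norm2E.
have hk m : {ae P, forall w, (enrm P (F (t j)) (EFin \o h m) w <=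
    (CM * (t m - t j) `^ (- 2^-1))%:E)%E}.
  have [jm|jm] := boolP (j < m <= N)%N.
    apply: filterS (HM jm) => w; rewrite cond_norm2E.
    by rewrite (_ : EFin \o h m = EFin \o (fun w' => enorm (H j m w')))// /h jm.
  apply: filterS (enrm0 P (sF (ltnW jN)) (FM (ltnW jN))) => w e.
  rewrite (_ : EFin \o h m = fun=> 0%E); last first.
    by apply/funext => w'; rewrite /= /h (negbTE jm).
  by rewrite e lee_fin.
have Ge : measurable_wrt (F (t j)) (Edxi j).
  exact: (measurable_wrt_fine_condE (sF (ltnW jN)) (FM (ltnW jN)) dxiI).
have a1 := enrm_weighted_le (sF kN) (sF (ltnW jN)) (Fmono kjN) (FM (ltnW jN))
  cX (fun l => Hcond l jNN) mdxi Ge mG G0 mh h0 (CM_ge0 j N) (CM_ge0 j) HkH hk bnd.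
have a2 : {ae P, forall w, forall l, (l < N)%N -> (enrm P (F (t k)) (EFin \o G l) w <=
    (nrm k (df l) w + (L l)%:E * (nrm k (dY l.+1) w + nrm k (fun w => enorm (dZ l w)) w))
      * (D l)%:E)%E}.
  apply: ae_forall_count_in => l lN.
  have b1 := enrmZ P (sF kN) (FM kN) (D'0 l) (mabs (mg l)).
  apply: filterS2 b1 (driver_gap kN lN) => w.
  rewrite -[X in enrm _ _ X _ = _]/(EFin \o G l) => -> hg.
  rewrite muleC /D' lN; apply: lee_wpmul2r => //.
  by rewrite lee_fin ltW// (step_gt0 tg).
have tN : t N = T by case: tg.
apply: filterS2 a1 a2 => w b1 b2.
rewrite cond_norm2E nabs; apply: (le_trans b1).
rewrite tN leeD2l// !big_nat; apply: lee_sum => l /andP[_ lN].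
by rewrite lee_wpmul2l ?lee_fin// b2.
Qed.

Let dxi_real i : (i <= N)%N -> real_condE P (F (t i)) dxi (Edxi i).
Proof. by move=> iN; exact: (real_condE_condE (sF iN) (FM iN) dxiI). Qed.

(** Orthogonality of the residual would give the constant 1. The triangle inequality and the
    contraction property give 2, which the choice of [Gamma] absorbs. *)
Lemma nrm_residual_le k i (U V : Omega -> R) : (k <= i <= N)%N ->
  real_condE P (F (t i)) U V ->
  {ae P, forall w, (nrm k (fun w => U w - V w)%R w <= 2%:E * nrm k U w)%E}.
Proof.
move=> /andP[ki iN] c; have kN := leq_trans ki iN.
have kiN : (k <= i <= N)%N by rewrite ki.
have mU : measurable_fun setT U by case: c => iU _; apply/measurable_EFinP; exact: measurable_int iU.
have mV := mcond iN c.
have p (Q : Omega -> R) w : (0 <= `|Q w|%:E)%E by rewrite lee_fin.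
have a1 := enrm_condE_le (sF kN) (sF iN) (Fmono kiN) (FM iN) c (mabs mU) (p U)
  (aeW _ (fun w => lexx _)).
have a2 := enrmD P (sF kN) (FM kN) (mabs mU) (mabs mV) (p U) (p V).
have a3 : {ae P, forall w, (enrm P (F (t k)) (fun w => `|U w - V w|%:E) w <=
    enrm P (F (t k)) (fun w => `|U w|%:E + `|V w|%:E)%E w)%E}.
  apply: (enrm_le (sF kN) (FM kN)).
  - by apply: mabs; exact: measurable_funB.
  - by apply: emeasurable_funD; exact: mabs.
  - by move=> w; exact: (p (fun w => U w - V w)).
  - by apply: aeW => w; rewrite -EFinD lee_fin ler_normB.
apply: filterS3 a1 a2 a3 => w b1 b2 b3; rewrite !nabs.
apply: (le_trans b3); apply: (le_trans b2).
by rewrite enrm_abs in b1; rewrite mule_natl mule2n leeD2l.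
Qed.

Lemma residual_le_total k i : (k <= i <= N)%N -> {ae P, forall w,
  (nrm k (fun w => dxi w - Edxi i w)%R w <= 2%:E * nrm k dxi w)%E}.
Proof.
by move=> kiN; apply: (nrm_residual_le kiN (dxi_real _)); case/andP: kiN.
Qed.

(** [E_i dxi] is already [F (t l)]-measurable, so subtracting it from [dxi] does not change the
    residual at [l]; the previous bound is applied to [dxi - E_i dxi]. *)
Lemma residual_le_residual k i l : (k <= i <= l)%N -> (l <= N)%N -> {ae P, forall w,
  (nrm k (fun w => dxi w - Edxi l w)%R w <= 2%:E * nrm k (fun w => dxi w - Edxi i w)%R w)%E}.
Proof.
move=> /andP[ki il] lN; have iN := leq_trans il lN; have kN := leq_trans ki iN.
have klN : (k <= l <= N)%N by rewrite (leq_trans ki il).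
have ilN : (i <= l <= N)%N by rewrite il.
have ci := dxi_real iN; have cl := dxi_real lN.
have iE : P.-integrable setT (EFin \o Edxi i).
  by case: ci => iX c; exact: (is_condE_integrable (sF iN) (FM iN) iX c).
have Gl : measurable_wrt (F (t l)) (Edxi i).
  move=> B mB; apply: (Fmono ilN).
  exact: (measurable_wrt_fine_condE (sF iN) (FM iN) dxiI).
have ce := real_condE_id (sF lN) Gl iE.
have := real_condE_lin (sF lN) (FM lN) 1 (-1) cl ce.
have -> : (fun w => 1 * dxi w + -1 * Edxi i w) = (fun w => dxi w - Edxi i w).
  by apply/funext => w; rewrite mul1r mulN1r.
have -> : (fun w => 1 * Edxi l w + -1 * Edxi i w) = (fun w => Edxi l w - Edxi i w).
  by apply/funext => w; rewrite mul1r mulN1r.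
move=> /(nrm_residual_le klN).
have -> // : (fun w => dxi w - Edxi i w - (Edxi l w - Edxi i w)) = (fun w => dxi w - Edxi l w).
by apply/funext => w; ring.
Qed.

Lemma nrm_dxi_fin k : (k <= N)%N -> {ae P, forall w, nrm k dxi w \is a fin_num}.
Proof.
move=> kN.
have /integrableP[m2 i2] := Lfun2_integrable_sqr dxiL.
have p w : (0 <= (EFin \o (fun x => dxi x ^+ 2)%R) w)%E by rewrite lee_fin sqr_ge0.
have i3 : (\int[P]_w (EFin \o (fun x => dxi x ^+ 2)%R) w < +oo)%E.
  by move: i2; under eq_integral do rewrite gee0_abs//.
apply: filterS (nnE_fin (sF kN) (FM kN) m2 p i3) => w h; rewrite cond_norm2E /enrm.
rewrite sqrte_fin_num ?nnE_ge0//; move: h; congr (_ \is a fin_num).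
Qed.

End recursion.

Theorem proposition2p5 (R : realType) :
  exists (Bc : R -> R -> R -> R) (Gc : R -> R -> R -> R -> R -> R),
  forall (T Rpi thetaL Lf2 CM : R) (N : nat) (t : nat -> R)
    (d : measure_display) (Omega : measurableType d) (P : probability Omega R)
    (F : R -> set_system Omega) (q : nat)
    (H : nat -> nat -> Omega -> 'rV[R]_q)
    (xi1 xi2 : Omega -> R) (f1 f2 : nat -> Omega -> R -> 'rV[R]_q -> R)
    (Y1 Y2 : nat -> Omega -> R) (Z1 Z2 : nat -> Omega -> 'rV[R]_q),
  0 < T -> 0 < Rpi -> 0 < thetaL <= 1 -> 0 <= Lf2 -> 0 <= CM ->
  time_grid T N t -> step_ratio_le N t Rpi ->
  augmented_filtration P T F ->
  (forall i j, (i < j <= N)%N -> forall l : 'I_q,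
     L2 P (F T) (fun w => H i j w 0 l)) ->
  (forall i j, (i < j <= N)%N -> forall l : 'I_q,
     {ae P, forall w, condE P (F (t i)) (fun w' => (H i j w' 0 l)%:E) w = 0%E}) ->
  (forall i j, (i < j <= N)%N ->
     {ae P, forall w, (cond_norm2 P (F (t i)) (fun w' => enorm (H i j w')) w
        <= (CM * (t j - t i) `^ (- 2^-1))%:E)%E}) ->
  L2 P (F T) xi1 -> L2 P (F T) xi2 ->
  (forall i, (i < N)%N -> jointly_measurable (f1 i)) ->
  (forall i, (i < N)%N -> jointly_measurable (f2 i)) ->
  solves_MWDP P F N t H xi1 f1 Y1 Z1 ->
  solves_MWDP P F N t H xi2 f2 Y2 Z2 ->
  (forall i, (i < N)%N -> L2 P (F T) (fun w => f1 i w (Y1 i.+1 w) (Z1 i w))) ->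
  (forall i, (i < N)%N ->
     {ae P, forall w, forall (y y' : R) (z z' : 'rV[R]_q),
        `|f2 i w y z - f2 i w y' z'|
          <= Lf2 / (T - t i) `^ ((1 - thetaL) / 2)
             * (`|y - y'| + enorm (z - z'))}) ->
  let c := Lf2 * (CM + Num.sqrt T) in
  let B := Bc Rpi in
  let G := Gc c T thetaL Rpi in
  let dY i w := Y1 i w - Y2 i w in
  let dZ i w := Z1 i w - Z2 i w in
  let dxi w := xi1 w - xi2 w in
  let df i w := f1 i w (Y1 i.+1 w) (Z1 i w) - f2 i w (Y1 i.+1 w) (Z1 i w) in
  let Edxi i w := fine (condE P (F (t i)) (fun w' => (dxi w')%:E) w) in
  let nrm k (U : Omega -> R) := cond_norm2 P (F (t k)) U in
  let Cy1 := 1 + Lf2 * G 1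
    * (CM * B (thetaL / 2) 1 + B (2^-1 + thetaL / 2) 1 * Num.sqrt T)
    * T `^ (thetaL / 2) in
  let Cy2 := 1 + Lf2 * G 1 * (CM + Num.sqrt T) * B (thetaL / 2) 1
    * T `^ (thetaL / 2) in
  let Cz1 := CM * (1 + Lf2 * G 2^-1 * CM * B (thetaL / 2) 2^-1
    * T `^ (thetaL / 2)) in
  let Cz2 := CM * (1 + Lf2 * G 2^-1 * (CM + Num.sqrt T) * B (thetaL / 2) 2^-1
    * T `^ (thetaL / 2)) in
  let Cz3 := CM * Lf2 * G 2^-1 * B (2^-1 + thetaL / 2) 2^-1 in
  [/\ kernel_sum_bounds N t B,
      gronwall_bound T N t thetaL c 2^-1 (G 2^-1)
        /\ gronwall_bound T N t thetaL c 1 (G 1),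
      forall k i, (k <= i <= N)%N -> {ae P, forall w,
        (nrm k (dY i) w
          <= Cy1%:E * nrm k dxi w
             + Cy2%:E * \sum_(i <= j < N) nrm k (df j) w * (step t j)%:E)%E} &
      forall k i, (k <= i < N)%N -> {ae P, forall w,
        (nrm k (fun w' => enorm (dZ i w')) w
          <= Cz1%:E * (nrm k (fun w' => (dxi w' - Edxi i w')%R) w
                        * (Num.sqrt (T - t i))^-1%:E)
             + Cz2%:E * \sum_(i.+1 <= j < N)
                 nrm k (df j) w * ((Num.sqrt (t j - t i))^-1)%:E * (step t j)%:E
             + Cz3%:E * nrm k dxi w * ((T - t i) `^ (thetaL / 2))%:E)%E}].
Proof.
exists (@kernel_cst R), (fun c T th Rpi g => 4 * expR (damping T Rpi th c g * T)).
move=> T Rpi theta Lf CM N t d Omega P F q H xi1 xi2 f1 f2 Y1 Y2 Z1 Z2.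
move=> T0 Rpi0 theta01 Lf0 CM0 tg tr fF HL2 Hc HM xi1L xi2L jm1 jm2 S1 S2 _ f2Lip.
move=> c B G dY dZ dxi df Edxi nrm Cy1 Cy2 Cz1 Cz2 Cz3.
have c0 : 0 <= c by rewrite mulr_ge0// addr_ge0// sqrtr_ge0.
have half0 : 0 < 2^-1 :> R by rewrite invr_gt0.
have nrm0 k U w : (0 <= nrm k U w)%E by exact: sqrte_ge0.
split.
- exact: kernel_sum_boundsP tg Rpi0 tr.
- by split; apply: gronwall_boundP.
- move=> k i /andP[ki iN]; have kN := leq_trans ki iN.
  have kY j : (i <= j <= N)%N -> (k <= j <= N)%N by lia_idx.
  have kZ j : (i <= j < N)%N -> (k <= j < N)%N by lia_idx.
  have kX j : (i <= j < N)%N -> (k <= j <= N)%N by lia_idx.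
  have aY := ae_forall_count_in (fun j h =>
    recursion_Y Lf0 tg fF xi1L xi2L jm1 jm2 S1 S2 f2Lip (kY j h)).
  have aZ := ae_forall_count_in (fun j h =>
    recursion_Z Lf0 CM0 tg fF HL2 Hc HM xi1L xi2L jm1 jm2 S1 S2 f2Lip (kZ j h)).
  have ax := ae_forall_count_in (fun j h => residual_le_total tg fF xi1L xi2L (kX j h)).
  (* Outside a single null set all the recursive inequalities hold at once, and the deterministic
     estimate applies at that [w]. *)
  apply: filterS2 (filterI aY aZ) (filterI ax (nrm_dxi_fin tg fF xi1L xi2L kN)).
  move=> w [hY hZ] [hx xfin].
  exact: (Y_path T0 tg Rpi0 theta01 Lf0 CM0 (x := nrm k dxi w) (phi := fun l => nrm k (df l) w)
    (Y := fun l => nrm k (dY l) w) (Z := fun l => nrm k (fun w' => enorm (dZ l w')) w)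
    (delta := fun l => nrm k (fun w' => dxi w' - Edxi l w') w)).
- move=> k i /andP[ki iN]; have kN := leq_trans ki (ltnW iN).
  have kY j : (i <= j <= N)%N -> (k <= j <= N)%N by lia_idx.
  have kZ j : (i <= j < N)%N -> (k <= j < N)%N by lia_idx.
  have kX j : (i <= j < N)%N -> (k <= j <= N)%N by lia_idx.
  have kD j : (i <= j < N)%N -> (k <= i <= j)%N by lia_idx.
  have jN j : (i <= j < N)%N -> (j <= N)%N by lia_idx.
  have aY := ae_forall_count_in (fun j h =>
    recursion_Y Lf0 tg fF xi1L xi2L jm1 jm2 S1 S2 f2Lip (kY j h)).
  have aZ := ae_forall_count_in (fun j h =>
    recursion_Z Lf0 CM0 tg fF HL2 Hc HM xi1L xi2L jm1 jm2 S1 S2 f2Lip (kZ j h)).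
  have ax := ae_forall_count_in (fun j h => residual_le_total tg fF xi1L xi2L (kX j h)).
  have ad := ae_forall_count_in (fun j h =>
    residual_le_residual tg fF xi1L xi2L (kD j h) (jN j h)).
  apply: filterS3 (filterI aY aZ) (filterI ax ad) (nrm_dxi_fin tg fF xi1L xi2L kN).
  move=> w [hY hZ] [hx hd] xfin.
  exact: (Z_path T0 tg Rpi0 tr theta01 Lf0 CM0 (x := nrm k dxi w) (phi := fun l => nrm k (df l) w)
    (Y := fun l => nrm k (dY l) w) (Z := fun l => nrm k (fun w' => enorm (dZ l w')) w)
    (delta := fun l => nrm k (fun w' => dxi w' - Edxi l w') w)).
Qed.
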